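(* For almost all primes $p$ (i.e. all but finitely many), the local normal zeta function of $F_{2,4}$ is $$\zeta^{\triangleleft}_{F_{2,4},p}(s)=\zeta_{\mathbb{Z}^4,p}(s)\,\zeta_p(10s-24)\cdot\Big(W_0(p,p^{-s})+\mathfrak{n}_1(p)W_1(p,p^{-s})+\mathfrak{n}_2(p)W_2(p,p^{-s})+\mathfrak{n}_3(p)W_3(p,p^{-s})\Big),$$ where $$\mathfrak{n}_1(p)=(p^2+1)(p^2+p+1),\quad \mathfrak{n}_2(p)=(p+1)(p^2+1)(p^2+p+1),\quad \mathfrak{n}_3(p)=(p^2+1)(p+1),$$ and, for $i=0,1,2,3$, $$W_i(p,p^{-s})=I_{5-i}(X_5,\dots,X_{i+1})\,E_i(X_i,Y_i)\,I_{i-1}(Y_{i-1},\dots,Y_1),$$ with the convention $E_0=I_{-1}=I_0=1$, and with numerical data $$X_i=p^{i(10-i)-(4+i)s},\qquad Y_1=p^{8-3s},\quad Y_2=p^{13-5s},\quad Y_3=p^{15-6s}.$$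
   Context: $F_{2,4}=F_4/\gamma_3(F_4)$ is the free nilpotent group of class two on four generators ($F_4$ the free group on four generators, $\gamma_3$ the third term of the lower central series); it has a presentation with generators $x_1,\dots,x_4,y_1,\dots,y_6$, relations $[x_1,x_2]=y_1$, $[x_1,x_3]=y_2$, $[x_1,x_4]=y_3$, $[x_2,x_3]=y_4$, $[x_2,x_4]=y_5$, $[x_3,x_4]=y_6$, and the $y_j$ central. For a finitely generated group $G$, $a_n^{\triangleleft}(G)$ is the number of normal subgroups of index $n$ in $G$; for a prime $p$, $\zeta^{\triangleleft}_{G,p}(s)=\sum_{n\ge 0}a^{\triangleleft}_{p^n}(G)p^{-ns}$. Also $\zeta_p(s)=\frac{1}{1-p^{-s}}$ and $\zeta_{\mathbb{Z}^4,p}(s)=\zeta_p(s)\zeta_p(s-1)\zeta_p(s-2)\zeta_p(s-3)$. Igusa factor: for $n\ge1$ and $\mathbf{U}=(U_1,\dots,U_n)$, $$I_n(\mathbf U)=\sum_{I\subseteq\{1,\dots,n\}}b_I(p^{-1})\prod_{i\in I}\frac{U_i}{1-U_i},$$ where $b_I(p)$ is the polynomial in $p$ (product of $p$-binomial coefficients, independent of $p$) giving the number of $\mathbb{F}_p$-points of the variety of flags of type $I$ in $\mathbb{P}^{n}$, i.e. the number of flags of subspaces of $\mathbb{F}_p^{n+1}$ whose dimensions are the elements of $I$; $b_\emptyset=1$. $b_I(p^{-1})$ means the polynomial $b_I$ evaluated at $p^{-1}$. Exceptional factor: for $i=1,2,3$, $$E_i(X_i,Y_i)=\frac{p^{-d_i}Y_i-p^{-n_i}X_i}{(1-X_i)(1-Y_i)},$$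 where $d_i$ is the dimension of the Fano variety of $(i-1)$-dimensional linear subspaces lying on the Pfaffian hypersurface $y_1y_6-y_2y_5+y_3y_4=0$ in $\mathbb{P}^5$ (a smooth quadric four-fold), and $n_i$ is the dimension of the variety of $(i-1)$-dimensional linear subspaces of $\mathbb{P}^5$. Thus $(d_1,d_2,d_3)=(4,5,3)$ and $n_i=i(6-i)$, so $(n_1,n_2,n_3)=(5,8,9)$. *)

(* Defs.v *)
From HB Require Import structures.
From mathcomp Require Import all_boot all_order all_algebra.
From mathcomp Require Import generic_quotient finmap.
From mathcomp Require Import all_classical all_reals all_analysis.
From mathcomp Require Import complex.

Set Implicit Arguments.
Unset Strict Implicit.
Unset Printing Implicit Defensive.

Import Order.TTheory GRing.Theory Num.Theory.
Import numFieldNormedType.Exports.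

Local Open Scope classical_set_scope.
Local Open Scope card_scope.
Local Open Scope quotient_scope.
Local Open Scope group_scope.

Definition is_subgroup (G : groupType) (H : set G) : Prop :=
  [/\ H 1, forall x y, H x -> H y -> H (x * y) & forall x, H x -> H x^-1].

Definition is_normal (G : groupType) (N : set G) : Prop :=
  is_subgroup N /\ forall x y, N x -> N (x ^ y).

Definition generated (G : groupType) (A : set G) : set G :=
  \bigcap_(H in [set H : set G | is_subgroup H /\ A `<=` H]) H.

Definition commutator_subgroup (G : groupType) (H K : set G) : set G :=
  generated [set [~ x, y] | x in H & y in K].

(* gamma_1 = G and gamma_(n+1) = [gamma_n, G]; the junk value at 0 is G. *)
Definition lower_central (G : groupType) (n : nat) : set G :=
  iter n.-1 (fun H : set G => commutator_subgroup H [set: G]) [set: G].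

Lemma is_subgroup_generated (G : groupType) (A : set G) :
  is_subgroup (generated A).
Proof.
split=> [H [[]]//|x y Ax Ay H HA|x Ax H HA].
  by case: (HA.1) => _ HM _; apply: HM; [exact: Ax|exact: Ay].
by case: (HA.1) => _ _; apply; exact: Ax.
Qed.

Lemma sub_generated (G : groupType) (A : set G) : A `<=` generated A.
Proof. by move=> x Ax H [_]; apply. Qed.

Lemma is_normal_generated (G : groupType) (A : set G) :
  (forall x y, A x -> A (x ^ y)) -> is_normal (generated A).
Proof.
move=> AJ; split=> [|x y]; first exact: is_subgroup_generated.
have [g1 gM gV] := is_subgroup_generated A.
move=> /(_ [set x | generated A (x ^ y)]); apply; split; last first.
  by move=> z Az; apply: sub_generated; exact: AJ.
split=> [|u v|u] /=; rewrite ?conj1g ?conjMg ?conjVg //; [exact: gM|exact: gV].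
Qed.

Lemma is_normal_lower_central (G : groupType) (n : nat) :
  is_normal (@lower_central G n).
Proof.
rewrite /lower_central; elim: n.-1 => [|m [_ mJ]] //=.
apply: is_normal_generated => _ y [u mu [v _ <-]].
rewrite conjRg; exists (u ^ y); first exact: mJ.
by exists (v ^ y).
Qed.

Record normal_subgroup (G : groupType) := NormalSubgroup {
  normal_set : set G;
  normal_setP : is_normal normal_set
}.

Section QuotientGroup.
Variables (G : groupType) (N : normal_subgroup G).

Definition coset_rel : rel G := fun x y => `[< normal_set N (x^-1 * y) >].

Lemma coset_relP x y : reflect (normal_set N (x^-1 * y)) (coset_rel x y).
Proof. exact: asboolP. Qed.

Lemma coset_rel_refl : reflexive coset_rel.
Proof.
by move=> x; apply/coset_relP; rewrite mulVg; case: (normal_setP N) => [[]].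
Qed.

Lemma coset_rel_sym : symmetric coset_rel.
Proof.
case: (normal_setP N) => [[_ _ NV] _].
by move=> x y; apply/idP/idP => /coset_relP/NV;
  rewrite invgM invgK => ?; apply/coset_relP.
Qed.

Lemma coset_rel_trans : transitive coset_rel.
Proof.
case: (normal_setP N) => [[_ NM _] _].
move=> y x z /coset_relP Nxy /coset_relP Nyz; apply/coset_relP.
by have := NM _ _ Nxy Nyz; rewrite mulgA mulgK.
Qed.

Canonical coset_equiv :=
  EquivRel coset_rel coset_rel_refl coset_rel_sym coset_rel_trans.

Definition quotient_group : Type := {eq_quot coset_equiv}.
HB.instance Definition _ := Choice.on quotient_group.

Definition quotient_proj (x : G) : quotient_group :=
  (\pi_({eq_quot coset_equiv}) x).
Definition quotient_repr (x : quotient_group) : G :=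
  repr (x : {eq_quot coset_equiv}).

Lemma quotient_reprK : cancel quotient_repr quotient_proj.
Proof. exact: reprK. Qed.

Lemma quotient_projP x y :
  reflect (quotient_proj x = quotient_proj y) (coset_rel x y).
Proof. exact: (@eqmodP _ coset_equiv x y). Qed.

Definition quotient_one : quotient_group := quotient_proj 1.
Definition quotient_mul (x y : quotient_group) : quotient_group :=
  quotient_proj (quotient_repr x * quotient_repr y).
Definition quotient_inv (x : quotient_group) : quotient_group :=
  quotient_proj (quotient_repr x)^-1.

Lemma quotient_projM x y :
  quotient_mul (quotient_proj x) (quotient_proj y) = quotient_proj (x * y).
Proof.
have [[_ NM _] NJ] := normal_setP N.
have repr_rel z : normal_set N ((quotient_repr (quotient_proj z))^-1 * z).
  by apply/coset_relP/quotient_projP; rewrite quotient_reprK.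
apply/quotient_projP/coset_relP.
set a := quotient_repr _; set b := quotient_repr _.
have -> : (a * b)^-1 * (x * y) = ((a^-1 * x) ^ b) * (b^-1 * y).
  by rewrite /conjg invgM !mulgA mulgK.
by apply: NM; [apply: NJ|]; exact: repr_rel.
Qed.

Lemma quotient_projV x : quotient_inv (quotient_proj x) = quotient_proj x^-1.
Proof.
have [[_ _ NV] NJ] := normal_setP N.
apply/quotient_projP/coset_relP; set a := quotient_repr _.
have /NV/(fun h => NJ _ x^-1 h) : normal_set N (a^-1 * x).
  by apply/coset_relP/quotient_projP; rewrite quotient_reprK.
by rewrite /conjg !(invgM, invgK) !mulgA mulgV mul1g.
Qed.

Let quotientW (P : quotient_group -> Prop) :
  (forall x, P (quotient_proj x)) -> forall x, P x.
Proof. by move=> PP x; rewrite -[x]quotient_reprK. Qed.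

Lemma quotient_mulA : associative quotient_mul.
Proof.
by elim/quotientW=> x; elim/quotientW=> y; elim/quotientW=> z;
  rewrite !quotient_projM mulgA.
Qed.

Lemma quotient_mul1 : left_id quotient_one quotient_mul.
Proof. by elim/quotientW=> x; rewrite quotient_projM mul1g. Qed.

Lemma quotient_mulr1 : right_id quotient_one quotient_mul.
Proof. by elim/quotientW=> x; rewrite quotient_projM mulg1. Qed.

Lemma quotient_mulV : left_inverse quotient_one quotient_inv quotient_mul.
Proof. by elim/quotientW=> x; rewrite quotient_projV quotient_projM mulVg. Qed.

Lemma quotient_mulrV : right_inverse quotient_one quotient_inv quotient_mul.
Proof. by elim/quotientW=> x; rewrite quotient_projV quotient_projM mulgV. Qed.

HB.instance Definition _ := isGroup.Build quotient_group
  quotient_mulA quotient_mul1 quotient_mulr1 quotient_mulV quotient_mulrV.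

End QuotientGroup.

(* Free groups as groups of reduced words: the letter (x, true) stands for the *)
(* generator x and (x, false) for its inverse.                                 *)
Section FreeGroup.
Variable T : choiceType.
Implicit Types (a b : T * bool) (w x y z : seq (T * bool)).

Definition letter_inv a : T * bool := (a.1, ~~ a.2).

Definition reduced w : bool := sorted (fun a b => b != letter_inv a) w.

Definition word_push a w : seq (T * bool) :=
  if w is b :: w' then if b == letter_inv a then w' else a :: w else [:: a].

Definition word_mul x y : seq (T * bool) := foldr word_push y x.

Definition word_inv x : seq (T * bool) := rev (map letter_inv x).

Lemma letter_invK : involutive letter_inv.
Proof. by case=> t b; rewrite /letter_inv /= negbK. Qed.

Lemma reduced_push a w : reduced w -> reduced (word_push a w).
Proof.
case: w => [|b w] //= rw; case: ifPn => [_|nba]; first exact: path_sorted rw.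
by rewrite /= nba.
Qed.

Lemma word_pushK a w : reduced w -> word_push a (word_push (letter_inv a) w) = w.
Proof.
case: w => [|b w] /=; first by rewrite eqxx.
rewrite letter_invK; case: eqP => [->|_] rw; last by rewrite /= eqxx.
by case: w rw => [|c w] //= /andP[/negPf->].
Qed.

Lemma reduced_mul x y : reduced y -> reduced (word_mul x y).
Proof. by move=> ry; elim: x => //= a x; exact: reduced_push. Qed.

Lemma reduced_inv x : reduced x -> reduced (word_inv x).
Proof.
rewrite /reduced /word_inv rev_sorted sorted_map; congr is_true.
case: x => //= a x; apply: eq_path => b c /=.
by rewrite (inj_eq (inv_inj letter_invK)) eq_sym (can2_eq letter_invK letter_invK).
Qed.

Lemma word_mul_push a y z :
  reduced z -> word_mul (word_push a y) z = word_push a (word_mul y z).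
Proof.
move=> rz; case: y => [|b y] //=; case: eqP => //= ->.
by rewrite word_pushK// reduced_mul.
Qed.

Lemma word_mulA x y z :
  reduced z -> word_mul x (word_mul y z) = word_mul (word_mul x y) z.
Proof. by move=> rz; elim: x => //= a x ->; rewrite word_mul_push. Qed.

Lemma word_mul1 x : reduced x -> word_mul x [::] = x.
Proof.
elim: x => //= a x IHx rx; rewrite IHx; last exact: path_sorted rx.
by case: x rx {IHx} => //= b x /andP[/negPf->].
Qed.

Lemma word_mulV x : word_mul (word_inv x) x = [::].
Proof.
elim: x => //= a x IHx.
by rewrite /word_inv /= rev_cons -cats1 /word_mul foldr_cat /= letter_invK eqxx.
Qed.

Lemma word_invK : involutive word_inv.
Proof.
move=> x; rewrite /word_inv map_rev revK -map_comp -[RHS]map_id.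
by apply: eq_map; exact: letter_invK.
Qed.

Definition free_group : Type := {w : seq (T * bool) | reduced w}.
HB.instance Definition _ := Choice.on free_group.

Definition free_one : free_group := exist reduced [::] isT.
Definition free_mul (x y : free_group) : free_group :=
  exist reduced (word_mul (sval x) (sval y)) (reduced_mul (sval x) (svalP y)).
Definition free_inv (x : free_group) : free_group :=
  exist reduced (word_inv (sval x)) (reduced_inv (svalP x)).

Lemma free_mulA : associative free_mul.
Proof. by move=> x y z; apply: val_inj; rewrite /= word_mulA// (svalP z). Qed.

Lemma free_mul1 : left_id free_one free_mul.
Proof. by move=> x; exact: val_inj. Qed.

Lemma free_mulr1 : right_id free_one free_mul.
Proof. by move=> x; apply: val_inj; rewrite /= word_mul1// (svalP x). Qed.

Lemma free_mulV : left_inverse free_one free_inv free_mul.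
Proof. by move=> x; apply: val_inj; rewrite /= word_mulV. Qed.

Lemma free_mulrV : right_inverse free_one free_inv free_mul.
Proof.
by move=> x; apply: val_inj; rewrite /= -{1}[sval x]word_invK word_mulV.
Qed.

HB.instance Definition _ := isGroup.Build free_group
  free_mulA free_mul1 free_mulr1 free_mulV free_mulrV.

End FreeGroup.

Definition F24 : groupType :=
  quotient_group
    (NormalSubgroup (is_normal_lower_central (free_group 'I_4) 3)).

Definition has_index (G : groupType) (N : set G) (n : nat) : Prop :=
  range (fun x : G => [set x * y | y in N]) #= `I_n.

(* fset_set A is the empty finite set when A is infinite; for finitely         *)
(* generated G there are only finitely many normal subgroups of a given index. *)
Definition num_normal_subgroups (G : groupType) (n : nat) : nat :=
  #|` fset_set [set N : set G | is_normal N /\ has_index N n]|.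

Close Scope group_scope.
Local Open Scope ring_scope.
Local Open Scope complex_scope.

Section ComplexTopology.
Variable R : realType.
HB.instance Definition _ := NormedModule.copy R[i] (R[i] : numFieldType)^o.
End ComplexTopology.

Definition cexp (R : realType) (z : R[i]) : R[i] :=
  let: a +i* b := z in (expR a * cos b) +i* (expR a * sin b).

Definition natpow (R : realType) (p : nat) (z : R[i]) : R[i] :=
  cexp ((ln p%:R)%:C * z).

Definition local_normal_zeta_terms (R : realType) (G : groupType) (p : nat)
    (s : R[i]) : (R[i])^nat :=
  fun n => (num_normal_subgroups G (p ^ n)%N)%:R * natpow p (- n%:R * s).

Definition local_normal_zeta (R : realType) (G : groupType) (p : nat)
    (s : R[i]) : R[i] :=
  limn (series (local_normal_zeta_terms G p s)).

Definition zeta_p (R : realType) (p : nat) (s : R[i]) : R[i] :=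
  (1 - natpow p (- s))^-1.

Definition zeta_Z4 (R : realType) (p : nat) (s : R[i]) : R[i] :=
  zeta_p p s * zeta_p p (s - 1) * zeta_p p (s - 2%:R) * zeta_p p (s - 3%:R).

(* Gaussian binomial coefficients, by the q-Pascal rule. *)
Fixpoint gauss_binomial (n k : nat) : {poly int} :=
  match n, k with
  | _, 0 => 1
  | 0, _.+1 => 0
  | n'.+1, k'.+1 =>
      gauss_binomial n' k' + 'X^k * gauss_binomial n' k
  end.

(* For dimensions d_1 < ... < d_l <= m this is the product of the Gaussian     *)
(* binomials [d_(j+1), d_j] with d_(l+1) = m: the number of flags of subspaces *)
(* of dimensions d_1, ..., d_l in an m-dimensional space over F_q, as a        *)
(* polynomial in q.                                                            *)
Fixpoint flag_poly (m : nat) (dims : seq nat) : {poly int} :=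
  if dims is d :: dims' then
    gauss_binomial (head m dims') d * flag_poly m dims'
  else 1.

(* The ordinal i : 'I_n represents the element i.+1 of {1, ..., n}; enum lists *)
(* ordinals in increasing order.                                               *)
Definition b_poly (n : nat) (I : {set 'I_n}) : {poly int} :=
  flag_poly n.+1 [seq (nat_of_ord i).+1 | i <- enum I].

(* The variables U are indexed from 1. *)
Definition igusa (R : realType) (p n : nat) (U : nat -> R[i]) : R[i] :=
  \sum_(I : {set 'I_n})
    (map_poly intr (b_poly I)).[p%:R^-1] *
    \prod_(i in I) (U i.+1 / (1 - U i.+1)).

Definition X_ (R : realType) (p : nat) (s : R[i]) (i : nat) : R[i] :=
  natpow p ((i * (10 - i))%N%:R - (4 + i)%N%:R * s).

Definition Y_ (R : realType) (p : nat) (s : R[i]) (i : nat) : R[i] :=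
  match i with
  | 1 => natpow p (8%:R - 3%:R * s)
  | 2 => natpow p (13%:R - 5%:R * s)
  | 3 => natpow p (15%:R - 6%:R * s)
  | _ => 0
  end.

(* Dimensions of the Fano varieties of (i-1)-dimensional linear subspaces of a *)
(* smooth quadric in P^5.                                                      *)
Definition fano_dim (i : nat) : nat := nth 0%N [:: 0; 4; 5; 3]%N i.

Definition grass_dim (i : nat) : nat := (i * (6 - i))%N.

Definition exceptional (R : realType) (p : nat) (s : R[i]) (i : nat) : R[i] :=
  if i == 0%N then 1 else
  (p%:R ^- fano_dim i * Y_ p s i - p%:R ^- grass_dim i * X_ p s i) /
  ((1 - X_ p s i) * (1 - Y_ p s i)).

(* igusa p 0 _ = 1, and i - 1 = 0 for i = 0, so that I_(-1) = I_0 = 1. *)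
Definition W_ (R : realType) (i p : nat) (s : R[i]) : R[i] :=
  igusa p (5 - i) (fun j => X_ p s (6 - j)) *
  exceptional p s i *
  igusa p (i - 1) (fun j => Y_ p s (i - j)).

Definition n_1 (p : nat) : nat := ((p ^ 2 + 1) * (p ^ 2 + p + 1))%N.
Definition n_2 (p : nat) : nat :=
  ((p + 1) * (p ^ 2 + 1) * (p ^ 2 + p + 1))%N.
Definition n_3 (p : nat) : nat := ((p ^ 2 + 1) * (p + 1))%N.

(* Main.v *)
Require Import Defs.
From HB Require Import structures.
From mathcomp Require Import all_boot all_order all_algebra.
From mathcomp Require Import mxabelem finmap ring lra zify.
From mathcomp Require Import all_classical all_reals all_analysis.
From mathcomp Require Import complex.

(** F24 is identified with the group [heis] on Z^4 x Z^6. For odd p a normal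
    subgroup N of p-power index amounts to its image M in Z^4, its intersection L
    with the centre Z^6, subject to M /\ Z^4 <= L, and a homomorphism M -> Z^6 / L;
    so one counts the pairs (M, L) of indices p^k and p^l with weight p^(4l).

    The map M |-> {x : p x in M}, applied to both lattices, lowers the index by an
    amount depending only on the ranks (d, e) of (M, L) modulo p. A fibre consists
    of pairs of subspaces of F_p^4 and F_p^6 of dimensions d and e, and Cartan's
    lemma shows that the wedge condition forces the second one to contain a
    subspace of dimension 4d - C(d+1, 2) that depends on the first one. Hence the
    generating functions F(d, e) of the pairs of given ranks satisfy a finite,
    triangular linear system with Gaussian binomial coefficients.

    The equations with d = 0 are eliminated by solving the adjoint system, whose
    solution is an Igusa factor by the recursion of the latter in its number of
    variables; the terms with d > 0 give the remaining factors. *)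

(** The multiplication cocycle of [heis] is symmetric modulo L on M, and it becomes a coboundary
    once 2 is invertible modulo L. For odd p this turns the normal subgroups over (M, L) into
    homomorphisms from M, free of rank 4, to Z^6 / L; hence the weight, and hence 2 as the excluded
    prime. The obstacle in the recursion is that a basis matrix of a lattice may be singular modulo
    p. Coordinates are therefore formed over the integers, with respect to a basis of the larger
    lattice, and only then reduced; the kernel of the reduced basis matrix is what the new subspace
    has to avoid. The system is triangular, but each unknown also occurs in its own equation. With h
    the drop of the total index exponent, the coefficient there has modulus at most p^(3h)
    |p^(-s)|^h, which is below 1 for Re s > 3 and h > 0. So the partial sums converge, and these
    loops produce the denominators of the formula. Only the sum over all ranks is wanted, which is
    why an adjoint solution can replace the individual unknowns with d = 0. *)

Set Implicit Arguments.
Unset Strict Implicit.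
Unset Printing Implicit Defensive.

Import Order.TTheory GRing.Theory Num.Theory.
Import numFieldNormedType.Exports.
Local Open Scope ring_scope.

(** * Counting subspaces *)

Section SubspaceCount.
Variable F : finFieldType.
Local Notation q := #|F|%N.

Lemma card_row_submx m n (A : 'M[F]_(m, n)) :
  #|[pred v : 'rV[F]_n | (v <= A)%MS]| = (q ^ \rank A)%N.
Proof. by rewrite -card_rowg; apply: eq_card => v; rewrite mem_rowg. Qed.

Lemma rank_addrow m n (v : 'rV[F]_n) (E : 'M[F]_(m, n)) :
  \rank (v + E)%MS = (~~ (v <= E)%MS + \rank E)%N.
Proof.
have le1 := rank_leq_row v.
have := mxrank_leqif_sup (addsmxSr v E); rewrite addsmx_sub submx_refl andbT.
case: (v <= E)%MS => -[le2]; first by move/eqP.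
move=> /negbT ne; apply/eqP; rewrite eqn_leq [X in _ && X]ltn_neqAle ne le2 andbT.
by rewrite (leq_trans (mxrank_adds_leqif v E).1)// leq_add2r.
Qed.

(** The rows of [B] are chosen one at a time, each outside the span of [D] and the rows already
    chosen. If [f] exceeds the codimension of [D] in [A], one of the factors is exactly 0, so
    truncated subtraction does no harm. *)
Lemma card_frames f k n m (D : 'M[F]_(k, n)) (A : 'M[F]_(m, n)) :
  (D <= A)%MS ->
  #|[pred B : 'M[F]_(f, n) | (B <= A)%MS &&
      (\rank (B + D)%MS == (f + \rank D)%N)]|
  = (\prod_(i < f) (q ^ \rank A - q ^ (\rank D + i)))%N.
Proof.
move=> DA; elim: f => [|f IHf].
  rewrite big_ord0 (eq_card (B := predT)) => [|B].
    by rewrite card_mx mul0n expn0.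
  by rewrite !inE [B]flatmx0 sub0mx add0n; apply/eqP/eqmx_rank/eqmxP/adds0mx.
rewrite big_ord_recr /= -IHf.
transitivity #|[pred B : 'M[F]_(1 + f, n) | (B <= A)%MS &&
      (\rank (B + D)%MS == (f.+1 + \rank D)%N)]|; first by [].
pose h (B : 'M[F]_(1 + f, n)) := (dsubmx B, usubmx B).
pose P := [pred B : 'M[F]_(f, n) | (B <= A)%MS &&
      (\rank (B + D)%MS == (f + \rank D)%N)].
pose Q := [pred u : 'M[F]_(f, n) * 'rV[F]_n |
   (u.1 \in P) && ((u.2 <= A)%MS && ~~ (u.2 <= u.1 + D)%MS)].
have hbij : bijective h.
  exists (fun u => col_mx u.2 u.1) => [B|[u v]]; rewrite /h /=.
    by rewrite vsubmxK.
  by rewrite col_mxKd col_mxKu.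
transitivity #|[pred B : 'M[F]_(1 + f, n) | h B \in Q]|.
  apply: eq_card => B; rewrite !inE /=; set v := usubmx _; set E := dsubmx _.
  have -> : B = col_mx v E by rewrite vsubmxK.
  rewrite col_mx_sub.
  have -> : \rank (col_mx v E + D)%MS = (~~ (v <= E + D)%MS + \rank (E + D)%MS)%N.
    rewrite -rank_addrow; apply/eqmx_rank/andP; split.
      by rewrite addsmx_sub -addsmxE addsmxA addsmxSl addsmxSr.
    by rewrite addsmxA addsmxS // addsmxE.
  have le1 := (mxrank_adds_leqif E D).1; have le2 := rank_leq_row E.
  have le3 : (\rank (E + D) <= f + \rank D)%N.
    by apply: leq_trans le1 _; rewrite leq_add2r.
  case: (v <= E + D)%MS => /=; last by rewrite add1n addSn eqSS andbT -andbA andbC.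
  by rewrite add0n !andbF; apply/negbTE; rewrite negb_and orbC eqn_leq addSn
    negb_and -!ltnNge ltnS le3 orbT.
have -> : #|[pred B : 'M[F]_(1 + f, n) | h B \in Q]| = #|Q|.
  rewrite -(fintype.card_image (bij_inj hbij)); apply: eq_card => u.
  case: hbij => h' hK h'K.
  apply/fintype.imageP/idP => [[B + ->]//|Qu]; exists (h' u); rewrite ?h'K //.
  by rewrite inE /= h'K.
rewrite -sum1_card (eq_bigl (fun u => P u.1 && ((u.2 <= A)%MS && ~~ (u.2 <= u.1 + D)%MS))) //.
rewrite -(pair_big_dep P (fun u v => (v <= A)%MS && ~~ (v <= u + D)%MS)
            (fun _ _ => 1%N)) /=.
rewrite (eq_bigr (fun=> (q ^ \rank A - q ^ (\rank D + f))%N)) => [|B].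
  by rewrite sum_nat_const.
move=> /andP[BA /eqP rBD].
rewrite sum1_card -card_row_submx [(\rank D + f)%N]addnC -rBD -card_row_submx.
rewrite -(cardID [pred v : 'rV[F]_n | (v <= B + D)%MS] [pred v : 'rV[F]_n | (v <= A)%MS]).
rewrite (eq_card (A := [predI _ & _]) (B := [pred v : 'rV[F]_n | (v <= B + D)%MS])).
  by rewrite addnC addnK; apply: eq_card => v; rewrite !inE /= andbC.
move=> v; rewrite !inE /= andbC; apply: andb_idr => vBD.
by apply: submx_trans vBD _; rewrite addsmx_sub BA.
Qed.

(** The equation [<<A>>%MS == A] selects the canonical matrix of each row space, so that counting
    matrices counts subspaces. *)
Definition between n k1 k2 (e : nat) (D : 'M[F]_(k1, n)) (K : 'M[F]_(k2, n)) :=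
  [pred A : 'M[F]_n | [&& <<A>>%MS == A, \rank A == e, (D <= A)%MS
     & (A :&: K <= (0 : 'M[F]_n))%MS]].

(** Double counting of the frames that are independent modulo [D + K]: each of them spans, together
    with [D], one admissible subspace, and inside an admissible [A] a frame modulo [D] stays
    independent modulo [D + K] because [A] misses [K]. *)
Lemma card_between_frames n k1 k2 f (D : 'M[F]_(k1, n)) (K : 'M[F]_(k2, n)) :
  (D :&: K)%MS = 0 ->
  (#|between (f + \rank D) D K| *
     \prod_(i < f) (q ^ (f + \rank D) - q ^ (\rank D + i)))%N =
  (\prod_(i < f) (q ^ n - q ^ (\rank D + \rank K + i)))%N.
Proof.
move=> DK0; under [RHS]eq_bigr do rewrite -{1}(mxrank1 F n) -(mxrank_disjoint_sum DK0).
rewrite -card_frames ?submx1 //.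
rewrite -[RHS]sum1_card.
rewrite (partition_big (fun B : 'M[F]_(f, n) => <<(B + D)%MS>>%MS)
  (mem (between (f + \rank D) D K))) /=.
  rewrite -sum_nat_const; apply: eq_bigr => A /and4P[/eqP gA /eqP rA DA AK0].
  rewrite sum1_card -{1}rA -card_frames //; apply: eq_card => B; rewrite !inE /=.
  rewrite unfold_in inE /= submx1 /=; apply/andP/andP => [[BA /eqP rBD]|[/eqP rBDK /eqP <-]].
    have BDA : (B + D <= A)%MS by rewrite addsmx_sub BA.
    have eqA : (B + D == A)%MS.
      by rewrite -(mxrank_leqif_eq BDA) rBD rA.
    split; last by rewrite -gA; apply/eqP/genmxP.
    rewrite addsmxA mxrank_disjoint_sum ?rBD ?mxrank_disjoint_sum ?addnA//.
    apply/eqP; rewrite -submx0; apply: submx_trans AK0.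
    by apply: capmxS; [exact: BDA|exact: submx_refl].
  rewrite genmxE addsmxSl; split=> //.
  have le1 := (mxrank_adds_leqif B D).1; have le2 := rank_leq_row B.
  have := (mxrank_adds_leqif (B + D)%MS K).1.
  rewrite -addsmxA rBDK mxrank_disjoint_sum // addnA leq_add2r => le3.
  by rewrite eqn_leq le3 andbT (leq_trans le1) // leq_add2r.
move=> B; rewrite inE submx1 /= => /eqP rBDK.
have le1 := (mxrank_adds_leqif B D).1; have le2 := rank_leq_row B.
have := mxrank_adds_leqif (B + D)%MS K.
rewrite -addsmxA rBDK mxrank_disjoint_sum // addnA => -[].
rewrite leq_add2r => le3 eq3.
have rBD : \rank (B + D) = (f + \rank D)%N.
  by apply/eqP; rewrite eqn_leq le3 andbT (leq_trans le1) // leq_add2r.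
rewrite !inE /= genmx_id eqxx !genmxE rBD eqxx addsmxSr /=.
move: eq3; rewrite rBD eqxx => /esym; apply: submx_trans.
by apply: capmxS; rewrite ?genmxE.
Qed.

End SubspaceCount.

Section GaussValue.
Variable K : numFieldType.
Implicit Type x : K.

Definition gauss x n k : K := (map_poly intr (gauss_binomial n k)).[x].

Lemma gaussn0 x n : gauss x n 0 = 1.
Proof. by case: n => [|n]; rewrite /gauss /= rmorph1 hornerC. Qed.

Lemma gauss0S x k : gauss x 0 k.+1 = 0.
Proof. by rewrite /gauss /= rmorph0 horner0. Qed.

Lemma gaussS x n k :
  gauss x n.+1 k.+1 = gauss x n k + x ^+ k.+1 * gauss x n k.+1.
Proof. by rewrite /gauss /= rmorphD rmorphM rmorphXn /= map_polyX !hornerE. Qed.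

Lemma gauss_small x n k : (n < k)%N -> gauss x n k = 0.
Proof.
elim: n k => [|n IHn] [|k] //= nk; first exact: gauss0S.
by rewrite gaussS !IHn ?(ltnW nk)// mulr0 addr0.
Qed.

Lemma prod_subX_recl x m f :
  \prod_(i < f.+1) (x ^+ m.+1 - x ^+ i) =
  (x ^+ m.+1 - 1) * x ^+ f * \prod_(i < f) (x ^+ m - x ^+ i).
Proof.
rewrite big_ord_recl expr0 -mulrA; congr (_ * _).
rewrite (eq_bigr (fun i : 'I_f => x * (x ^+ m - x ^+ i))) => [|i _].
  by rewrite big_split /= prodr_const card_ord.
by rewrite mulrBr !exprS.
Qed.

(** The product formula with denominators cleared: in this form it covers [f > m] and every [x], so
    that it can be used both at p and at its inverse. *)
Lemma gauss_prod x m f :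
  gauss x m f * \prod_(i < f) (x ^+ f - x ^+ i) =
  \prod_(i < f) (x ^+ m - x ^+ i).
Proof.
elim: m f => [|m IHm] [|f]; rewrite ?big_ord0 ?gaussn0 ?mulr1 //.
  by rewrite gauss0S mul0r big_ord_recl subrr mul0r.
rewrite gaussS mulrDl -[X in _ + X]mulrA IHm [RHS]prod_subX_recl.
rewrite prod_subX_recl [X in X + _]mulrCA IHm big_ord_recr /= !exprS.
by set P := \prod_(i < f) _; ring.
Qed.

Lemma natr_prod_subX q m f :
  (\prod_(i < f) (q.+1 ^ m - q.+1 ^ i))%N%:R =
  \prod_(i < f) (q.+1%:R ^+ m - q.+1%:R ^+ i) :> K.
Proof.
case: (leqP f m) => fm.
  rewrite natr_prod; apply: eq_bigr => i _.
  by rewrite natrB ?natrX // leq_pexp2l // ltnW // (leq_trans (ltn_ord i)).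
by rewrite (bigD1 (Ordinal fm)) //= subnn mul0n (bigD1 (Ordinal fm)) //= subrr mul0r.
Qed.

(** Once the common powers of q are pulled out, the quotient of the two frame counts is a Gaussian
    binomial, counting the images in the quotient by [D + L]; the remaining power of q counts the
    lifts of an image that miss [L]. *)
Lemma card_between (F : finFieldType) n k1 k2 f (D : 'M[F]_(k1, n)) (L : 'M[F]_(k2, n)) :
  (D :&: L)%MS = 0 ->
  #|between (f + \rank D) D L|%:R =
  #|F|%:R ^+ (f * \rank L) * gauss #|F|%:R (n - \rank D - \rank L) f :> K.
Proof.
move=> DL0.
have : (\rank D + \rank L <= n)%N by rewrite -mxrank_disjoint_sum // rank_leq_col.
have := card_between_frames f DL0; set N := #|between _ _ _|.
set r := \rank D; set k := \rank L; move=> + le_n.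
have [q1 ->] : exists q, #|F| = q.+2.
  by case: #|F| (card_finNzRing_gt1 F) => [|[|q]] // _; exists q.
set q := q1.+2; set x : K := q%:R.
set m := (n - r - k)%N; have -> : n = (r + k + m)%N.
  by rewrite /m -subnDA subnKC.
have E1 (a b : nat) : (\prod_(i < f) (q ^ (a + b) - q ^ (a + i)) =
    q ^ (a * f) * \prod_(i < f) (q ^ b - q ^ i))%N.
  rewrite expnM; transitivity (\prod_(i < f) (q ^ a * (q ^ b - q ^ i)))%N.
    by apply: eq_bigr => i _; rewrite mulnBr -!expnD.
  by rewrite big_split prod_nat_const card_ord.
rewrite [(f + r)%N]addnC !E1 => /(congr1 (fun n : nat => n%:R : K)).
rewrite !natrM !natr_prod_subX !natrX -/x -(gauss_prod x m) => H.
have x0 : x != 0 by rewrite pnatr_eq0.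
have nz : \prod_(i < f) (x ^+ f - x ^+ i) != 0.
  apply/prodf_neq0 => i _; rewrite subr_eq0; apply/eqP => /eqP.
  rewrite /x -!natrX eqr_nat eqn_exp2l // => /eqP fi.
  by have := ltn_ord i; rewrite -fi ltnn.
apply: (mulIf nz); apply: (mulIf (expf_neq0 (r * f) x0)).
rewrite -mulrA [\prod_(i < f) _ * _]mulrC H mulnDl exprD [(k * f)%N]mulnC.
by ring.
Qed.

End GaussValue.

Local Open Scope classical_set_scope.
Local Open Scope card_scope.
Local Open Scope ring_scope.

(** * Lattices and their reduction modulo p *)

Section Cardinals.

Lemma range_card (I : finType) (T : Type) (g : I -> T) :
  injective g -> range g #= `I_#|I|.
Proof.
move=> ginj; have ginj' : injective (g \o (@enum_val I predT)).
  by apply: inj_comp ginj _ => i j; exact: enum_val_inj.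
have -> : range g = range (g \o (@enum_val I predT)).
  by apply/seteqP; split=> _ [i _ <-]; [exists (enum_rank i)|exists (enum_val i)];
    rewrite //= enum_rankK.
apply: card_eq_trans (card_eq_trans (inj_card_eq (A := setT) _) _).
- exact: card_eqxx.
- by move=> i j _ _; exact: ginj'.
- by rewrite card_eq_sym card_II.
Qed.

Lemma cardP (T : Type) (A : set T) n :
  A #= `I_n <-> exists2 g : 'I_n -> T, injective g & A = range g.
Proof.
split=> [An|[g ginj ->]]; last first.
  by have := range_card ginj; rewrite card_ord.
have /card_bijP[f [h hK fK]] : [set: 'I_n] #= A.
  by rewrite card_eq_sym; apply: card_eq_trans An card_II.
pose g i := set_val (f (SigSub (mem_setT i))).
exists g => [i j /val_inj /(can_inj hK) [] //|].
apply/seteqP; split=> [x Ax|_ [i _ <-]]; last exact: set_valP.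
exists (set_val (h (SigSub (mem_set Ax)))) => //.
rewrite /g; set u := h _.
have -> : SigSub (mem_setT (set_val u)) = u by exact: val_inj.
by rewrite /u fK.
Qed.

Lemma card_uniq (T : Type) (A : set T) m n : A #= `I_m -> A #= `I_n -> m = n.
Proof.
by rewrite card_eq_sym => Am An; apply/card_eq_II; exact: card_eq_trans Am An.
Qed.

Lemma card_bigcup (I : finType) (T : Type) (A : I -> set T) (c : I -> nat) :
  (forall i, A i #= `I_(c i)) -> (forall i j x, A i x -> A j x -> i = j) ->
  \bigcup_i A i #= `I_(\sum_i c i).
Proof.
move=> Ac Adisj.
have Ag i : exists g : 'I_(c i) -> T, injective g /\ A i = range g.
  by have /cardP[g] := Ac i; exists g.
pose g i := sval (cid (Ag i)).
have gP i : injective (g i) /\ A i = range (g i) := svalP (cid (Ag i)).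
pose h (u : {i : I & 'I_(c i)}) := g (tag u) (tagged u).
have hA u : A (tag u) (h u) by rewrite (gP _).2; exists (tagged u).
have -> : \bigcup_i A i = range h.
  apply/seteqP; split=> [x [i _]|_ [u _ <-]]; last by exists (tag u).
  by rewrite (gP i).2 => -[j _ <-]; exists (existT _ i j).
have -> : (\sum_i c i)%N = #|{: {i : I & 'I_(c i)}}|.
  by rewrite card_tagged sumnE big_map big_enum; apply: eq_bigr => i _; rewrite card_ord.
apply: range_card => u v huv; have := hA u; rewrite huv => /Adisj/(_ (hA v)).
move: u v huv => [i x] [j y] /= + eij; subst j.
by rewrite /h /= => /(gP i).1 ->.
Qed.

Lemma card_fibers (S T : Type) (A : set S) (B : set T) (f : S -> T) m c :
  B #= `I_m -> (forall x, A x -> B (f x)) ->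
  (forall b, B b -> [set x | A x /\ f x = b] #= `I_c) -> A #= `I_(m * c).
Proof.
move=> /cardP[g ginj gB] AB fib.
have -> : A = \bigcup_i [set x | A x /\ f x = g i].
  apply/seteqP; split=> [x Ax|x [i _ []]//].
  by have := AB _ Ax; rewrite gB => -[i _ e]; exists i.
have -> : (m * c = \sum_(i < m) c)%N by rewrite sum_nat_const card_ord.
apply: card_bigcup => [i|i j x [_ e] [_]]; last by rewrite e => /ginj.
by apply: fib; rewrite gB; exists i.
Qed.

Lemma card_inj_image (S T : Type) (A : set S) (f : S -> T) n :
  injective f -> A #= `I_n -> f @` A #= `I_n.
Proof.
move=> finj An; apply: card_eq_trans An; apply: inj_card_eq => x y _ _; exact: finj.
Qed.

End Cardinals.

Section Classes.
Variables (T : Type) (E : T -> T -> Prop).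
Hypotheses (Erefl : forall x, E x x) (Esym : forall x y, E x y -> E y x).
Hypothesis Etrans : forall x y z, E x y -> E y z -> E x z.

Definition nclasses (A : set T) n := [set (E x : set T) | x in A] #= `I_n.

Lemma class_eq x y : E x y <-> (E x : set T) = (E y : set T).
Proof.
split=> [xy|->]; last exact: Erefl.
by apply/seteqP; split=> z /=; [apply/Etrans/Esym|apply/Etrans].
Qed.

Lemma nclassesI (I : finType) (A : set T) (f : I -> T) :
  (forall i, A (f i)) -> (forall x, A x -> exists i, E (f i) x) ->
  (forall i j, E (f i) (f j) -> i = j) -> nclasses A #|I|.
Proof.
move=> fA fex finj; rewrite /nclasses.
have -> : [set (E x : set T) | x in A] = range (fun i => E (f i) : set T).
  apply/seteqP; split=> [_ [x Ax <-]|_ [i _ <-]]; last by exists (f i).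
  by have [i /class_eq e] := fex _ Ax; exists i.
by apply: range_card => i j /class_eq; exact: finj.
Qed.

Lemma nclassesP (A : set T) n :
  nclasses A n <-> exists f : 'I_n -> T, [/\ forall i, A (f i),
    forall x, A x -> exists i, E (f i) x & forall i j, E (f i) (f j) -> i = j].
Proof.
split=> [/cardP[g ginj gE]|[f [fA fex finj]]]; last first.
  by rewrite -[n]card_ord; exact: nclassesI fA fex finj.
have gA i : exists x, A x /\ (E x : set T) = g i.
  have : range g (g i) by exists i.
  by rewrite -gE => -[x Ax e]; exists x.
exists (fun i => sval (cid (gA i))); split=> [i|x Ax|i j].
- exact: (svalP (cid (gA i))).1.
- have : range g (E x) by rewrite -gE; exists x.
  move=> [i _ e]; exists i; apply/class_eq; rewrite -e.
  exact: (svalP (cid (gA i))).2.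
- move/class_eq; rewrite (svalP (cid (gA i))).2 (svalP (cid (gA j))).2.
  exact: ginj.
Qed.

Lemma nclasses_cover (A : set T) n (f : 'I_n -> T) :
  (forall x, A x -> exists i, E (f i) x) -> exists m, nclasses A m.
Proof.
move=> fex; apply: (@sub_finite_set _ _ (range (fun i => E (f i) : set T))).
  by move=> _ [x Ax <-]; have [i /class_eq e] := fex _ Ax; exists i.
by apply: finite_image; exact: finite_finset.
Qed.

End Classes.

Section Index.
Variable V : zmodType.
Implicit Types A B C L : set V.

Definition addsub L := L 0 /\ forall x y, L x -> L y -> L (x - y).

Lemma addsubN L x : addsub L -> L x -> L (- x).
Proof. by move=> [L0 LB] Lx; rewrite -[- x]add0r; exact: LB. Qed.

Lemma addsubD L x y : addsub L -> L x -> L y -> L (x + y).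
Proof. by move=> HL Lx Ly; rewrite -[y]opprK; apply: HL.2 => //; exact: addsubN. Qed.

Lemma addsubMn L x n : addsub L -> L x -> L (x *+ n).
Proof.
move=> HL Lx; elim: n => [|n IHn]; first by case: HL.
by rewrite mulrS; exact: addsubD.
Qed.

Lemma addsubMz L x (n : int) : addsub L -> L x -> L (x *~ n).
Proof.
move=> HL Lx; case: n => n; first exact: addsubMn.
by rewrite NegzE mulrNz; apply: addsubN => //; exact: addsubMn.
Qed.

Lemma addsub_sum L (I : Type) (r : seq I) (P : pred I) (F : I -> V) : addsub L ->
  (forall i, P i -> L (F i)) -> L (\sum_(i <- r | P i) F i).
Proof.
by move=> HL HF; elim/big_ind: _ => //; [case: HL|move=> x y; exact: addsubD].
Qed.

Definition coset_eq L (x y : V) := L (y - x).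

Lemma coset_eqxx L : addsub L -> forall x, coset_eq L x x.
Proof. by move=> [L0 _] x; rewrite /coset_eq subrr. Qed.

Lemma coset_eq_sym L : addsub L -> forall x y, coset_eq L x y -> coset_eq L y x.
Proof. by move=> HL x y /(addsubN HL); rewrite opprB. Qed.

Lemma coset_eq_trans L : addsub L ->
  forall x y z, coset_eq L x y -> coset_eq L y z -> coset_eq L x z.
Proof.
by move=> HL x y z xy yz; rewrite /coset_eq -(subrKA y); exact: addsubD.
Qed.

Definition index_is A L n := nclasses (coset_eq L) A n.

Lemma index_isI (I : finType) A L (f : I -> V) : addsub L ->
  (forall i, A (f i)) -> (forall x, A x -> exists i, L (x - f i)) ->
  (forall i j, L (f j - f i) -> i = j) -> index_is A L #|I|.
Proof.
by move=> HL; apply: nclassesI;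
  [exact: coset_eqxx|exact: coset_eq_sym|exact: coset_eq_trans].
Qed.

Lemma index_isP A L n : addsub L ->
  index_is A L n <-> exists f : 'I_n -> V, [/\ forall i, A (f i),
    forall x, A x -> exists i, L (x - f i) & forall i j, L (f j - f i) -> i = j].
Proof.
by move=> HL; apply: nclassesP;
  [exact: coset_eqxx|exact: coset_eq_sym|exact: coset_eq_trans].
Qed.

Lemma index_is_cover A L n (f : 'I_n -> V) : addsub L ->
  (forall x, A x -> exists i, L (x - f i)) -> exists m, index_is A L m.
Proof.
by move=> HL; apply: nclasses_cover;
  [exact: coset_eqxx|exact: coset_eq_sym|exact: coset_eq_trans].
Qed.

Lemma index_is_trans A B C m n : addsub B -> addsub C -> C `<=` B -> B `<=` A ->
  addsub A -> index_is A B m -> index_is B C n -> index_is A C (m * n).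
Proof.
move=> HB HC CB BA HA /(index_isP _ _ HB)[f [fA fex finj]].
move=> /(index_isP _ _ HC)[g [gB gex ginj]].
rewrite -[m]card_ord -[n]card_ord -card_prod.
apply: (@index_isI _ _ _ (fun u => f u.1 + g u.2)) => //= [u|x Ax|u v Cuv].
- by apply: addsubD => //; exact/BA/gB.
- have [i Bi] := fex _ Ax; have [j Cj] := gex _ Bi.
  by exists (i, j); rewrite /= opprD addrA.
- have e1 : u.1 = v.1.
    apply: finj; have := CB _ Cuv.
    rewrite (_ : _ - _ = f v.1 - f u.1 + (g v.2 - g u.2)); last by rewrite opprD addrACA.
    move=> H; rewrite -[X in B X](addrK (g v.2 - g u.2)).
    by apply: HB.2 => //; apply: HB.2.
  move: Cuv; rewrite e1 opprD addrACA subrr add0r => /ginj e2.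
  by rewrite [u]surjective_pairing e1 e2 -surjective_pairing.
Qed.

(** Translation by [x] permutes the cosets of [L]. The differences [x + f i - f (s i)] lie in [L],
    and in their sum over all cosets the representatives cancel. *)
Lemma index_is_mul L n : addsub L -> index_is setT L n -> forall x, L (x *+ n).
Proof.
move=> HL /(index_isP _ _ HL)[f [_ fex finj]] x.
pose s i := sval (cid (fex (x + f i) I)).
have sP i : L (x + f i - f (s i)) := svalP (cid (fex (x + f i) I)).
have sinj : injective s.
  move=> i j e; apply: finj; have := HL.2 _ _ (sP j) (sP i).
  by rewrite e opprB subrKA opprD addrA [x + f j]addrC addrK.
have -> : x *+ n = \sum_(i < n) (x + f i - f (s i)).
  rewrite !big_split /= sumr_const card_ord sumrN.
  by rewrite [X in _ + X - _](reindex_inj sinj) /= addrK.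
by apply: addsub_sum.
Qed.

End Index.

Section Lattices.
Variable r : nat.
Implicit Types (L : set 'rV[int]_r) (A : 'M[int]_r) (x y v : 'rV[int]_r).

Definition rowlat A : set 'rV[int]_r := range (fun x => x *m A).

Lemma addsub_rowlat A : addsub (rowlat A).
Proof.
split=> [|_ _ [x _ <-] [y _ <-]]; first by exists 0; rewrite ?mul0mx.
by exists (x - y); rewrite ?mulmxBl.
Qed.

Lemma rowlat_inj A : \det A != 0 -> injective (fun x => x *m A).
Proof.
move=> dA x y /(congr1 (mulmx^~ (\adj A))).
rewrite /= -!mulmxA mul_mx_adj !mul_mx_scalar => /rowP e.
by apply/rowP => i; have := e i; rewrite !mxE; exact: mulfI.
Qed.

Lemma addsub_mulmx L A x : addsub L -> (forall i, L (row i A)) -> L (x *m A).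
Proof.
move=> HL LA; rewrite mulmx_sum_row; apply: addsub_sum => // i _.
by rewrite -[x 0 i]intz scaler_int; exact: addsubMz.
Qed.

(* A lattice is spanned by the rows of a matrix of minimal nonzero determinant *)
(* with rows in it: by Cramer's rule, reducing coefficients modulo the         *)
(* determinant and swapping the remainder in would make the determinant smaller. *)
Lemma lattice_basis L N : addsub L -> (0 < N)%N -> (forall x, L (x *+ N)) ->
  exists2 A, \det A != 0 & L = rowlat A.
Proof.
move=> HL N0 LN.
pose P d := `[< exists A, [/\ forall i, L (row i A), \det A != 0 & `|\det A|%N = d] >].
have exP : exists d, P d.
  exists `|\det (N%:R%:M : 'M[int]_r)|%N; apply/asboolP; exists N%:R%:M; split=> // [i|].
    by rewrite rowE mul_mx_scalar scaler_nat.
  by rewrite det_scalar expf_neq0 // pnatr_eq0 -lt0n.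
case: (ex_minnP exP) => d /asboolP[A [LA dA Ad]] min_d.
exists A => //; apply/seteqP; split=> [v Lv|_ [x _ <-]]; last exact: addsub_mulmx.
set D := \det A in dA Ad *.
set w := v *m \adj A.
have wA : w *m A = D *: v by rewrite -mulmxA mul_adj_mx mul_mx_scalar.
pose q : 'rV[int]_r := \row_j (w ord0 j %/ D)%Z.
pose v' := v - q *m A.
have Lv' : L v' by apply: HL.2 => //; exact: addsub_mulmx.
have v'A i : (v' *m \adj A) 0 i = (w ord0 i %% D)%Z.
  by rewrite mulmxBl -mulmxA mul_mx_adj mul_mx_scalar /modz !mxE mulrC.
have rem0 i : (w ord0 i %% D)%Z = 0.
  apply/eqP; apply: contraT => nz.
  pose A' := \matrix_k (if k == i then v' else row k A).
  have dA' : \det A' = (w ord0 i %% D)%Z.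
    rewrite (expand_det_row _ i) -v'A mxE; apply: eq_bigr => j _.
    have -> : A' i j = v' 0 j by rewrite mxE eqxx.
    congr (_ * _); rewrite [RHS]mxE /cofactor.
    congr (_ * \det _).
    apply/matrixP => a b; rewrite ![in RHS]mxE 3!mxE eq_sym (negPf (neq_lift _ _)).
    by rewrite mxE.
  have : (d <= `|\det A'|)%N.
    apply: min_d; apply/asboolP; exists A'; split=> //; last by rewrite dA'.
    by move=> k; rewrite rowK; case: ifP.
  rewrite dA' -Ad leqNgt => /negP[].
  by rewrite -ltz_nat !abszE (ger0_norm (modz_ge0 _ dA)) ltz_mod.
exists q => //; apply: (@rowlat_inj (D%:M)); first by rewrite det_scalar expf_neq0.
rewrite !mul_mx_scalar -wA scalemxAl; congr (_ *m _); apply/rowP => j.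
by rewrite [LHS]mxE mulrC [q _ _]mxE [RHS](divz_eq _ D) rem0 addr0.
Qed.

End Lattices.

Section ModP.
Variables (p : nat) (p_pr : prime p).
Local Notation Fp := 'F_p.

Definition mod_mx m n (x : 'M[int]_(m, n)) : 'M[Fp]_(m, n) := map_mx intr x.
Definition lift_mx m n (v : 'M[Fp]_(m, n)) : 'M[int]_(m, n) :=
  map_mx (fun a : Fp => (a : nat)%:Z) v.

Lemma lift_mxK m n : cancel (@lift_mx m n) (@mod_mx m n).
Proof. by move=> v; apply/matrixP => i j; rewrite !mxE; exact: natr_Zp. Qed.

Lemma redD m n (x y : 'M[int]_(m, n)) : mod_mx (x + y) = mod_mx x + mod_mx y.
Proof. exact: raddfD. Qed.

Lemma redB m n (x y : 'M[int]_(m, n)) : mod_mx (x - y) = mod_mx x - mod_mx y.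
Proof. exact: raddfB. Qed.

Lemma redM m n k (x : 'M[int]_(m, n)) (y : 'M[int]_(n, k)) : mod_mx (x *m y) = mod_mx x *m mod_mx y.
Proof. exact: map_mxM. Qed.

Lemma red0 m n : mod_mx (0 : 'M[int]_(m, n)) = 0.
Proof. exact: raddf0. Qed.

Lemma redMp m n (x : 'M[int]_(m, n)) : mod_mx (x *+ p) = 0.
Proof.
rewrite /mod_mx raddfMn /=; apply/matrixP => i j; rewrite mulmxnE mxE.
by rewrite -mulr_natr pchar_Fp_0 // mulr0 mxE.
Qed.

Lemma red_eq0 m n (x : 'M[int]_(m, n)) : mod_mx x = 0 -> exists y, x = y *+ p.
Proof.
move=> /matrixP x0; exists (map_mx (fun a => a %/ p)%Z x); apply/matrixP => i j.
rewrite mulmxnE mxE -mulr_natr natz; apply/eqP; rewrite eq_sym -dvdz_eq.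
by have := x0 i j; rewrite !mxE => /eqP; rewrite -(dvdz_pcharf (pchar_Fp p_pr)).
Qed.

End ModP.

Section LatticeModP.
Variables (p : nat) (p_pr : prime p) (r : nat).
Local Notation Fp := 'F_p.
Local Notation red := (@mod_mx p _ _).
Local Notation lift_mx := (@lift_mx p _ _).
Implicit Types (L : set 'rV[int]_r) (A : 'M[int]_r) (U : 'M[Fp]_r).

(** The image of [L] in F_p^r as a canonical row space. For a subgroup [L] this image is closed
    under scalars, which are multiples of 1, so summing the lines through its vectors adds nothing
    to it. *)
Definition mod_space L : 'M[Fp]_r :=
  <<(\sum_(v : 'rV[Fp]_r | `[< exists2 x, L x & red x = v >]) <<v>>)%MS>>%MS.

Lemma mod_spaceP L (v : 'rV[Fp]_r) : addsub L ->
  reflect (exists2 x, L x & red x = v) (v <= mod_space L)%MS.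
Proof.
move=> HL; rewrite genmxE; apply: (iffP idP) => [|Lv]; last first.
  by apply: (sumsmx_sup v); [exact/asboolP|rewrite genmxE].
move=> /sub_sumsmxP[u ->].
suff H : forall w : 'rV[Fp]_r, `[< exists2 x, L x & red x = w >] ->
    exists2 x, L x & red x = u w *m <<w>>%MS.
  elim/big_ind: _ => [|x y [x' Lx <-] [y' Ly <-]|w]; last exact: H.
  - by exists 0; [exact: HL.1|rewrite red0].
  - by exists (x' + y'); [exact: addsubD|rewrite redD].
move=> w /asboolP[x Lx <-].
have /sub_rVP[a ->] : (u (red x) *m <<red x>> <= red x)%MS.
  by rewrite (submx_trans (submxMl _ _)) // genmxE.
exists (x *+ a); first exact: addsubMn.
by rewrite /mod_mx raddfMn /= -scaler_nat natr_Zp.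
Qed.

Lemma mod_space_genmx L : <<mod_space L>>%MS = mod_space L.
Proof. exact: genmx_id. Qed.

Definition rk L := \rank (mod_space L).

Lemma rk_le L : (rk L <= r)%N.
Proof. exact: rank_leq_col. Qed.

Definition up L : set 'rV[int]_r := [set x | L (x *+ p)].

Lemma addsub_up L : addsub L -> addsub (up L).
Proof.
move=> HL; split=> [|x y Lx Ly]; rewrite /up /=; first by rewrite mul0rn; exact: HL.1.
by rewrite mulrnBl; exact: HL.2.
Qed.

Lemma sub_up L : addsub L -> L `<=` up L.
Proof. by move=> HL x Lx; exact: addsubMn. Qed.

Lemma mod_space_rowlat A : (mod_space (rowlat A) == red A)%MS.
Proof.
apply/andP; split; apply/row_subP => i.
  have /(mod_spaceP _ (addsub_rowlat A))[_ [y _ <-] <-] := row_sub i (mod_space (rowlat A)).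
  by rewrite redM submxMl.
apply/mod_spaceP; first exact: addsub_rowlat.
exists (row i A); last by rewrite -map_row.
by exists (delta_mx 0 i); rewrite // -rowE.
Qed.

Lemma rk_rowlat A : rk (rowlat A) = \rank (red A).
Proof. exact: (eqmx_rank (mod_space_rowlat A)). Qed.

(** In the coordinates of the basis [A], the subspaces [U] stand for the lattices between p times
    [rowlat A] and [rowlat A]; [coord_space] goes back. *)
Definition sublat A U : set 'rV[int]_r :=
  [set x *m A | x in [set x | (red x <= U)%MS]].

Lemma sublatP A U x : \det A != 0 -> sublat A U (x *m A) <-> (red x <= U)%MS.
Proof.
move=> dA; split=> [[y Uy /(rowlat_inj dA) <-]//|Ux]; by exists x.
Qed.

Lemma addsub_sublat A U : addsub (sublat A U).
Proof.
split=> [|_ _ [x Ux <-] [y Uy <-]].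
  by exists 0; rewrite ?mul0mx //= red0 sub0mx.
by exists (x - y); rewrite ?mulmxBl //= redB addmx_sub // eqmx_opp.
Qed.

Lemma sublat_rowlat A U : sublat A U `<=` rowlat A.
Proof. by move=> _ [x _ <-]; exists x. Qed.

Definition coord_space A L := mod_space [set x | L (x *m A)].

Lemma addsub_coord A L : addsub L -> addsub [set x | L (x *m A)].
Proof.
move=> HL; split=> [|x y Lx Ly] /=; first by rewrite mul0mx; exact: HL.1.
by rewrite mulmxBl; exact: HL.2.
Qed.

Lemma coord_spaceP A L : addsub L -> up L = rowlat A -> \det A != 0 ->
  forall x, (red x <= coord_space A L)%MS <-> L (x *m A).
Proof.
move=> HL upL dA x; split=> [/(mod_spaceP _ (addsub_coord A HL))[y /= Ly e]|Lx].
  have /red_eq0 : red (x - y) = 0 by rewrite redB e subrr.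
  move=> /(_ p_pr)[z ez].
  have -> : x = y + z *+ p by rewrite -ez addrC subrK.
  rewrite mulmxDl; apply: addsubD => //.
  have : up L (z *m A) by rewrite upL; exists z.
  by rewrite /up /= -!scaler_nat scalemxAl.
by apply/mod_spaceP; [exact: addsub_coord|exists x].
Qed.

Lemma sublat_coord A L : addsub L -> up L = rowlat A -> \det A != 0 ->
  L = sublat A (coord_space A L).
Proof.
move=> HL upL dA; apply/seteqP; split=> [y Ly|_ [x /= + <-]]; last first.
  by move/(coord_spaceP HL upL dA).
have := sub_up HL Ly; rewrite upL => -[x _ e]; exists x => //=.
by apply/(coord_spaceP HL upL dA); rewrite e.
Qed.

(** If x A vanishes modulo p, then x A = p y with y in [up L], so y = z A and x = p z. Together with
    [up_sublat] this describes all lattices with a given image under [up]: their coordinate spaces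
    are the subspaces that miss the kernel of the reduced [A]. *)
Lemma coord_space_cap A L : addsub L -> up L = rowlat A -> \det A != 0 ->
  (coord_space A L :&: kermx (red A) <= (0 : 'M[Fp]_r))%MS.
Proof.
move=> HL upL dA; apply/row_subP => i.
set v := row _ _; have : (v <= coord_space A L :&: kermx (red A))%MS by exact: row_sub.
rewrite sub_capmx => /andP[]; rewrite -[v](lift_mxK).
move/(coord_spaceP HL upL dA); set x := lift_mx v => LxA.
rewrite sub_kermx -redM => /eqP/(red_eq0 p_pr)[y ey].
have : up L y by rewrite /up /= -ey.
rewrite upL => -[z _ ez]; have : x = z *+ p.
  by apply: (rowlat_inj dA); rewrite ey -ez -!scaler_nat scalemxAl.
by move=> ->; rewrite redMp // sub0mx.
Qed.

Lemma up_sublat A U : \det A != 0 -> (U :&: kermx (red A) <= (0 : 'M[Fp]_r))%MS ->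
  up (sublat A U) = rowlat A.
Proof.
move=> dA U0; apply/seteqP; split=> [y [x /= Ux e]|_ [x _ <-]]; last first.
  rewrite /up /= -scaler_nat scalemxAl scaler_nat.
  by apply/(sublatP _ _ dA); rewrite redMp // sub0mx.
have : (red x <= U :&: kermx (red A))%MS.
  by rewrite sub_capmx Ux sub_kermx -redM e redMp ?eqxx.
move=> /submx_trans/(_ U0); rewrite submx0 => /eqP/(red_eq0 p_pr)[z ez].
exists z => //; have p0 : p%:R != 0 :> int by rewrite pnatr_eq0 -lt0n prime_gt0.
apply/rowP => i; apply: (mulfI p0); move/rowP/(_ i): e.
by rewrite ez -scaler_nat -scalemxAl -scaler_nat !mxE.
Qed.

Lemma coord_space_sublat A U : \det A != 0 -> <<U>>%MS = U ->
  coord_space A (sublat A U) = U.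
Proof.
move=> dA gU; rewrite -[LHS]genmx_id -[RHS]gU; apply/genmxP.
have H := addsub_coord A (addsub_sublat A U).
apply/andP; split; apply/row_subP => i.
  by have /(mod_spaceP _ H)[x /= /(sublatP _ _ dA) + <-] :=
    row_sub i (coord_space A (sublat A U)).
apply/(mod_spaceP _ H); exists (lift_mx (row i U)); last exact: lift_mxK.
by apply/(sublatP _ _ dA); rewrite lift_mxK row_sub.
Qed.

Lemma rk_sublat A U : \det A != 0 -> (U :&: kermx (red A) <= (0 : 'M[Fp]_r))%MS ->
  rk (sublat A U) = \rank U.
Proof.
move=> dA U0; have UA : \rank (U *m red A) = \rank U.
  move: U0; rewrite submx0 => /eqP U0.
  by rewrite -[RHS](mxrank_mul_ker U (red A)) U0 mxrank0 addn0.
rewrite -UA; apply: eqmx_rank; apply/andP; split; apply/row_subP => i.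
  have /(mod_spaceP _ (addsub_sublat A U))[_ [x /= Ux <-] <-] :=
    row_sub i (mod_space (sublat A U)).
  by rewrite redM submxMr.
apply/(mod_spaceP _ (addsub_sublat A U)).
exists (lift_mx (row i U) *m A); last by rewrite redM lift_mxK // row_mul.
by apply/(sublatP _ _ dA); rewrite lift_mxK row_sub.
Qed.

Lemma index_sublat A U : \det A != 0 ->
  index_is (rowlat A) (sublat A U) (p ^ (r - \rank U)).
Proof.
move=> dA.
pose I := {v : 'rV[Fp]_r | (v <= U^C)%MS}.
have -> : (p ^ (r - \rank U))%N = #|{: I}|.
  rewrite card_sig -mxrank_compl -[LHS](congr1 (expn^~ _) (card_Fp p_pr)).
  by rewrite -card_row_submx.
apply: (@index_isI _ _ _ _ (fun u : I => lift_mx (val u) *m A)).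
- exact: addsub_sublat.
- by move=> u; exists (lift_mx (val u)).
- move=> _ [x _ <-].
  have : (red x <= U + U^C)%MS by rewrite submx_full // addsmx_compl_full.
  move=> /sub_addsmxP[[u1 u2] /= e].
  exists (exist _ (u2 *m U^C)%MS (submxMl _ _)) => /=.
  rewrite -mulmxBl; apply/sublatP => //.
  by rewrite redB e lift_mxK // addrK submxMl.
- move=> u v; rewrite -mulmxBl => /(sublatP _ _ dA); rewrite redB !lift_mxK // => Uuv.
  apply: val_inj; apply/eqP; rewrite eq_sym -subr_eq0 -submx0 -(capmx_compl U) sub_capmx Uuv.
  by rewrite addmx_sub ?eqmx_opp //; [exact: (svalP v)|exact: (svalP u)].
Qed.

End LatticeModP.

Section LatticeIndex.
Variables (p : nat) (p_pr : prime p) (r : nat).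
Implicit Types (L : set 'rV[int]_r) (A : 'M[int]_r) (U : 'M['F_p]_r).

Lemma up_basis L k : addsub L -> index_is setT L (p ^ k) ->
  exists2 A, \det A != 0 & up p L = rowlat A.
Proof.
move=> HL ind; apply: (@lattice_basis _ _ (p ^ k)%N); first exact: addsub_up.
  by rewrite expn_gt0 prime_gt0.
by move=> x; apply: sub_up => //; exact: index_is_mul.
Qed.

Lemma rk_coord_space A L : addsub L -> up p L = rowlat A -> \det A != 0 ->
  rk p L = \rank (coord_space p A L).
Proof.
move=> HL upL dA; rewrite {1}(sublat_coord p_pr HL upL dA) rk_sublat //.
exact: coord_space_cap.
Qed.

(** The coordinate space of [L] inside [up L] misses the kernel of the reduced basis, so it has the
    dimension of the reduction of [L] itself. Hence the index of [L] in [up L] can be read off from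
    [rk L] alone. *)
Lemma index_up L k : addsub L -> index_is setT L (p ^ k) ->
  (r - rk p L <= k)%N /\ index_is setT (up p L) (p ^ (k - (r - rk p L))).
Proof.
move=> HL ind; have [A dA upL] := up_basis HL ind.
have HU := addsub_up p HL.
have [f [_ fex _]] := (index_isP _ _ HL).1 ind.
have [m indm] : exists m, index_is setT (up p L) m.
  apply: (index_is_cover (f := f) HU) => x _; have [i Li] := fex x I.
  by exists i; exact: sub_up.
have := index_sublat p_pr (coord_space p A L) dA.
rewrite -(sublat_coord p_pr HL upL dA) -upL -(rk_coord_space HL upL dA) => ind2.
have /(card_uniq ind) e : index_is setT L (m * p ^ (r - rk p L)).
  by apply: index_is_trans indm ind2 => //; exact: sub_up.
have le : (r - rk p L <= k)%N.
  by rewrite -(dvdn_Pexp2l _ _ (prime_gt1 p_pr)) e dvdn_mull.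
split=> //; rewrite (_ : (p ^ _)%N = m) //.
apply/eqP; rewrite -(eqn_pmul2r (m := p ^ (r - rk p L))); last by rewrite expn_gt0 prime_gt0.
by rewrite -expnD subnK // e.
Qed.

Lemma index_sublatT A U k : \det A != 0 ->
  index_is setT (rowlat A) (p ^ k) ->
  index_is setT (sublat A U) (p ^ (k + (r - \rank U))).
Proof.
move=> dA ind; rewrite expnD.
apply: index_is_trans ind (index_sublat p_pr U dA) => //.
- exact: addsub_rowlat.
- exact: addsub_sublat.
- exact: sublat_rowlat.
Qed.

(** At full rank the coordinate space is everything, so [up L] equals [L]; starting from p^k x in
    [L], one may divide by p again and again. *)
Lemma rk_full L k : addsub L -> index_is setT L (p ^ k) -> rk p L = r -> L = setT.
Proof.
move=> HL ind rL; have [A dA upL] := up_basis HL ind.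
have uL : up p L = L.
  apply/seteqP; split; last exact: sub_up.
  rewrite upL => _ [x _ <-]; apply/(coord_spaceP p_pr HL upL dA).
  by rewrite submx_full // /row_full -rk_coord_space // rL.
apply/seteqP; split=> // x _; have := index_is_mul HL ind x.
elim: k {ind} => [|k IHk] //; rewrite expnSr mulrnA => Lx.
by apply: IHk; rewrite -uL.
Qed.

Lemma rk_setT : rk p (setT : set 'rV[int]_r) = r.
Proof.
have -> : setT = rowlat (1%:M : 'M[int]_r).
  by apply/seteqP; split=> // x _; exists x; rewrite ?mulmx1.
by rewrite rk_rowlat /mod_mx map_mx1 mxrank1.
Qed.

Lemma index_setT : index_is setT (setT : set 'rV[int]_r) 1.
Proof.
rewrite -card_unit; apply: (@index_isI _ _ _ _ (fun=> 0)) => //; last by case=> -[].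
Qed.

End LatticeIndex.

(** * The exterior square of a free module of rank four *)

Definition pair_fst (k : 'I_6) : 'I_4 := nth ord0 [:: 0; 0; 0; 1; 1; 2%:R] k.
Definition pair_snd (k : 'I_6) : 'I_4 := nth ord0 [:: 1; 2%:R; 3%:R; 2%:R; 3%:R; 3%:R] k.

Lemma pair_cover (i j : 'I_4) : (i < j)%N ->
  exists k, pair_fst k = i /\ pair_snd k = j.
Proof.
case: i => [[|[|[|[|//]]]] lti]; case: j => [[|[|[|[|//]]]] ltj] //= _;
  first [ exists (@Ordinal 6 0 isT); split; apply: val_inj; reflexivity
        | exists (@Ordinal 6 1 isT); split; apply: val_inj; reflexivity
        | exists (@Ordinal 6 2 isT); split; apply: val_inj; reflexivity
        | exists (@Ordinal 6 3 isT); split; apply: val_inj; reflexivity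
        | exists (@Ordinal 6 4 isT); split; apply: val_inj; reflexivity
        | exists (@Ordinal 6 5 isT); split; apply: val_inj; reflexivity ].
Qed.

Section AltPart.
Variable R : comNzRingType.

(** The image of the tensor [Z] in the exterior square, in the basis indexed by the pairs i < j in
    lexicographic order. *)
Definition alt_part (Z : 'M[R]_4) : 'rV[R]_6 :=
  \row_k (Z (pair_fst k) (pair_snd k) - Z (pair_snd k) (pair_fst k)).

Lemma alt_part_is_linear : linear alt_part.
Proof. by move=> a Y Z; apply/rowP => k; rewrite !mxE mulrBr opprD addrACA. Qed.
HB.instance Definition _ :=
  GRing.isLinear.Build R 'M[R]_4 'rV[R]_6 _ alt_part alt_part_is_linear.

Lemma alt_part_eq0 Z : alt_part Z = 0 <-> Z^T = Z.
Proof.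
split=> [/rowP Z0|ZT]; last first.
  by apply/rowP => k; rewrite !mxE -{2}ZT mxE subrr.
have H (i j : 'I_4) : (i < j)%N -> Z j i = Z i j.
  move=> /pair_cover[k [<- <-]].
  by have := Z0 k; rewrite !mxE => /eqP; rewrite subr_eq0 => /eqP.
apply/matrixP => i j; rewrite mxE; case: (ltngtP i j) => [/H//|/H//|/val_inj -> //].
Qed.

Definition wedge (x y : 'rV[R]_4) : 'rV[R]_6 := alt_part (x^T *m y).

Lemma wedgeE x y k : wedge x y 0 k =
  x 0 (pair_fst k) * y 0 (pair_snd k) - x 0 (pair_snd k) * y 0 (pair_fst k).
Proof. by rewrite !mxE !big_ord1 !mxE. Qed.

End AltPart.

(** * The recursion for pairs of lattices *)

(** Cartan's lemma: the symmetry hypothesis says that the sum of the w_i /\ y_i is 0. *)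
Lemma cartan (F : fieldType) d n (W Y : 'M[F]_(d, n)) : row_free W ->
  (W^T *m Y)^T = W^T *m Y -> exists2 S : 'M[F]_d, S^T = S & Y = S *m W.
Proof.
move=> /row_freeP[G WG]; rewrite trmx_mul trmxK => e.
have Y_eq : Y = (Y *m G)^T *m W.
  apply: trmx_inj; rewrite trmx_mul trmxK.
  by rewrite mulmxA -e -mulmxA WG mulmx1.
exists (Y *m G)^T; last by [].
by rewrite trmxK {1}Y_eq -mulmxA WG mulmx1.
Qed.

Lemma trmx_congruence (R : comPzRingType) d n (W : 'M[R]_(d, n)) (S : 'M[R]_d) :
  S^T = S -> (W^T *m (S *m W))^T = W^T *m (S *m W).
Proof. by move=> ST; rewrite !trmx_mul trmxK ST mulmxA. Qed.

Lemma card_symmetric (F : finFieldType) d :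
  #|[pred S : 'M[F]_d | S^T == S]| = (#|F| ^ 'C(d.+1, 2))%N.
Proof.
elim: d => [|d IHd].
  rewrite bin_small // expn0 (eq_card (B := predT)) ?card_mx ?mul0n ?expn0 //.
  by move=> S; rewrite !inE [S]flatmx0 trmx0 eqxx.
pose h (u : F * 'rV[F]_d * 'M[F]_d) : 'M[F]_(1 + d) :=
  block_mx u.1.1%:M u.1.2 u.1.2^T u.2.
pose Q := [pred u : F * 'rV[F]_d * 'M[F]_d | u.2^T == u.2].
have hinj : injective h.
  move=> [[a v] S] [[b w] T] /eq_block_mx /= [e -> _ ->].
  by move/matrixP/(_ 0 0): e; rewrite !mxE eqxx !mulr1n => ->.
transitivity #|[pred S : 'M[F]_(1 + d) | S^T == S]|; first by [].
transitivity #|[seq h u | u in Q]|.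
  apply: eq_card => S; apply/idP/idP => [|/mapP[[[a v] T]]]; rewrite ?mem_enum !inE /=; last first.
    by move=> /eqP ST ->; rewrite /h /= tr_block_mx trmxK tr_scalar_mx ST.
  rewrite -[S]submxK => /eqP; rewrite (@tr_block_mx _ 1 d 1 d).
  move=> /eq_block_mx[_ _ e2 e3].
  apply/mapP; exists ((S 0 0, @ursubmx _ 1 d 1 d S), @drsubmx _ 1 d 1 d S);
    rewrite ?mem_enum ?inE /= ?e3 //.
  rewrite /h /= e2; congr (block_mx _ _ _ _); rewrite [LHS]mx11_scalar; congr (_%:M).
  by rewrite !mxE; congr (S _ _); exact: val_inj.
rewrite fintype.card_image //.
rewrite (eq_card (B := [predX predT & [pred S : 'M[F]_d | S^T == S]])); last first.
  by move=> [a S]; rewrite !inE.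
rewrite cardX IHd card_prod card_mx mul1n (binS d.+1 1) bin1 -expnS -expnD.
by rewrite addnC.
Qed.

Definition pair_cond (M : set 'rV[int]_4) (L : set 'rV[int]_6) :=
  forall x y, M x -> L (wedge x y).

Section PairCond.
Variables (p : nat) (p_pr : prime p).
Local Notation Fp := 'F_p.
Local Notation red := (@mod_mx p _ _).
Local Notation lift_mx := (@lift_mx p _ _).

(** Since the second argument of the wedge ranges over all of Z^4, only the element of [M] has to be
    multiplied by p, and bilinearity moves this one factor out. *)
Lemma pair_cond_up M L : pair_cond M L -> pair_cond (up p M) (up p L).
Proof.
move=> ML x y Mx; have := ML _ y Mx; rewrite /up /= /wedge.
by rewrite -!scaler_nat linearZ /= -scalemxAl linearZ.
Qed.

Lemma red_tr m n (x : 'M[int]_(m, n)) : mod_mx p x^T = (mod_mx p x)^T.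
Proof. by rewrite /mod_mx matrix.map_trmx. Qed.

Lemma red_mxvec m n (x : 'M[int]_(m, n)) : mod_mx p (mxvec x) = mxvec (mod_mx p x).
Proof. exact: map_mxvec. Qed.

Lemma red_row m n i (x : 'M[int]_(m, n)) : mod_mx p (row i x) = row i (mod_mx p x).
Proof. exact: map_row. Qed.

Lemma red_alt_part (Z : 'M[int]_4) : red (alt_part Z) = alt_part (red Z).
Proof. by apply/rowP => k; rewrite !mxE rmorphB. Qed.

Variables (A : 'M[int]_4) (C : 'M[int]_6).
Hypotheses (dA : \det A != 0) (dC : \det C != 0).
Hypothesis AC : pair_cond (rowlat A) (rowlat C).

Lemma alt_part_rowlat (Z : 'M[int]_4) : rowlat C (alt_part (A^T *m Z)).
Proof.
have -> : A^T *m Z = \sum_i (row i A)^T *m row i Z.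
  apply/matrixP => i j; rewrite mxE summxE; apply: eq_bigr => k _.
  by rewrite !mxE big_ord1 !mxE.
rewrite linear_sum; apply: addsub_sum; first exact: addsub_rowlat.
by move=> i _; apply: AC; exists (delta_mx 0 i); rewrite // -rowE.
Qed.

(** [A^T *m Z] is the sum of the tensors of the rows of [A] with those of [Z], so its wedge lies in
    [rowlat C] and its integral coordinates there are linear in [Z]. They have to be found before
    the reduction, because [C] may be singular modulo p. *)
Lemma ex_coeff_mx : exists P : 'M[int]_(4 * 4, 6),
  forall Z, alt_part (A^T *m Z) = mxvec Z *m P *m C.
Proof.
have H (k : 'I_(4 * 4)) : exists w, w *m C = alt_part (A^T *m vec_mx (delta_mx 0 k)).
  by have [w _ e] := alt_part_rowlat (vec_mx (delta_mx 0 k)); exists w.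
exists (\matrix_k (sval (cid (H k)))) => Z.
rewrite -{1}[Z]mxvecK; move: (mxvec Z) => z.
rewrite [in LHS](row_sum_delta z) !linear_sum -mulmxA mulmx_sum_row /=.
apply: eq_bigr => k _.
rewrite linearZ /= -scalemxAr linearZ; congr (_ *: _).
by rewrite row_mul rowK (svalP (cid (H k))).
Qed.

Definition coeff_mx := sval (cid ex_coeff_mx).

Lemma coeff_mxP Z : alt_part (A^T *m Z) = mxvec Z *m coeff_mx *m C.
Proof. exact: (svalP (cid ex_coeff_mx)). Qed.

Lemma red_coeff_mxP (Z : 'M[Fp]_4) :
  alt_part ((red A)^T *m Z) = mxvec Z *m red coeff_mx *m red C.
Proof.
rewrite -[Z]lift_mxK -red_tr -redM -red_mxvec -!redM -coeff_mxP.
exact/esym/red_alt_part.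
Qed.

Lemma coeff_mx_sym (Z : 'M[int]_4) : (A^T *m Z)^T = A^T *m Z -> mxvec Z *m coeff_mx = 0.
Proof.
move=> /alt_part_eq0; rewrite coeff_mxP => e.
by apply: (rowlat_inj dC); rewrite /= e mul0mx.
Qed.

(** The rows of [wedge_space U] span the coordinates, with respect to C, of the
    wedges of the vectors of [sublat A U] with Z^4, reduced modulo p. *)
Definition wedge_space (U : 'M[Fp]_4) : 'M[Fp]_(\rank U * 4, 6) :=
  lin1_mx (mulmxr (red coeff_mx) \o mxvec \o mulmx (row_base U)^T \o vec_mx).

Variable U : 'M[Fp]_4.
Hypothesis U0 : (U :&: kermx (red A) <= (0 : 'M[Fp]_4))%MS.
Local Notation X := (row_base U).
Local Notation W := (row_base U *m red A).

Lemma wedge_spaceE (y : 'rV_(\rank U * 4)) : y *m wedge_space U =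
  mxvec (X^T *m vec_mx y) *m red coeff_mx.
Proof. by rewrite mul_rV_lin1. Qed.

Let U0' : (U :&: kermx (red A) = 0)%MS.
Proof. by apply/eqP; rewrite -submx0. Qed.

Lemma row_free_W : row_free W.
Proof.
have e := eqmxMr (red A) (eq_row_base U); rewrite /row_free e.
by rewrite -[X in _ == X](mxrank_mul_ker U (red A)) U0' mxrank0 addn0.
Qed.

(** From left to right one multiplies by the reduced [C]. In the other direction the reduced [C]
    cannot be cancelled. Instead Cartan's lemma gives Y = S W with S symmetric, and lifting S and X
    entrywise makes the tensor symmetric over the integers, where [C] is cancellable; reducing the
    vanishing integral coordinates gives the claim. *)
Lemma wedge_space_ker (Y : 'M[Fp]_(\rank U, 4)) :
  mxvec (X^T *m Y) *m red coeff_mx = 0 <-> alt_part (W^T *m Y) = 0.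
Proof.
split=> [Y0|/alt_part_eq0/(cartan row_free_W)[S ST ->]].
  by rewrite trmx_mul -mulmxA red_coeff_mxP Y0 mul0mx.
pose S' := lift_mx S; pose X' := lift_mx X.
have ST' : S'^T = S'.
  by apply/matrixP => i j; have /matrixP/(_ i j) := ST; rewrite !mxE => ->.
pose Z := X'^T *m S' *m X' *m A.
have /coeff_mx_sym/(congr1 red) : (A^T *m Z)^T = A^T *m Z.
  by rewrite !trmx_mul !trmxK ST' !mulmxA.
by rewrite redM red_mxvec !redM red_tr !lift_mxK red0 -!mulmxA.
Qed.

Lemma wedge_space_cap (v : 'rV[Fp]_6) :
  (v <= wedge_space U)%MS -> v *m red C = 0 -> v = 0.
Proof.
move=> /submxP[y ->]; rewrite wedge_spaceE => e.
apply/wedge_space_ker; move: e.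
by rewrite -red_coeff_mxP mulmxA -trmx_mul.
Qed.

(** By Cartan's lemma the kernel consists of the Y = S W with S symmetric, and S is determined by Y
    because [W] has free rows. The binomial is the dimension of the space of symmetric matrices. *)
Lemma rank_wedge_space : \rank (wedge_space U) = (\rank U * 4 - 'C((\rank U).+1, 2))%N.
Proof.
suff e : \rank (kermx (wedge_space U)) = 'C((\rank U).+1, 2).
  by rewrite -e mxrank_ker subKn // rank_leq_row.
apply/eqP; rewrite -(eqn_exp2l _ _ (card_finNzRing_gt1 Fp)) -card_symmetric -card_row_submx.
pose h (S : 'M[Fp]_(\rank U)) : 'rV_(\rank U * 4) := mxvec (S *m W).
have hinj : injective h.
  by move=> S T /(can_inj mxvecK) e; exact: (row_free_inj row_free_W e).
rewrite -(fintype.card_image hinj); apply/eqP; apply: eq_card => y.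
rewrite inE sub_kermx wedge_spaceE; apply/eqP/mapP => [|[S]].
  move=> /wedge_space_ker/alt_part_eq0/(cartan row_free_W)[S ST eY].
  by exists S; rewrite ?mem_enum ?inE ?ST // /h -eY vec_mxK.
rewrite mem_enum inE => /eqP ST ->; rewrite mxvecK; apply/wedge_space_ker/alt_part_eq0.
exact: trmx_congruence.
Qed.

Lemma pair_cond_sublat (O : 'M[Fp]_6) :
  pair_cond (sublat A U) (sublat C O) <-> (wedge_space U <= O)%MS.
Proof.
have key (Z : 'M[int]_4) : sublat C O (alt_part (A^T *m Z)) <->
    (mxvec (red Z) *m red coeff_mx <= O)%MS.
  by rewrite coeff_mxP sublatP // redM red_mxvec.
split=> [AUC|sub _ y [x /= + <-]]; last first.
  rewrite -(eq_row_base U) => /submxP[a ea].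
  rewrite /wedge trmx_mul -mulmxA; apply/key; apply: submx_trans sub.
  apply/submxP; exists (mxvec (a^T *m red y)).
  by rewrite wedge_spaceE mxvecK mulmxA -trmx_mul -ea redM red_tr.
apply/row_subP => i; rewrite rowE wedge_spaceE.
set Y := vec_mx _; pose X' := lift_mx X; pose Y' := lift_mx Y.
have -> : X^T *m Y = red (X'^T *m Y').
  by rewrite redM lift_mxK red_tr lift_mxK.
apply/key; rewrite mulmxA -trmx_mul.
have -> : (X' *m A)^T *m Y' = \sum_i (row i X' *m A)^T *m row i Y'.
  apply/matrixP => j k; rewrite mxE summxE; apply: eq_bigr => l _.
  by rewrite -row_mul !mxE big_ord1 !mxE.
rewrite linear_sum; apply: addsub_sum; first exact: addsub_sublat.
move=> k _; apply: AUC; apply/(sublatP _ _ dA).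
by rewrite red_row lift_mxK (submx_trans (row_sub _ _)) // eq_row_base.
Qed.

End PairCond.

Fixpoint gaussn (q n k : nat) : nat :=
  match n, k with
  | _, 0 => 1
  | 0, _.+1 => 0
  | n'.+1, k'.+1 => gaussn q n' k' + q ^ k * gaussn q n' k
  end%N.

Lemma natr_gaussn (K : numFieldType) q n k : (gaussn q n k)%:R = gauss (q%:R : K) n k.
Proof.
elim: n k => [|n IHn] [|k] /=; rewrite ?gaussn0 ?gauss0S //.
by rewrite gaussS natrD natrM natrX !IHn.
Qed.

(** The number of subspaces of dimension e of an n-dimensional space over F_q that
    contain a given subspace of dimension delta and meet one of dimension k, itself
    disjoint from the former, trivially. *)
Definition between_card (q n delta k e : nat) : nat :=
  if (delta <= e)%N then (q ^ ((e - delta) * k) * gaussn q (n - delta - k) (e - delta))%N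
  else 0%N.

Lemma card_betweenE (F : finFieldType) n k1 k2 e (D : 'M[F]_(k1, n)) (L : 'M[F]_(k2, n)) :
  (D :&: L)%MS = 0 ->
  #|between e D L| = between_card #|F| n (\rank D) (\rank L) e.
Proof.
move=> DL0; rewrite /between_card; case: leqP => [le|lt].
  apply/eqP; rewrite -(eqr_nat rat) natrM natrX natr_gaussn.
  by have := card_between rat (e - \rank D)%N DL0; rewrite subnK // => ->.
apply: eq_card0 => A; rewrite inE; apply/negP => /and4P[_ /eqP rA /mxrankS DA _].
by move: lt; rewrite -rA ltnNge DA.
Qed.

Section PairRecursion.
Variables (p : nat) (p_pr : prime p).
Local Notation Fp := 'F_p.

Definition pairs (k l d e : nat) : set (set 'rV[int]_4 * set 'rV[int]_6) :=
  [set x | [/\ addsub x.1, addsub x.2 & pair_cond x.1 x.2] /\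
    [/\ index_is setT x.1 (p ^ k), index_is setT x.2 (p ^ l), rk p x.1 = d & rk p x.2 = e]].

(** The number of pairs of ranks (d, e) over one pair of ranks (d', e'). The kernels to be avoided
    have dimensions 4 - d' and 6 - e', and the second subspace must contain the wedge space of the
    first. *)
Definition step_card (d e d' e' : nat) : nat :=
  (between_card p 4 0 (4 - d') d * between_card p 6 (d * 4 - 'C(d.+1, 2)) (6 - e') e)%N.

Definition up2 (x : set 'rV[int]_4 * set 'rV[int]_6) := (up p x.1, up p x.2).

Lemma index_basis r (L : set 'rV[int]_r) k : addsub L -> index_is setT L (p ^ k) ->
  exists2 A, \det A != 0 & L = rowlat A.
Proof.
move=> HL ind; apply: (lattice_basis (N := p ^ k)) => //.
  by rewrite expn_gt0 prime_gt0.
exact: index_is_mul.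
Qed.

(** The choice of U limits the choice of O only through [wedge_space], whose rank depends on d alone
    and which misses the kernel that O must avoid. So every U admits equally many O, and the count
    is a product. *)
Lemma pairs_fiber k l d e d' e' x1 : pairs k l d' e' x1 -> (d <= 4)%N -> (e <= 6)%N ->
  [set x | pairs (k + (4 - d)) (l + (6 - e)) d e x /\ up2 x = x1]
  #= `I_(step_card d e d' e').
Proof.
move=> [[H1 H2 H12] [i1 i2 r1 r2]] d4 e6.
have [A dA eA] := index_basis H1 i1; have [C dC eC] := index_basis H2 i2.
case: x1 H1 H2 H12 i1 i2 r1 r2 eA eC => M1 L1 /= H1 H2 H12 i1 i2 r1 r2 eA eC.
subst M1 L1.
pose P1 : pred 'M[Fp]_4 := between d (0 : 'M[Fp]_4) (kermx (mod_mx p A)).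
pose P2 (U : 'M[Fp]_4) : pred 'M[Fp]_6 :=
  between e (wedge_space H12 U) (kermx (mod_mx p C)).
pose I := {u : 'M[Fp]_4 * 'M[Fp]_6 | P1 u.1 && P2 u.1 u.2}.
pose g (u : I) := (sublat A (val u).1, sublat C (val u).2).
have rkA : \rank (kermx (mod_mx p A)) = (4 - d')%N by rewrite mxrank_ker -rk_rowlat r1.
have rkC : \rank (kermx (mod_mx p C)) = (6 - e')%N by rewrite mxrank_ker -rk_rowlat r2.
have -> : step_card d e d' e' = #|{: I}|.
  rewrite card_sig -sum1_card.
  rewrite -(pair_big_dep P1 P2 (fun _ _ => 1%N)) /=.
  rewrite (eq_bigr (fun=> between_card p 6 (d * 4 - 'C(d.+1, 2)) (6 - e') e)).
    have e1 := card_betweenE d (cap0mx 4 (kermx (mod_mx p A))).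
    rewrite mxrank0 rkA card_Fp // in e1.
    by rewrite sum_nat_const /step_card -e1.
  move=> U /and4P[_ /eqP rU _ U0]; rewrite sum1_card.
  apply: etrans (card_betweenE e (_ :
    (wedge_space H12 U :&: kermx (mod_mx p C))%MS = 0)) _; last first.
    by rewrite (rank_wedge_space dC H12 U0) rU rkC card_Fp.
  apply/eqP; rewrite -submx0; apply/row_subP => i.
  have : (row i (wedge_space H12 U :&: kermx (mod_mx p C)) <=
          wedge_space H12 U :&: kermx (mod_mx p C))%MS by exact: row_sub.
  rewrite sub_capmx => /andP[w1]; rewrite sub_kermx => /eqP w2.
  by rewrite (wedge_space_cap dC U0 w1 w2) sub0mx.
rewrite (_ : [set x | _] = range g); last first.
  apply/seteqP; split=> [[M L]|_ [[[U O] /= HUO] _ <-]]; last case/andP: (HUO) => HU HO.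
    move=> [[[HM HL ML] [_ _ rM rL]] e12].
    have uM := congr1 fst e12; have uL := congr1 snd e12.
    rewrite /= in HM HL ML rM rL uM uL.
    have capM := coord_space_cap p_pr HM uM dA.
    have capL := coord_space_cap p_pr HL uL dC.
    have eM := sublat_coord p_pr HM uM dA.
    have eL := sublat_coord p_pr HL uL dC.
    have Pu : P1 (coord_space p A M) && P2 (coord_space p A M) (coord_space p C L).
      apply/andP; split; apply/and4P; split=> //; rewrite ?mod_space_genmx ?sub0mx //.
      - by rewrite -(rk_coord_space p_pr HM uM dA) rM.
      - by rewrite -(rk_coord_space p_pr HL uL dC) rL.
      - by apply/(pair_cond_sublat dA dC); rewrite -eM -eL.
    by exists (exist _ (coord_space p A M, coord_space p C L) Pu); rewrite // /g /= -eM -eL.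
  case/and4P: (HU) => /eqP gU /eqP rU _ capU; case/and4P: (HO) => /eqP gO /eqP rO sub capO.
  rewrite /g /= /pairs /up2 /= !up_sublat //; split=> //; split.
    split; [exact: addsub_sublat|exact: addsub_sublat|].
    exact/(pair_cond_sublat dA dC).
  rewrite !rk_sublat // rU rO; split=> //.
    by rewrite -rU; exact: index_sublatT.
  by rewrite -rO; exact: index_sublatT.
apply: range_card => -[[U O] HU] [[U' O'] HU'] [eU eO]; apply: val_inj => /=.
move: HU HU' => /andP[/and4P[/eqP gU _ _ _] /and4P[/eqP gO _ _ _]].
move=> /andP[/and4P[/eqP gU' _ _ _] /and4P[/eqP gO' _ _ _]].
rewrite /= in gU gO gU' gO'; rewrite -(coord_space_sublat dA gU) -(coord_space_sublat dA gU') eU.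
by rewrite -(coord_space_sublat dC gO) -(coord_space_sublat dC gO') eO.
Qed.

Lemma pairs_up k l d e x : pairs k l d e x ->
  [/\ 4 - d <= k, 6 - e <= l & pairs (k - (4 - d)) (l - (6 - e))
    (rk p (up p x.1)) (rk p (up p x.2)) (up2 x)]%N.
Proof.
move=> [[H1 H2 H12] [i1 i2 <- <-]].
have [le1 j1] := index_up p_pr H1 i1; have [le2 j2] := index_up p_pr H2 i2.
split=> //; split; last by [].
by split; [exact: addsub_up|exact: addsub_up|exact: pair_cond_up].
Qed.

Lemma card_pairs_step k l d e (f : 'I_5 -> 'I_7 -> nat) : (d <= 4)%N -> (e <= 6)%N ->
  (forall (d' : 'I_5) (e' : 'I_7), pairs k l d' e' #= `I_(f d' e')) ->
  pairs (k + (4 - d)) (l + (6 - e)) d e #= `I_(\sum_d' \sum_e' f d' e' * step_card d e d' e')%N.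
Proof.
move=> d4 e6 Hf.
pose B (i : 'I_5 * 'I_7) := [set x | pairs (k + (4 - d)) (l + (6 - e)) d e x /\
  pairs k l i.1 i.2 (up2 x)].
rewrite (_ : pairs _ _ _ _ = \bigcup_i B i); last first.
  apply/seteqP; split=> [x Hx|x [i _ []]//].
  have [_ _] := pairs_up Hx; rewrite !addnK => Hu.
  have ltr : (rk p (up p x.1) < 5)%N by rewrite ltnS rk_le.
  have ltr' : (rk p (up p x.2) < 7)%N by rewrite ltnS rk_le.
  by exists (Ordinal ltr, Ordinal ltr').
rewrite pair_big /=; apply: card_bigcup => [i|i j x].
  apply: (card_fibers (Hf i.1 i.2) (f := up2)) => [x []//|y Hy].
  rewrite (_ : [set x | _] = [set x | pairs (k + (4 - d)) (l + (6 - e)) d e x /\ up2 x = y]).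
    exact: pairs_fiber Hy _ _.
  by apply/seteqP; split=> x /= [] => [[Hx _] e1|Hx e1]; split=> //; split=> //; rewrite e1.
move=> [_ [_ [_ _ e1 e2]]] [_ [_ [_ _ e3 e4]]].
apply: etrans (surjective_pairing i) (etrans _ (esym (surjective_pairing j))).
by congr (_, _); apply: val_inj; [exact: etrans (esym e1) e3|exact: etrans (esym e2) e4].
Qed.

Lemma pairs_top k l : pairs k l 4 6 #= `I_((k == 0) && (l == 0)).
Proof.
case: (boolP ((k == 0) && (l == 0)))%N => [/andP[/eqP -> /eqP ->]|kl].
  rewrite (_ : pairs _ _ _ _ = [set (setT, setT)]); first exact: card_set1.
  apply/seteqP; split=> [[M L] [[/= H1 H2 _] [i1 i2 r1 r2]]|_ ->].
    by rewrite (rk_full p_pr H1 i1 r1) (rk_full p_pr H2 i2 r2).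
  by rewrite /pairs /= !rk_setT !expn0; do !split=> //; exact: index_setT.
rewrite (_ : pairs _ _ _ _ = set0); first by rewrite II0; exact: card_eq00.
apply/seteqP; split=> // -[M L] [[/= H1 H2 _] [i1 i2 r1 r2]].
have eM := rk_full p_pr H1 i1 r1; have eL := rk_full p_pr H2 i2 r2.
move: i1 i2; rewrite eM eL.
move=> /(card_uniq (index_setT _))/esym/eqP + /(card_uniq (index_setT _))/esym/eqP.
rewrite -!(expn0 p) !eqn_exp2l ?prime_gt1 // => k0 l0.
by move: kl; rewrite k0 l0.
Qed.

(** Induction on k + l: [up] lowers this sum strictly unless both ranks are full, and full ranks
    leave at most the pair of the whole lattices. *)
Lemma finite_pairs k l d e : finite_set (pairs k l d e).
Proof.
have [n] := ubnP (k + l); elim: n k l d e => // n IHn k l d e.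
rewrite ltnS => kln.
case: (pselect (pairs k l d e !=set0)) => [[x Hx]|/set0P/negP/negPn/eqP ->]; 
    last exact: finite_set0.
have [le1 le2 _] := pairs_up Hx.
have [_ [_ _ e1 e2]] := Hx.
have d4 : (d <= 4)%N by rewrite -e1 rk_le.
have e6 : (e <= 6)%N by rewrite -e2 rk_le.
have [/andP[/eqP -> /eqP ->]|ne] := boolP ((d == 4) && (e == 6))%N.
  by exists ((k == 0) && (l == 0))%N; exact: pairs_top.
have H (d' : 'I_5) (e' : 'I_7) : exists m, pairs (k - (4 - d)) (l - (6 - e)) d' e' #= `I_m.
  apply: IHn; apply: leq_trans kln.
  rewrite -[in X in (_ < X)%N](subnK le1) -[in X in (_ < X)%N](subnK le2).
  rewrite addnACA -[X in (X < _)%N]addn0 ltn_add2l addn_gt0 !subn_gt0.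
  by move: ne; rewrite negb_and !neq_ltn !(ltnNge 4) !(ltnNge 6) d4 e6 !orbF.
have := card_pairs_step d4 e6 (fun d' e' => svalP (cid (H d' e'))).
by rewrite !subnK // => Hc; eexists; exact: Hc.
Qed.

Definition num_pairs k l d e : nat := #|` fset_set (pairs k l d e)|.

Lemma num_pairsP k l d e : pairs k l d e #= `I_(num_pairs k l d e).
Proof. by have [n Hn] := finite_pairs k l d e; rewrite /num_pairs (card_fset_set Hn). Qed.

Lemma num_pairs_rec k l d e : (d <= 4)%N -> (e <= 6)%N ->
  num_pairs (k + (4 - d)) (l + (6 - e)) d e =
  (\sum_(d' < 5) \sum_(e' < 7) num_pairs k l d' e' * step_card d e d' e')%N.
Proof.
move=> d4 e6; apply: card_uniq (num_pairsP _ _ _ _) _.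
by apply: card_pairs_step => // d' e'; exact: num_pairsP.
Qed.

Lemma num_pairs_small k l d e : (k < 4 - d)%N || (l < 6 - e)%N -> num_pairs k l d e = 0%N.
Proof.
move=> kl; apply: (card_uniq (num_pairsP _ _ _ _)).
rewrite (_ : pairs _ _ _ _ = set0); first by rewrite II0; exact: card_eq00.
apply/seteqP; split=> // x /pairs_up[le1 le2 _].
by move: kl; rewrite !ltnNge le1 le2.
Qed.

Lemma num_pairs_top k l : num_pairs k l 4 6 = ((k == 0) && (l == 0))%N.
Proof. exact: card_uniq (num_pairsP _ _ _ _) (pairs_top _ _). Qed.

End PairRecursion.

(** * Normal subgroups of F24 *)

(** Collecting x_1^a_1 ... x_4^a_4 x_1^b_1 ... x_4^b_4 moves x_j^a_j past x_i^b_i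
    for i < j, at the cost of [x_i, x_j]^(- a_j b_i). *)
Definition heis_form (x y : 'rV[int]_4) : 'rV[int]_6 :=
  \row_k - (x 0 (pair_snd k) * y 0 (pair_fst k)).

Lemma heis_formDl x y z : heis_form (x + y) z = heis_form x z + heis_form y z.
Proof. by apply/rowP => k; rewrite !mxE; ring. Qed.

Lemma heis_formDr x y z : heis_form z (x + y) = heis_form z x + heis_form z y.
Proof. by apply/rowP => k; rewrite !mxE; ring. Qed.

Lemma heis_formNl x z : heis_form (- x) z = - heis_form x z.
Proof. by apply/rowP => k; rewrite !mxE; ring. Qed.

Lemma heis_formNr x z : heis_form z (- x) = - heis_form z x.
Proof. by apply/rowP => k; rewrite !mxE; ring. Qed.

Lemma heis_form0l z : heis_form 0 z = 0.
Proof. by apply/rowP => k; rewrite !mxE; ring. Qed.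

Lemma heis_form0r z : heis_form z 0 = 0.
Proof. by apply/rowP => k; rewrite !mxE; ring. Qed.

Lemma heis_form_wedge x y : heis_form x y = heis_form y x + wedge x y.
Proof. by apply/rowP => k; rewrite [RHS]mxE wedgeE !mxE; ring. Qed.

Definition heis : Type := ('rV[int]_4 * 'rV[int]_6)%type.
HB.instance Definition _ := Choice.on heis.

Definition heis_one : heis := (0, 0).
Definition heis_mul (g h : heis) : heis :=
  (g.1 + h.1, g.2 + h.2 + heis_form g.1 h.1).
Definition heis_inv (g : heis) : heis := (- g.1, - g.2 + heis_form g.1 g.1).

Lemma heis_mulA : associative heis_mul.
Proof.
move=> [a x] [b y] [c z]; congr (_, _); rewrite /= ?addrA //.
by rewrite heis_formDl heis_formDr; apply/rowP => k; rewrite !mxE; ring.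
Qed.

Lemma heis_mul1 : left_id heis_one heis_mul.
Proof. by move=> [a x]; rewrite /heis_mul /= heis_form0l addr0 !add0r. Qed.

Lemma heis_mulr1 : right_id heis_one heis_mul.
Proof. by move=> [a x]; rewrite /heis_mul /= heis_form0r !addr0. Qed.

Lemma heis_mulV : left_inverse heis_one heis_inv heis_mul.
Proof.
move=> [a x]; congr (_, _); rewrite /= ?addNr // heis_formNl.
by apply/rowP => k; rewrite !mxE; ring.
Qed.

Lemma heis_mulrV : right_inverse heis_one heis_inv heis_mul.
Proof.
move=> [a x]; congr (_, _); rewrite /= ?addrN // heis_formNr.
by apply/rowP => k; rewrite !mxE; ring.
Qed.

HB.instance Definition _ := isGroup.Build heis
  heis_mulA heis_mul1 heis_mulr1 heis_mulV heis_mulrV.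

Lemma heis_conjE (g h : heis) : (g ^ h)%g = (g.1, g.2 + wedge g.1 h.1).
Proof.
apply: (mulgI h); rewrite conjgE mulVKg; congr (_, _); first by rewrite addrC.
by rewrite /= heis_form_wedge; apply/rowP => k; rewrite !mxE; ring.
Qed.

Lemma heis_invmulE (g h : heis) : (g^-1 * h)%g =
  (h.1 - g.1, h.2 + heis_form g.1 g.1 - heis_form g.1 h.1 - g.2).
Proof.
congr (_, _); rewrite /= ?heis_formNl; first exact: addrC.
by apply/rowP => k; rewrite !mxE; ring.
Qed.

Section NormalHeis.
Implicit Types (N : set heis) (M : set 'rV[int]_4) (L : set 'rV[int]_6).

Definition proj_ab N : set 'rV[int]_4 := [set x | exists y, N (x, y)].
Definition center_part N : set 'rV[int]_6 := [set y | N (0, y)].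

Lemma heis_shift N x y z : is_subgroup N -> N (x, y) -> N (x, z) <-> center_part N (z - y).
Proof.
move=> [_ NM NV] Nxy; split=> [Nxz|Nzy].
  have := NM _ _ (NV _ Nxy) Nxz; rewrite heis_invmulE /= subrr /center_part /=.
  by rewrite addrK.
have := NM _ _ Nxy Nzy; congr N; congr (_, _); rewrite /= ?addr0 //.
by rewrite heis_form0r addr0 addrC subrK.
Qed.

Lemma addsub_proj_ab N : is_subgroup N -> addsub (proj_ab N).
Proof.
move=> [N1 NM NV]; split=> [|x y [x' Nx] [y' Ny]]; first by exists 0.
have := NM _ _ (NV _ Ny) Nx; rewrite heis_invmulE /= => H.
by eexists; exact: H.
Qed.

Lemma addsub_center_part N : is_subgroup N -> addsub (center_part N).
Proof.
move=> HN; split=> [|x y Nx Ny]; first by case: HN.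
exact/(heis_shift x HN Ny).
Qed.

Lemma pair_cond_normal N : is_normal N -> pair_cond (proj_ab N) (center_part N).
Proof.
move=> [HN NJ] x y [z Nz]; have := NJ _ (y, 0) Nz; rewrite heis_conjE /=.
by move/(heis_shift _ HN Nz); rewrite addrAC subrr add0r.
Qed.

Definition coset_mul (G : groupType) (N : set G) (x y : G) := N (x^-1 * y)%g.

Lemma has_indexE (G : groupType) (N : set G) n :
  has_index N n = nclasses (coset_mul N) setT n.
Proof.
rewrite /has_index /nclasses; congr (_ #= _).
apply: eq_imagel => x _; apply/seteqP; split=> [_ [y Ny <-]|y Ny].
  by rewrite /coset_mul mulKg.
by exists (x^-1 * y)%g; rewrite ?mulVKg.
Qed.

Section CosetEquiv.
Variables (G : groupType) (N : set G) (HN : is_subgroup N).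

Lemma coset_mul_refl x : coset_mul N x x.
Proof. by rewrite /coset_mul mulVg; case: HN. Qed.

Lemma coset_mul_sym x y : coset_mul N x y -> coset_mul N y x.
Proof. by rewrite /coset_mul => /(let: And3 _ _ NV := HN in NV _); rewrite invgM invgK. Qed.

Lemma coset_mul_trans x y z : coset_mul N x y -> coset_mul N y z -> coset_mul N x z.
Proof.
case: HN => _ NM _ xy yz; have := NM _ _ xy yz.
by rewrite /coset_mul mulgA mulgK.
Qed.

Lemma has_indexP n : has_index N n <-> exists f : 'I_n -> G,
  (forall x, exists i, N ((f i)^-1 * x)%g) /\ (forall i j, N ((f i)^-1 * f j)%g -> i = j).
Proof.
rewrite has_indexE nclassesP; [|exact: coset_mul_refl|exact: coset_mul_sym|exact: coset_mul_trans].
split=> -[f]; first by case=> _ fex finj; exists f; split=> // x; exact: fex.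
by case=> fex finj; exists f; split=> // x _; exact: fex.
Qed.

End CosetEquiv.

Lemma has_index_uniq (G : groupType) (N : set G) m n : has_index N m -> has_index N n -> m = n.
Proof. exact: card_uniq. Qed.

Lemma heis_index N m n : is_subgroup N ->
  index_is setT (proj_ab N) m -> index_is setT (center_part N) n -> has_index N (m * n).
Proof.
move=> HN.
have HM := addsub_proj_ab HN; have HL := addsub_center_part HN.
move=> /(index_isP _ _ HM)[f [_ fex finj]] /(index_isP _ _ HL)[g [_ gex ginj]].
rewrite has_indexE -[m]card_ord -[n]card_ord -card_prod.
apply: (nclassesI (coset_mul_refl HN) (@coset_mul_sym _ _ HN) (@coset_mul_trans _ _ HN)
  (f := fun u : 'I_m * 'I_n => (f u.1, g u.2) : heis)) => // [[x y] _|[i j] [i' j']].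
  have [i [z Nz]] := fex x I.
  have [j Nj] := gex (y + heis_form (f i) (f i) - heis_form (f i) x - z) I.
  exists (i, j); rewrite /coset_mul heis_invmulE /=.
  by apply/(heis_shift _ HN Nz); rewrite addrAC.
rewrite /coset_mul heis_invmulE /= => H.
have eij : i = i' by apply: finj; eexists; exact: H.
move: H; rewrite eij subrr addrK => H.
by rewrite (ginj j j').
Qed.

(** Finitely many cosets of [N] cover the group, which bounds the indices of both parts;
    [heis_index] and the uniqueness of the index then identify their product. *)
Lemma heis_indexI N n : is_subgroup N -> has_index N n ->
  exists m l, [/\ index_is setT (proj_ab N) m, index_is setT (center_part N) l & n = (m * l)%N].
Proof.
move=> HN ind; have /(has_indexP HN)[f [fex _]] := ind.
have HM := addsub_proj_ab HN; have HL := addsub_center_part HN.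
have [m indm] : exists m, index_is setT (proj_ab N) m.
  apply: (index_is_cover (f := fun i => (f i).1) HM) => x _.
  have [i +] := fex (x, 0); rewrite heis_invmulE /= => H.
  by exists i; eexists; exact: H.
have [l indl] : exists l, index_is setT (center_part N) l.
  (* A central element is chosen in every coset of [N] that meets the centre. The default 0 goes to
     the other cosets, which contain no central element to be covered. *)
  have Hg : forall i, exists y, (exists y', N ((f i)^-1 * ((0, y') : heis))%g) ->
      N ((f i)^-1 * ((0, y) : heis))%g.
    move=> i; case: (pselect (exists y', N ((f i)^-1 * ((0, y') : heis))%g)) => [[y Hy]|nH].
      by exists y.
    by exists 0 => /nH.
  have [g gP] := boolp.choice Hg.
  apply: (index_is_cover (f := g) HL) => y _; have [i Hi] := fex (0, y).
  exists i; have := coset_mul_trans HN (coset_mul_sym HN (gP i (ex_intro _ y Hi))) Hi.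
  by rewrite /coset_mul heis_invmulE /= subrr heis_form0l addr0 subr0.
by exists m, l; split=> //; apply: has_index_uniq ind _; exact: heis_index.
Qed.

End NormalHeis.

Section NormalFiber.
Variables (M : set 'rV[int]_4) (L : set 'rV[int]_6) (q : nat).
Hypotheses (HM : addsub M) (HL : addsub L) (ML : pair_cond M L).
Hypotheses (q_odd : odd q) (Lq : forall y, L (y *+ q)).

(** Multiplication by [q.+1./2] inverts 2 modulo L, so that [half_form] is half the
    quadratic form, and subtracting it turns N into the graph of a homomorphism. *)
Definition half_form (x : 'rV[int]_4) : 'rV[int]_6 := heis_form x x *+ q.+1./2.

Let half2 : (q.+1./2 + q.+1./2)%N = q.+1.
Proof. by rewrite addnn -[RHS]odd_double_half /= q_odd. Qed.

Lemma half_formN x : half_form (- x) = half_form x.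
Proof. by rewrite /half_form heis_formNl heis_formNr opprK. Qed.

Lemma half_form0 : half_form 0 = 0.
Proof. by rewrite /half_form heis_form0l mul0rn. Qed.

Lemma half_form2 x : L (half_form x + half_form x - heis_form x x).
Proof. by rewrite /half_form -mulrnDr half2 mulrS addrAC subrr add0r. Qed.

(** The antisymmetric part of the form is a wedge, which lies in [L] as soon as x is in [M]. So the
    form is symmetric modulo [L] there, and a symmetric bilinear cocycle is the coboundary of half
    its quadratic form when 2 is invertible. *)
Lemma half_formD x y : M x ->
  L (half_form (x + y) - heis_form x y - half_form x - half_form y).
Proof.
move=> Mx; set w := wedge x y.
have -> : half_form (x + y) - heis_form x y - half_form x - half_form y =
    heis_form x y *+ q - w *+ q.+1./2.
  rewrite /half_form heis_formDl !heis_formDr (heis_form_wedge x y) -/w.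
  set s := heis_form y x; rewrite !mulrnDl.
  have -> : s *+ q = s *+ q.+1./2 + s *+ q.+1./2 - s.
    by rewrite -mulrnDr half2 mulrS addrAC subrr add0r.
  have -> : w *+ q = w *+ q.+1./2 + w *+ q.+1./2 - w.
    by rewrite -mulrnDr half2 mulrS addrAC subrr add0r.
  by apply/rowP => k; rewrite !mxE; ring.
by apply: HL.2 => //; apply: addsubMn => //; exact: ML.
Qed.

(** The graph of the homomorphism to Z^6 / L that sends row i of [A] to row i of [B], shifted by
    [half_form] to undo the cocycle. *)
Definition hom_subgroup (A : 'M[int]_4) (B : 'M[int]_(4, 6)) : set heis :=
  [set g | exists2 c, g.1 = c *m A & L (g.2 - half_form g.1 - c *m B)].

Variable A : 'M[int]_4.
Hypotheses (dA : \det A != 0) (MA : M = rowlat A).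
Implicit Type B : 'M[int]_(4, 6).

Lemma hom_subgroup_subgroup B : is_subgroup (hom_subgroup A B).
Proof.
have MxA c : M (c *m A) by rewrite MA; exists c.
split=> [|[x y] [x' y'] [c /= -> Lc] [c' /= -> Lc']|[x y] [c /= -> Lc]].
- by exists 0; rewrite /= ?mul0mx ?half_form0 ?subr0 //; case: HL.
- exists (c + c'); rewrite /= !mulmxDl //.
  have -> : y + y' + heis_form (c *m A) (c' *m A) 
      - half_form (c *m A + c' *m A) - (c *m B + c' *m B)
    = (y - half_form (c *m A) - c *m B) + (y' - half_form (c' *m A) - c' *m B)
      - (half_form (c *m A + c' *m A) - heis_form (c *m A) (c' *m A)
         - half_form (c *m A) - half_form (c' *m A)).
    by apply/rowP => k; rewrite !mxE; ring.
  by apply: HL.2; [exact: addsubD|exact: half_formD].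
- exists (- c); rewrite /= ?mulNmx // half_formN opprK.
  have -> : - y + heis_form (c *m A) (c *m A) - half_form (c *m A) + c *m B =
     - (y - half_form (c *m A) - c *m B) -
     (half_form (c *m A) + half_form (c *m A) - heis_form (c *m A) (c *m A)).
    by apply/rowP => k; rewrite !mxE; ring.
  by apply: HL.2; [exact: addsubN|exact: half_form2].
Qed.

Lemma hom_subgroup_normal B : is_normal (hom_subgroup A B).
Proof.
split=> [|g h [c e Lc]]; first exact: hom_subgroup_subgroup.
exists c; rewrite heis_conjE //=.
rewrite -addrA addrAC -addrA; rewrite -addrA in Lc; rewrite addrA addrC.
by apply: addsubD => //; apply: ML; rewrite MA e; exists c.
Qed.

Lemma proj_ab_hom_subgroup B : proj_ab (hom_subgroup A B) = M.
Proof.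
rewrite MA; apply/seteqP; split=> [x [y [c /= -> _]]|_ [c _ <-]]; first by exists c.
exists (half_form (c *m A) + c *m B); exists c => //=.
by rewrite -addrA -opprD subrr; case: HL.
Qed.

Lemma center_part_hom_subgroup B : center_part (hom_subgroup A B) = L.
Proof.
apply/seteqP; split=> [y [c /= e]|y Ly]; last first.
  by exists 0; rewrite /= ?mul0mx ?half_form0 ?subr0.
have -> : c = 0 by apply: (rowlat_inj dA); rewrite -e mul0mx.
by rewrite half_form0 mul0mx !subr0.
Qed.

Lemma hom_subgroup_mem B i : hom_subgroup A B (row i A, half_form (row i A) + row i B).
Proof.
exists (delta_mx 0 i); rewrite /= -?rowE // -addrA -opprD subrr.
by case: HL.
Qed.

(** Removing the shift by [half_form] makes [N] an additive subgroup of Z^4 x Z^6. Membership of the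
    four basis rows then propagates to all their integral combinations. *)
Lemma hom_subgroup_eq N B : is_subgroup N -> proj_ab N = M -> center_part N = L ->
  (forall i, N (row i A, half_form (row i A) + row i B)) -> N = hom_subgroup A B.
Proof.
move=> HN pN cN NAB.
pose K : set ('rV[int]_4 * 'rV[int]_6)%type := [set u | N (u.1, half_form u.1 + u.2)].
have HK : addsub K.
  split=> [|[x z] [x' z'] Kx Kx'] /=; first by rewrite /K /= half_form0 addr0; case: HN.
  have Mx : M x by rewrite -pN; eexists; exact: Kx.
  have Mx' : M (- x') by apply: addsubN => //; rewrite -pN; eexists; exact: Kx'.
  have := HN; case=> _ NM NV; have := NM _ _ Kx (NV _ Kx').
  move=> H; apply/(heis_shift _ HN H); rewrite cN /=.
  have -> : half_form (x - x') + (z - z') - (half_form x + z +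
      (- (half_form x' + z') + heis_form x' x') + heis_form x (- x')) =
    (half_form (x - x') - heis_form x (- x') - half_form x - half_form (- x'))
    + (half_form x' + half_form x' - heis_form x' x').
    by rewrite half_formN; apply/rowP => k; rewrite !mxE; ring.
  by apply: addsubD => //; [exact: half_formD|exact: half_form2].
have Kc c : K (c *m A, c *m B).
  pose K' := [set c : 'rV[int]_4 | K (c *m A, c *m B)].
  have HK' : addsub K'.
    split=> [|c1 c2 K1 K2]; rewrite /K' /=; first by rewrite !mul0mx; exact: HK.1.
    by rewrite !mulmxBl; exact: HK.2 K1 K2.
  rewrite -[c]mulmx1; apply: (addsub_mulmx c HK') => i.
  by rewrite /K' /= row1 -!rowE; exact: NAB.
apply/seteqP; split=> [[x y] Nxy|[_ y] [c /= -> Lc]].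
  have : M x by rewrite -pN; exists y.
  rewrite MA => -[c _ e]; exists c => //=; rewrite -{1}cN -addrA -opprD.
  have Kx : N (x, half_form x + c *m B) by have := Kc c; rewrite e.
  exact/(heis_shift _ HN Kx).
have Kx : N (c *m A, half_form (c *m A) + c *m B) := Kc c.
by apply/(heis_shift _ HN Kx); rewrite cN opprD addrA.
Qed.

(** A homomorphism is determined by the cosets of [L] that contain the images of the four basis
    rows, and these cosets can be prescribed freely. *)
Lemma card_normal_fiber m : index_is setT L m ->
  [set N : set heis | is_normal N /\ (proj_ab N, center_part N) = (M, L)] #= `I_(m ^ 4).
Proof.
move=> /(index_isP _ _ HL)[g [_ gex ginj]].
have -> : (m ^ 4 = #|{ffun 'I_4 -> 'I_m}|)%N by rewrite card_ffun !card_ord.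
pose G (h : {ffun 'I_4 -> 'I_m}) : 'M[int]_(4, 6) := \matrix_i g (h i).
rewrite (_ : [set N | _] = range (fun h => hom_subgroup A (G h))).
  apply: range_card => h h' e; apply/ffunP => i; apply: ginj.
  have := hom_subgroup_mem (G h') i; rewrite -e => -[c /= eA].
  have -> : c = delta_mx 0 i by apply: (rowlat_inj dA); rewrite -eA rowE.
  by rewrite [half_form _ + _]addrC addrK -rowE !rowK.
apply/seteqP; split=> [N [[HN NJ] [pN cN]]|_ [h _ <-]]; last first.
  split; first exact: hom_subgroup_normal.
  by rewrite proj_ab_hom_subgroup center_part_hom_subgroup.
have H i : exists j, N (row i A, half_form (row i A) + g j).
  have : proj_ab N (row i A) by rewrite pN MA; exists (delta_mx 0 i); rewrite // -rowE.
  move=> [y Ny]; have [j Lj] := gex (y - half_form (row i A)) I.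
  exists j; apply/(heis_shift _ HN Ny); rewrite cN -opprB; apply: addsubN => //.
  by rewrite opprD addrA.
exists [ffun i => sval (cid (H i))] => //; apply/esym/hom_subgroup_eq => // i.
by rewrite rowK ffunE; exact: (svalP (cid (H i))).
Qed.

End NormalFiber.

Section NormalCount.
Variables (p : nat) (p_pr : prime p) (p_odd : odd p).

Lemma card_normal_pairs k l d e :
  [set N : set heis | is_normal N /\ pairs p k l d e (proj_ab N, center_part N)]
  #= `I_(num_pairs p k l d e * (p ^ l) ^ 4).
Proof.
apply: (card_fibers (num_pairsP p_pr k l d e) (f := fun N => (proj_ab N, center_part N))).
  by move=> N [].
move=> [M L] HML; have [[/= HM HL ML] [i1 i2 r1 r2]] := HML.
have [A dA eA] := index_basis p_pr HM i1.
have odd_q : odd (p ^ l) by rewrite oddX p_odd orbT.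
have := card_normal_fiber HM HL ML odd_q (index_is_mul HL i2) dA eA i2.
congr (_ #= _); apply/seteqP; split=> N /= [H1 H2]; split=> //; last by case: H1.
by split=> //; rewrite H2.
Qed.

Lemma card_normal_heis n :
  [set N : set heis | is_normal N /\ has_index N (p ^ n)] #=
  `I_(\sum_(l < n.+1) \sum_(d < 5) \sum_(e < 7) num_pairs p (n - l) l d e * (p ^ l) ^ 4)%N.
Proof.
pose B (i : 'I_n.+1 * ('I_5 * 'I_7)) := [set N : set heis | is_normal N /\
  pairs p (n - i.1) i.1 i.2.1 i.2.2 (proj_ab N, center_part N)].
under eq_bigr do rewrite pair_big /=.
rewrite pair_big /= (_ : [set N | _] = \bigcup_i B i); last first.
  apply/seteqP; split=> [N [NN indN]|N [[l [d e]] _ [NN [_ [/= i1 i2 _ _]]]]]; last first.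
    split=> //; rewrite -(subnK (_ : (l <= n)%N)) -1?ltnS // expnD.
    by apply: heis_index => //; case: NN.
  have [HN _] := NN; have [m [k [im ik e]]] := heis_indexI HN indN.
  have [l le ek] : exists2 l, (l <= n)%N & k = (p ^ l)%N.
    by apply/(dvdn_pfactor _ _ p_pr); rewrite e dvdn_mull.
  have em : m = (p ^ (n - l))%N.
    apply/eqP; rewrite -(eqn_pmul2r (m := p ^ l)); last by rewrite expn_gt0 prime_gt0.
    by rewrite -expnD subnK // e ek.
  have ltd : (rk p (proj_ab N) < 5)%N by rewrite ltnS rk_le.
  have lte : (rk p (center_part N) < 7)%N by rewrite ltnS rk_le.
  have ltl : (l < n.+1)%N by [].
  exists (Ordinal ltl, (Ordinal ltd, Ordinal lte)) => //; split=> //=.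
  split; first by split; [exact: addsub_proj_ab|exact: addsub_center_part|exact: pair_cond_normal].
  by split=> //=; rewrite -?em -?ek.
apply: card_bigcup => [[l [d e]]|[l [d e]] [l' [d' e']] N
    [_ [_ [/= _ i1 r1 r2]]] [_ [_ [/= _ i2 r3 r4]]]].
  exact: card_normal_pairs.
have /eqP := card_uniq i1 i2; rewrite eqn_exp2l ?prime_gt1 // => /eqP ell.
congr (_, (_, _)); apply: val_inj; rewrite //=;
  [exact: etrans (esym r1) r3|exact: etrans (esym r2) r4].
Qed.

End NormalCount.

(** * The isomorphism of [F24] with [heis] *)

Section Transfer.
Variables (G H : groupType) (f : G -> H).
Hypotheses (fM : {morph f : x y / (x * y)%g}) (f_inj : injective f).
Hypothesis f_surj : forall y, exists x, f x = y.

Let f1 : f 1%g = 1%g.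
Proof. by apply: (mulgI (f 1%g)); rewrite -fM !mulg1. Qed.

Let fV x : f x^-1%g = (f x)^-1%g.
Proof. by apply: (mulgI (f x)); rewrite -fM !mulgV f1. Qed.

Lemma normal_preimage (N : set H) : is_normal (f @^-1` N) <-> is_normal N.
Proof.
split=> [[[N1 NM NV] NJ]|[[N1 NM NV] NJ]].
  split=> [|y z]; last first.
    have [x <-] := f_surj y; have [w <-] := f_surj z => Nx.
    by have := NJ x w Nx; rewrite /conjg /preimage /= !fM fV.
  split=> [|y z|y]; first by rewrite -f1.
    by have [x <-] := f_surj y; have [w <-] := f_surj z; rewrite -fM; exact: NM.
  by have [x <-] := f_surj y; rewrite -fV; exact: NV.
split=> [|y z Ny]; last by rewrite /preimage /conjg /= !fM fV; exact: NJ.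
by split=> [|y z|y] /=; rewrite ?f1 ?fM ?fV //; [exact: NM|exact: NV].
Qed.

Lemma index_preimage (N : set H) n : is_normal N ->
  has_index (f @^-1` N) n <-> has_index N n.
Proof.
move=> NN; have [HN _] := NN; have [HN' _] := (normal_preimage N).2 NN.
rewrite (has_indexP HN) (has_indexP HN').
split=> -[g [gex ginj]].
  exists (f \o g); split=> [y|i j] /=.
    have [x <-] := f_surj y; have [i +] := gex x.
    by rewrite /preimage /= fM fV; exists i.
  by rewrite -fV -fM; exact: ginj.
pose g' i := sval (cid (f_surj (g i))); have g'K i : f (g' i) = g i := svalP (cid (f_surj (g i))).
exists g'; split=> [x|i j]; rewrite /preimage /=.
  by have [i Ni] := gex (f x); exists i; rewrite fM fV g'K.
by rewrite fM fV !g'K; exact: ginj.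
Qed.

Lemma card_normal_transfer n m :
  [set N : set H | is_normal N /\ has_index N n] #= `I_m ->
  num_normal_subgroups G n = m.
Proof.
move=> Hm; apply: card_fset_set.
rewrite (_ : [set N | _] = preimage f @` [set N : set H | is_normal N /\ has_index N n]).
  apply: card_inj_image Hm => A B e.
  have eAB x : A (f x) = B (f x) := congr1 (fun S : set G => S x) e.
  by apply/seteqP; split=> y; have [x <-] := f_surj y; rewrite eAB.
have fK (N : set G) : f @^-1` (f @` N) = N.
  by apply/seteqP; split=> [x [y Ny /f_inj <-]//|x Nx]; exists x.
apply/seteqP; split=> [N [NN iN]|_ [N [NN iN] <-]]; last first.
  by split; [apply/normal_preimage|apply/index_preimage].
have NN' : is_normal (f @` N) by apply/normal_preimage; rewrite fK.
exists (f @` N); last exact: fK.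
by split=> //; apply/(index_preimage _ NN'); rewrite fK.
Qed.

End Transfer.

Section ZPow.
Variable G : groupType.
Implicit Types (x y : G) (m n : int).
Local Open Scope group_scope.

Definition zpow x (n : int) : G :=
  match n with Posz k => x ^+ k | Negz k => x ^- k.+1 end.

Lemma zpow0 x : zpow x 0 = 1. Proof. by []. Qed.

Lemma zpowS x n : zpow x (1 + n)%R = x * zpow x n.
Proof.
case: n => [n|[|n]]; first by rewrite -PoszD add1n /= expgS.
  by rewrite /= mulgV.
have -> : (1 + Negz n.+1)%R = Negz n.
  by rewrite !NegzE -[n.+2]addn1 PoszD opprD addrA addrAC subrr add0r.
by rewrite /= [x ^+ n.+2]expgSr invgM mulVKg.
Qed.

Lemma zpowD x m n : zpow x (m + n)%R = zpow x m * zpow x n.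
Proof.
elim/int_rect: m n => [n|m IHm n|m IHm n]; first by rewrite add0r mul1g.
  by rewrite -addn1 addnC PoszD -addrA !zpowS IHm mulgA.
have e : (- m%:Z)%R = (1 + - m.+1%:Z)%R by rewrite -addn1 PoszD opprD addrC subrK.
apply: (mulgI x); rewrite mulgA -zpowS -(zpowS x (- m.+1%:Z)%R) addrA -e.
exact: IHm.
Qed.

Lemma zpow_unique x (f : int -> G) :
  f 0%R = 1 -> (forall n, f (1 + n)%R = x * f n) -> forall n, zpow x n = f n.
Proof.
move=> f0 fS; elim/int_rect => [//|n IHn|n IHn]; first by rewrite intS zpowS IHn fS.
apply: (mulgI x); rewrite -zpowS -fS.
by have -> : (1 + - n.+1%:Z)%R = (- n%:Z)%R by rewrite intS opprD addrA subrr add0r.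
Qed.

Lemma commute_zpow x y n : commute x y -> commute x (zpow y n).
Proof.
by move=> xy; case: n => n /=; [exact: commuteX|apply/commuteV/commuteX].
Qed.

Lemma zpowM_commute x y n : commute x y -> zpow (x * y) n = zpow x n * zpow y n.
Proof.
move=> xy; case: n => n /=; first exact: expgMn.
rewrite expgMn // invgM; apply: commute_sym; apply: commuteV; apply: commute_sym.
by apply: commuteV; exact: commuteX2.
Qed.

Lemma conj_zpow x y n : (zpow x n) ^ y = zpow (x ^ y) n.
Proof. by case: n => n /=; rewrite ?conjVg conjXg. Qed.

End ZPow.

Lemma morph_zpow (G H : groupType) (f : G -> H) : {morph f : x y / (x * y)%g} ->
  forall x n, f (zpow x n) = zpow (f x) n.
Proof.
move=> fM; have f1 : f 1%g = 1%g by apply: (mulgI (f 1%g)); rewrite -fM !mulg1.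
have fX x n : f (x ^+ n)%g = (f x ^+ n)%g.
  by elim: n => [|n IHn]; rewrite ?expg0 // !expgS fM IHn.
move=> x [] n /=; first exact: fX.
by apply: (mulgI (f (x ^+ n.+1)%g)); rewrite -fM mulgV f1 fX mulgV.
Qed.

Definition ords4 : seq 'I_4 := [:: 0; 1; 2%:R; 3%:R].

Section ClassTwo.
Variables (G : groupType) (a : 'I_4 -> G).
Hypothesis class2 : forall x y z : G, ([~ [~ x, y], z] = 1)%g.
Local Open Scope group_scope.

Let comm_central (x y z : G) : commute z [~ x, y].
Proof. by apply/commute_sym/commgP/eqP/class2. Qed.

Definition ord_prod (s : seq 'I_4) (x : 'rV[int]_4) : G := \prod_(j <- s) zpow (a j) (x 0 j)%R.

Definition center_prod (y : 'rV[int]_6) : G :=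
  \prod_(k < 6) zpow [~ a (pair_fst k), a (pair_snd k)] (y 0 k)%R.

Lemma center_prodD y z : center_prod (y + z)%R = center_prod y * center_prod z.
Proof.
rewrite -prodgM_commute => [|i j _ _]; last exact/commute_zpow/comm_central.
by apply: eq_bigr => k _; rewrite mxE zpowD.
Qed.

Lemma gen_swap i j n : a i * zpow (a j) n = zpow (a j) n * a i * zpow [~ a j, a i] (- n)%R.
Proof.
apply: (mulIg (zpow [~ a j, a i] n)).
rewrite -[RHS]mulgA -zpowD addNr mulg1 [RHS]conjgC conj_zpow.
have -> : a j ^ a i = a j * [~ a j, a i] by rewrite commgEl mulVKg.
by rewrite zpowM_commute ?mulgA //; exact: comm_central.
Qed.

Lemma gen_ord_prod i s x : a i * ord_prod s x =
  ord_prod s x * (a i * \prod_(j <- s) zpow [~ a j, a i] (- x 0%R j)%R).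
Proof.
elim: s => [|j s IHs]; first by rewrite /ord_prod !big_nil !mulg1 mul1g.
rewrite /ord_prod !big_cons -/(ord_prod s x) mulgA gen_swap -!mulgA; congr (_ * _).
have cz n g : commute g (zpow [~ a j, a i] n) by exact/commute_zpow/comm_central.
rewrite -[zpow _ _ * ord_prod s x]cz mulgA IHs -!mulgA; congr (_ * (_ * _)).
exact: cz.
Qed.

(** To reach its place, a_i passes only the a_j with j < i, and each passage leaves the central
    factor [a_j, a_i]^(- x_j). These are the only nonzero entries of [heis_form] at the i-th unit
    vector, so [s1] and [s2] are the indices before and after i. *)
Lemma gen_ords4 i x : a i * ord_prod ords4 x =
  ord_prod ords4 (delta_mx 0 i + x)%R * center_prod (heis_form (delta_mx 0 i) x).
Proof.
have [s1 [s2 [e n1 n2 ->]]] : exists s1 s2, [/\ ords4 = s1 ++ i :: s2, i \notin s1, i \notin s2 &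
    center_prod (heis_form (delta_mx 0 i) x) = \prod_(j <- s1) zpow [~ a j, a i] (- x 0%R j)%R].
  rewrite /center_prod !big_ord_recl big_ord0 !mxE.
  case: i => [[|[|[|[|//]]]] lti].
  - have -> : Ordinal lti = 0%R by exact: val_inj.
    exists [::], [:: 1; 2%:R; 3%:R]%R; split=> //.
    by rewrite big_nil /= ?mul0r ?oppr0 !zpow0 !mulg1.
  - have -> : Ordinal lti = 1%R by exact: val_inj.
    exists [:: 0%R], [:: 2%:R; 3%:R]%R; split=> //.
    by rewrite !big_cons big_nil /= ?mul1r ?mul0r ?oppr0 !zpow0 !mulg1 ?mul1g.
  - have -> : Ordinal lti = 2%:R%R by exact: val_inj.
    exists [:: 0; 1]%R, [:: 3%:R]%R; split=> //.
    by rewrite !big_cons big_nil /= ?mul1r ?mul0r ?oppr0 !zpow0 !mulg1 ?mul1g.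
  - have -> : Ordinal lti = 3%:R%R by exact: val_inj.
    exists [:: 0; 1; 2%:R]%R, [::]; split=> //.
    by rewrite !big_cons big_nil /= ?mul1r ?mul0r ?oppr0 !zpow0 !mulg1 ?mul1g.
have E s : i \notin s -> ord_prod s (delta_mx 0 i + x)%R = ord_prod s x.
  move=> ns; apply: eq_big_seq => j js; rewrite !mxE /=.
  by case: eqP => [ji|_]; [move: ns; rewrite -ji js|rewrite add0r].
rewrite e /ord_prod !big_cat /= !big_cons -!/(ord_prod _ _) !E // mulgA gen_ord_prod.
rewrite !mxE !eqxx zpowS -!mulgA; congr (_ * (_ * _)).
rewrite [RHS]mulgA; apply/commute_sym/commute_prod => j _.
exact/commute_zpow/comm_central.
Qed.

Definition normal_form (g : heis) : G := ord_prod ords4 g.1 * center_prod g.2.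

Definition heis_gen (i : 'I_4) : heis := (delta_mx 0 i, 0)%R.

(** Equivariance under the generators and their inverses drives an induction over words, which
    identifies [normal_form] after [ev] with the projection to [F24]. *)
Lemma normal_form_gen i g : a i * normal_form g = normal_form (heis_gen i * g).
Proof.
rewrite /normal_form mulgA gen_ords4 -mulgA -center_prodD /=; congr (_ * center_prod _).
by rewrite /= add0r addrC.
Qed.

Lemma normal_form_genV i g : (a i)^-1 * normal_form g = normal_form ((heis_gen i)^-1 * g).
Proof. by apply: (mulgI (a i)); rewrite mulVKg normal_form_gen mulVKg. Qed.

Lemma normal_form1 : normal_form 1 = 1.
Proof.
rewrite /normal_form /ord_prod /center_prod !big1_seq ?mulg1 // => k _; by rewrite mxE.
Qed.

End ClassTwo.

Section FreeEval.
Variables (T : choiceType) (H : groupType) (h : T -> H).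
Local Open Scope group_scope.

Definition letter_eval (a : T * bool) : H := if a.2 then h a.1 else (h a.1)^-1.

Definition word_eval (w : seq (T * bool)) : H := foldr (fun a g => letter_eval a * g) 1 w.

Lemma letter_evalV a : letter_eval (letter_inv a) = (letter_eval a)^-1.
Proof. by case: a => t [] //=; rewrite invgK. Qed.

Lemma word_eval_push a w : word_eval (word_push a w) = letter_eval a * word_eval w.
Proof.
case: w => [|b w] //=; case: eqP => // ->.
by rewrite letter_evalV mulVKg.
Qed.

Definition free_eval (x : free_group T) : H := word_eval (sval x).

Lemma free_evalM : {morph free_eval : x y / x * y}.
Proof.
move=> [x rx] [y ry]; rewrite /free_eval /=.
elim: x {rx} => [|a x IHx] /=; first by rewrite mul1g.
by rewrite word_eval_push IHx mulgA.
Qed.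

End FreeEval.

Lemma generated_sub (G : groupType) (A K : set G) : is_subgroup K -> A `<=` K ->
  generated A `<=` K.
Proof. by move=> HK AK x; apply. Qed.

Section HeisIso.
Local Notation F := (free_group 'I_4).
Local Notation gamma3 := (NormalSubgroup (is_normal_lower_central (free_group 'I_4) 3)).
Local Open Scope group_scope.

Definition F24_proj (x : F) : F24 := quotient_proj gamma3 x.

Lemma F24_projM : {morph F24_proj : x y / x * y}.
Proof. by move=> x y; rewrite /F24_proj -quotient_projM. Qed.

Lemma F24_projV x : F24_proj x^-1 = (F24_proj x)^-1.
Proof. by rewrite /F24_proj -quotient_projV. Qed.

Lemma F24_proj1 : F24_proj 1 = 1.
Proof. by []. Qed.

Lemma F24_proj_surj y : exists x, F24_proj x = y.
Proof. by exists (quotient_repr y); exact: quotient_reprK. Qed.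

Lemma F24_projP x y : F24_proj x = F24_proj y <-> @lower_central F 3 (x^-1 * y).
Proof.
split=> [/quotient_projP/coset_relP//|xy].
exact/quotient_projP/coset_relP.
Qed.

Lemma F24_class2 (x y z : F24) : [~ [~ x, y], z] = 1.
Proof.
have [x' <-] := F24_proj_surj x; have [y' <-] := F24_proj_surj y.
have [z' <-] := F24_proj_surj z.
have -> : [~ [~ F24_proj x', F24_proj y'], F24_proj z'] = F24_proj [~ [~ x', y'], z'].
  by rewrite /commg /conjg !(F24_projM, F24_projV).
rewrite -F24_proj1; apply/esym/F24_projP; rewrite invg1 mul1g.
apply: sub_generated; exists [~ x', y']; last by exists z'.
by apply: sub_generated; exists x' => //; exists y'.
Qed.

Definition ev : F -> heis := free_eval heis_gen.

Lemma evM : {morph ev : x y / x * y}. Proof. exact: free_evalM. Qed.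

Lemma evV x : ev x^-1 = (ev x)^-1.
Proof. by apply: (mulgI (ev x)); rewrite -evM !mulgV. Qed.

Lemma heis_commE (g h : heis) : [~ g, h] = (0%R, wedge g.1 h.1).
Proof.
rewrite commgEl heis_conjE heis_invmulE /= subrr.
by congr (_, _); apply/rowP => k; rewrite !mxE; ring.
Qed.

(** Commutators in [heis] have first coordinate 0, and the wedge of 0 with anything vanishes, so
    double commutators are trivial. *)
Lemma ev_gamma3 x : @lower_central F 3 x -> ev x = 1.
Proof.
have sub2 : commutator_subgroup [set: F] [set: F] `<=` [set x | (ev x).1 = 0%R].
  apply: generated_sub => [|_ [u _ [v _ <-]]] /=.
    split=> [|u v|u] /=; rewrite ?evM ?evV //= => ->; rewrite ?add0r ?oppr0 //.
  by rewrite /commg /conjg !(evM, evV) -/(conjg _ _) -/(commg _ _) heis_commE.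
have : commutator_subgroup (commutator_subgroup [set: F] [set: F]) [set: F]
    `<=` [set x | ev x = 1].
  apply: generated_sub => [|_ [u /sub2 /= u0 [v _ <-]]] /=.
    split=> [|u v|u] /=; rewrite ?evM ?evV // => ->; rewrite ?mul1g ?invg1 //.
  rewrite /commg /conjg !(evM, evV) -/(conjg _ _) -/(commg _ _) heis_commE u0.
  by congr (_, _); apply/rowP => k; rewrite wedgeE !mxE; ring.
by apply.
Qed.

(** Evaluated on a chosen representative; [ev_gamma3] makes the value independent of the choice. *)
Definition F24_heis (x : F24) : heis := ev (quotient_repr x).

Lemma F24_heis_proj x : F24_heis (F24_proj x) = ev x.
Proof.
have /F24_projP/ev_gamma3 : F24_proj (quotient_repr (F24_proj x)) = F24_proj x.
  exact: quotient_reprK.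
by rewrite evM evV => /mulg1_eq; rewrite invgK.
Qed.

Lemma F24_heisM : {morph F24_heis : x y / x * y}.
Proof.
move=> x y; have [x' <-] := F24_proj_surj x; have [y' <-] := F24_proj_surj y.
by rewrite -F24_projM !F24_heis_proj evM.
Qed.

Definition free_letter (i : 'I_4) : F := exist (@reduced 'I_4) [:: (i, true)] isT.

Definition F24_gen (i : 'I_4) : F24 := F24_proj (free_letter i).

Lemma normal_form_ev x : normal_form F24_gen (ev x) = F24_proj x.
Proof.
case: x => w; rewrite /ev /free_eval /=; elim: w => [|[i b] w IHw] rw.
  rewrite normal_form1 -F24_proj1; congr F24_proj; exact: val_inj.
have rw' : reduced w := path_sorted rw.
set l : F := if b then free_letter i else (free_letter i)^-1.
have -> : exist _ ((i, b) :: w) rw = l * (exist _ w rw' : F) :> F.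
  apply: val_inj; rewrite /l; case: b rw {l} => rw /=;
    by case: w rw {IHw rw'} => [|c w] //= /andP[/negPf ->].
rewrite F24_projM -IHw /= /letter_eval /l; case: b rw {l} => rw /=.
  by rewrite normal_form_gen //; exact: F24_class2.
by rewrite F24_projV normal_form_genV //; exact: F24_class2.
Qed.

Lemma F24_heisK : cancel F24_heis (normal_form F24_gen).
Proof.
by move=> x; have [x' <-] := F24_proj_surj x; rewrite F24_heis_proj normal_form_ev.
Qed.

Lemma heis_gen_zpow i n : zpow (heis_gen i) n = (delta_mx 0%R i *~ n, 0)%R.
Proof.
have form0 : heis_form (delta_mx 0%R i) (delta_mx 0%R i) = 0%R.
  apply/rowP => k; rewrite !mxE /=.
  have ne : pair_snd k != pair_fst k by case: k => [[|[|[|[|[|[|//]]]]]] ltk].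
  case: (eqVneq (pair_snd k) i) => [e|_]; last by rewrite mul0r oppr0.
  case: (eqVneq (pair_fst k) i) => [e'|_]; last by rewrite mulr0 oppr0.
  by rewrite e e' eqxx in ne.
apply: (zpow_unique (f := fun n => (delta_mx 0 i *~ n, 0)%R : heis)) => // m.
congr (_, _); first by rewrite mulrzDr.
rewrite /= !add0r; elim/int_rect: m => [|m IHm|m IHm]; first by rewrite mulr0z heis_form0r.
  by rewrite intS mulrzDr heis_formDr -IHm form0 addr0.
by rewrite intS opprD mulrzDr heis_formDr -IHm mulrNz heis_formNr form0 oppr0 addr0.
Qed.

Lemma heis_center_zpow (y : 'rV[int]_6) n : zpow ((0%R, y) : heis) n = (0, y *~ n)%R.
Proof.
apply: (zpow_unique (f := fun n => (0, y *~ n)%R : heis)) => // m.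
by congr (_, _); rewrite /= ?addr0 // heis_form0l addr0 mulrzDr.
Qed.

Lemma wedge_gen k : wedge (delta_mx 0%R (pair_fst k)) (delta_mx 0%R (pair_snd k)) =
  delta_mx 0%R k :> 'rV[int]_6.
Proof.
apply/rowP => l; rewrite wedgeE !mxE /=.
case: k => [[|[|[|[|[|[|//]]]]]] ltk]; case: l => [[|[|[|[|[|[|//]]]]]] ltl] //=;
  by rewrite -val_eqE.
Qed.

Lemma F24_heis_gen i : F24_heis (F24_gen i) = heis_gen i.
Proof. by rewrite F24_heis_proj /ev /free_eval /= mulg1. Qed.

Lemma F24_heis_ord_prod s x :
  (F24_heis (ord_prod F24_gen s x)).1 = (\sum_(j <- s) delta_mx 0 j *~ x 0 j)%R.
Proof.
rewrite /ord_prod; elim: s => [|j s IHs]; first by rewrite !big_nil F24_heis_proj.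
by rewrite !big_cons F24_heisM /= IHs (morph_zpow F24_heisM) F24_heis_gen heis_gen_zpow.
Qed.

Lemma F24_heis_center_prod y : F24_heis (center_prod F24_gen y) = (0%R, y).
Proof.
have E (r : seq 'I_6) : F24_heis (
    \prod_(k <- r) zpow [~ F24_gen (pair_fst k), F24_gen (pair_snd k)] (y 0%R k))
    = (0, \sum_(k <- r) delta_mx 0 k *~ y 0 k)%R.
  elim: r => [|k r IHr]; first by rewrite !big_nil F24_heis_proj.
  rewrite !big_cons F24_heisM IHr (morph_zpow F24_heisM).
  have -> : F24_heis [~ F24_gen (pair_fst k), F24_gen (pair_snd k)] = (0%R, delta_mx 0%R k).
    rewrite -wedge_gen -(heis_commE (heis_gen _) (heis_gen _)) -!F24_heis_gen.
    have fV z : F24_heis z^-1 = (F24_heis z)^-1.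
      by apply: (mulgI (F24_heis z)); rewrite -F24_heisM !mulgV; exact: (F24_heis_proj 1).
    by rewrite /commg /conjg !(F24_heisM, fV).
  by rewrite heis_center_zpow; congr (_, _); rewrite /= ?addr0 // heis_form0l addr0.
rewrite /center_prod E; congr (_, _); rewrite [RHS]row_sum_delta; apply: eq_bigr => k _.
by rewrite -[in RHS](intz (y 0%R k)) scaler_int.
Qed.

Lemma F24_heis_surj g : exists x, F24_heis x = g.
Proof.
case: g => x y; set u := F24_heis (ord_prod F24_gen ords4 x).
have ux : u.1 = x.
  rewrite F24_heis_ord_prod [RHS]row_sum_delta /ords4 !big_cons big_nil.
  rewrite !big_ord_recl big_ord0.
  have e j : (x 0 j *: delta_mx 0 j = (delta_mx 0 j : 'rV[int]_4) *~ x 0 j)%R.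
    by rewrite -[in LHS](intz (x 0%R j)) scaler_int.
  have E (j j' : 'I_4) : val j = val j' ->
      ((delta_mx 0 j : 'rV[int]_4) *~ x 0 j = delta_mx 0 j' *~ x 0 j')%R by move/val_inj ->.
  by rewrite !e; congr (_ + (_ + (_ + (_ + _))))%R; exact: E.
(* The ordered product has the right first coordinate and some central coordinate [u.2], whose value
   is never computed; the central product corrects it. *)
exists (ord_prod F24_gen ords4 x * center_prod F24_gen (y - u.2)%R).
rewrite F24_heisM F24_heis_center_prod -/u; congr (_, _); first by rewrite /= addr0.
by rewrite /= heis_form0r addr0 addrC subrK.
Qed.

Lemma num_normal_F24 n m :
  [set N : set heis | is_normal N /\ has_index N n] #= `I_m ->
  num_normal_subgroups F24 n = m.
Proof.
exact: (card_normal_transfer F24_heisM (can_inj F24_heisK) F24_heis_surj).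
Qed.

End HeisIso.

Local Open Scope complex_scope.

(** * Generating functions *)

(** Along each residue class modulo [s] the sequence contracts by the ratio [k] up to a small error.
    As soon as d is at most (eps / 2)(1 - k), the value eps / 2 is a fixed point of the majorising
    map, and the excess over it decays like a power of [k]. *)
Lemma contraction_cvg0 (R : realType) (e d : nat -> R) (k : R) s : (0 < s)%N ->
  0 <= k < 1 -> (forall n, 0 <= e n) -> (forall n, e (n + s)%N <= k * e n + d n) ->
  d @ \oo --> 0 -> e @ \oo --> 0.
Proof.
move=> s0 /andP[k0 k1] e0 erec /cvgrPdist_le dcvg.
apply/cvgrPdist_le => eps eps0.
have eta0 : 0 < eps / 2 * (1 - k) by rewrite mulr_gt0 ?divr_gt0 ?subr_gt0.
have [N0 _ dN0] := dcvg _ eta0.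
have dle n : (N0 <= n)%N -> d n <= eps / 2 * (1 - k).
  by move/dN0; rewrite /= sub0r normrN; apply: le_trans; exact: ler_norm.
pose C := \sum_(r < s) e (N0 + r)%N.
have C0 : 0 <= C by exact: sumr_ge0.
have claim j (r : 'I_s) : e (N0 + r + j * s)%N <= k ^+ j * C + eps / 2.
  elim: j => [|j IHj].
    rewrite mul0n addn0 expr0 mul1r /C (bigD1 r) //= -addrA lerDl addr_ge0 ?sumr_ge0 //.
    by rewrite divr_ge0 // ltW.
  rewrite mulSn [(s + _)%N]addnC addnA; apply: (le_trans (erec _)).
  have : d (N0 + r + j * s)%N <= eps / 2 * (1 - k) by apply: dle; rewrite -addnA leq_addr.
  have : k * e (N0 + r + j * s)%N <= k * (k ^+ j * C + eps / 2) by exact: ler_wpM2l.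
  by rewrite exprS; move: (k ^+ j) => kj; lra.
have : (fun j => k ^+ j * C) @ \oo --> 0 * C.
  by apply: cvgMl; apply: cvg_expr; rewrite ger0_norm.
rewrite mul0r => /cvgrPdist_le/(_ (eps / 2)); rewrite divr_gt0 // => /(_ isT)[J _ HJ].
exists (N0 + J * s)%N => // n /= le_n; rewrite sub0r normrN ger0_norm //.
have N0n : (N0 <= n)%N by apply: leq_trans le_n; exact: leq_addr.
have := claim ((n - N0) %/ s)%N (Ordinal (ltn_pmod (n - N0) s0)).
rewrite /= -addnA [((n - N0) %% s + _)%N]addnC -divn_eq subnKC // => /le_trans; apply.
have : k ^+ ((n - N0) %/ s) * C <= eps / 2.
  have /HJ : (J <= (n - N0) %/ s)%N by rewrite leq_divRL // leq_subRL.
  by rewrite /= sub0r normrN; apply: le_trans; exact: ler_norm.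
lra.
Qed.

Section ComplexSeries.
Variable R : realType.
Implicit Types z w : R[i].

Definition absc z : R := complex.Re `|z|.

Lemma abscE z : `|z| = (absc z)%:C.
Proof. by rewrite /absc normc_def. Qed.

Lemma absc_ge0 z : 0 <= absc z.
Proof. by have := normr_ge0 z; rewrite abscE (lecR 0). Qed.

Lemma abscM z w : absc (z * w) = absc z * absc w.
Proof. by apply: complexI; rewrite -abscE normrM !abscE rmorphM. Qed.

Lemma abscX z n : absc (z ^+ n) = absc z ^+ n.
Proof. by apply: complexI; rewrite -abscE normrX abscE rmorphXn. Qed.

Lemma absc_nat n : absc n%:R = n%:R.
Proof. by apply: complexI; rewrite -abscE normr_nat rmorph_nat. Qed.

Lemma abscD z w : absc (z + w) <= absc z + absc w.
Proof. by rewrite -lecR rmorphD -!abscE ler_normD. Qed.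

Lemma cvg_absc (u : nat -> R[i]) l :
  u @ \oo --> l <-> (fun n => absc (u n - l)) @ \oo --> 0.
Proof.
split=> /cvgrPdist_lt H; apply/cvgrPdist_lt.
  move=> eps eps0; have eps0' : 0 < eps%:C by rewrite (ltcR 0).
  have [N _ HN] := H _ eps0'; exists N => // n /HN.
  by rewrite /= sub0r normrN (ger0_norm (absc_ge0 _)) distrC abscE ltcR.
move=> [eps im]; rewrite ltcE /= => /andP[/eqP -> eps0]; have [N _ HN] := H eps eps0.
exists N => // n /HN; rewrite /= sub0r normrN (ger0_norm (absc_ge0 _)) distrC abscE.
by rewrite -ltcR.
Qed.

(** The limit is the solution of l = b v + k l, and the distance of [P] to it satisfies the
    contraction inequality with an error proportional to |V - v|. *)
Lemma linear_rec_cvg (P V : nat -> R[i]) (b k v : R[i]) s : (0 < s)%N -> absc k < 1 ->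
  (forall n, P (n + s)%N = b * V n + k * P n) -> V @ \oo --> v ->
  P @ \oo --> b * v / (1 - k).
Proof.
move=> s0 k1 Prec /cvg_absc Vv; set l := _ / _.
have nk : 1 - k != 0.
  by apply/eqP => /subr0_eq k1'; move: k1; rewrite -k1' (absc_nat 1) ltxx.
have el : l = b * v + k * l by rewrite /l; field.
apply/cvg_absc; apply: (contraction_cvg0 (k := absc k) (d := fun n => absc b * absc (V n - v)) s0).
- by rewrite absc_ge0.
- by move=> n; exact: absc_ge0.
- move=> n; rewrite Prec {1}el.
  have -> : b * V n + k * P n - (b * v + k * l) = k * (P n - l) + b * (V n - v) by ring.
  by apply: le_trans (abscD _ _) _; rewrite !abscM.
- by rewrite -(mulr0 (absc b)); exact: cvgMr.
Qed.

End ComplexSeries.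

Lemma antidiagonal_shift (f : nat -> nat -> nat) a b n :
  (forall k l, (k < a)%N || (l < b)%N -> f k l = 0%N) ->
  (\sum_(l < (n + (a + b)).+1) f (n + (a + b) - l) l =
   \sum_(l < n.+1) f (n - l + a) (l + b))%N.
Proof.
move=> f0; rewrite -(big_mkord xpredT (fun l => f (n + (a + b) - l)%N l)).
rewrite -(big_mkord xpredT (fun l => f (n - l + a)%N (l + b)%N)).
rewrite (big_cat_nat (n := b)) ?leq0n //=; last by lia.
rewrite big_nat big1 ?add0n => [|l /andP[_ lb]]; last by rewrite f0 // lb orbT.
rewrite -{1}[b]add0n big_addn (big_cat_nat (n := n.+1)) ?leq0n //=; last by lia.
rewrite [X in (_ + X)%N]big_nat [X in (_ + X)%N]big1 ?addn0 => [|l /andP[nl ll]].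
  by rewrite !big_nat; apply: eq_bigr => l /andP[_ ln]; congr f; lia.
by apply: f0; apply/orP; left; lia.
Qed.

Section PairSeries.
Variables (p : nat) (p_pr : prime p).

(** The factor (p^l)^4 counts the homomorphisms from M to Z^6 / L. *)
Definition gcount d e n : nat := (\sum_(l < n.+1) num_pairs p (n - l) l d e * (p ^ l) ^ 4)%N.

(** The drop of the total index exponent under [up], and at the same time the measure for the
    induction over the triangular system. *)
Definition height d e : nat := ((4 - d) + (6 - e))%N.

Lemma gcount_rec d e n : (d <= 4)%N -> (e <= 6)%N ->
  gcount d e (n + height d e) = (p ^ (4 * (6 - e)) *
    \sum_(d' < 5) \sum_(e' < 7) step_card p d e d' e' * gcount d' e' n)%N.
Proof.
move=> d4 e6; rewrite /gcount /height.
rewrite (antidiagonal_shift (f := fun k l => num_pairs p k l d e * (p ^ l) ^ 4)%N); last first.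
  by move=> k l kl; rewrite num_pairs_small.
under eq_bigr do rewrite num_pairs_rec //.
rewrite big_distrr /=; under [RHS]eq_bigr do rewrite big_distrr /=.
under eq_bigr do rewrite big_distrl /=.
rewrite exchange_big; apply: eq_bigr => d' _ /=.
under eq_bigr do rewrite big_distrl /=.
rewrite exchange_big; apply: eq_bigr => e' _ /=.
rewrite !big_distrr /=; apply: eq_bigr => l _.
rewrite -!expnM mulnDl expnD [(4 * _)%N]mulnC.
set A := num_pairs _ _ _ _ _; set B := step_card _ _ _ _ _.
by move: (p ^ _)%N (p ^ _)%N => X Y; ring.
Qed.

Lemma gcount_small d e n : (n < height d e)%N -> gcount d e n = 0%N.
Proof.
move=> lt; rewrite /gcount big1 // => l _; rewrite num_pairs_small //.
by move: lt; rewrite /height; case: l => l /= ?; lia.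
Qed.

Lemma gcount_top n : gcount 4 6 n = (n == 0%N).
Proof.
rewrite /gcount; case: n => [|n].
  by rewrite big_ord_recl big_ord0 num_pairs_top.
rewrite big1 // => l _; rewrite num_pairs_top //.
by case: l => [[|l]] //= _; rewrite andbF.
Qed.

Definition wedge_rank d : nat := (d * 4 - 'C(d.+1, 2))%N.

Lemma gcount_eq0 d e n : (d <= 4)%N -> (e <= 6)%N -> (e < wedge_rank d)%N -> gcount d e n = 0%N.
Proof.
move=> d4 e6 lt; case: (ltnP n (height d e)) => [|le]; first exact: gcount_small.
rewrite -(subnK le) gcount_rec // big1 ?muln0 // => d' _; rewrite big1 // => e' _.
by rewrite /step_card /between_card -/(wedge_rank d) [(wedge_rank d <= e)%N]leqNgt lt muln0.
Qed.

End PairSeries.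

Lemma gaussn_small q m k : (m < k)%N -> gaussn q m k = 0%N.
Proof.
elim: m k => [|m IHm] [|k] //= mk.
by rewrite !IHm ?muln0 // ltnW.
Qed.

Lemma gaussn_diag q n : gaussn q n n = 1%N.
Proof. by elim: n => //= n ->; rewrite gaussn_small ?muln0. Qed.

(** Triangularity: [up] cannot lower the ranks. The bound [wedge_rank d <= e'] excludes a case in
    which truncated subtraction makes the formula nonzero, namely e' < e = [wedge_rank d]; there d
    <= d' forces e' < [wedge_rank d'], and the series of (d', e') is zero. *)
Lemma step_card_eq0 p d e (d' : 'I_5) (e' : 'I_7) : (d <= 4)%N -> (e <= 6)%N ->
  (d' < d)%N || (wedge_rank d <= e')%N && (e' < e)%N -> step_card p d e d' e' = 0%N.
Proof.
move=> d4 e6 H; rewrite /step_card /between_card leq0n !subn0.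
case/orP: H => [lt|/andP[le lt]].
  by rewrite gaussn_small ?muln0 //; case: d' lt => d' /= ? ?; lia.
rewrite -/(wedge_rank d); case: leqP => // _; last by rewrite muln0.
rewrite [X in (_ * (_ * X))%N]gaussn_small ?muln0 //.
by case: e' le lt => e' /= ? ? ?; lia.
Qed.

Lemma step_card_diag p d e : (d <= 4)%N -> (e <= 6)%N -> (wedge_rank d <= e)%N ->
  step_card p d e d e = (p ^ (d * (4 - d) + (e - wedge_rank d) * (6 - e)))%N.
Proof.
move=> d4 e6 le; rewrite /step_card /between_card leq0n !subn0 -/(wedge_rank d) le.
have -> : (4 - (4 - d) = d)%N by lia.
have -> : (6 - wedge_rank d - (6 - e) = e - wedge_rank d)%N by lia.
by rewrite !gaussn_diag !muln1 expnD.
Qed.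

Lemma wedge_rank_mono d d' : (d <= d')%N -> (d' <= 4)%N -> (wedge_rank d <= wedge_rank d')%N.
Proof. by case: d' => [|[|[|[|[|]]]]] //; case: d => [|[|[|[|[|]]]]]. Qed.

(** This bound is what makes the half-plane Re s > 3 a domain of convergence. *)
Lemma loop_exponent d e : (d <= 4)%N -> (e <= 6)%N -> (wedge_rank d <= e)%N ->
  (4 * (6 - e) + (d * (4 - d) + (e - wedge_rank d) * (6 - e)) <= 3 * height d e)%N.
Proof.
by case: d => [|[|[|[|[|]]]]] //; case: e => [|[|[|[|[|[|[|]]]]]]].
Qed.

Lemma cvg_bigsum (R : realType) (I : finType) (u : I -> nat -> R[i]) l :
  (forall i, u i @ \oo --> l i) -> (fun n => \sum_i u i n) @ \oo --> \sum_i l i.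
Proof.
move=> ul; elim: (index_enum I) => [|i r IHr].
  by under [X in X @ _ --> _]funext do rewrite big_nil; rewrite big_nil; exact: cvg_cst.
under [X in X @ _ --> _]funext do rewrite big_cons; rewrite big_cons.
exact: (cvgD (ul i) IHr).
Qed.

Section Convergence.
Variables (R : realType) (p : nat) (p_pr : prime p) (z : R[i]).
Hypothesis z_small : absc z < p%:R ^- 3.

Definition pser d e : nat -> R[i] := series (fun n => (gcount p d e n)%:R * z ^+ n).

Lemma pser_rec d e n : (d <= 4)%N -> (e <= 6)%N ->
  pser d e (n + height d e) = p%:R ^+ (4 * (6 - e)) * z ^+ height d e *
    \sum_(d' < 5) \sum_(e' < 7) (step_card p d e d' e')%:R * pser d' e' n.
Proof.
move=> d4 e6; rewrite /pser /series /=.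
rewrite (big_cat_nat (n := height d e)) ?leq_addl //= big_nat big1 => [|k /andP[_ lt]]; last first.
  by rewrite gcount_small // mul0r.
rewrite add0r -{1}[height d e]add0n big_addn addnK.
transitivity (\sum_(0 <= k < n) p%:R ^+ (4 * (6 - e)) * z ^+ height d e *
    \sum_(d' < 5) \sum_(e' < 7) (step_card p d e d' e')%:R * ((gcount p d' e' k)%:R * z ^+ k)).
  apply: eq_bigr => k _; rewrite gcount_rec // natrM natrX exprD -mulrA [RHS]mulrAC -[RHS]mulrA.
  congr (_ * _); rewrite mulrA; congr (_ * _).
  rewrite natr_sum mulr_suml; apply: eq_bigr => d' _.
  rewrite natr_sum mulr_suml; apply: eq_bigr => e' _.
  by rewrite natrM mulrA.
rewrite -mulr_sumr; congr (_ * _); rewrite exchange_big; apply: eq_bigr => d' _ /=.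
rewrite exchange_big; apply: eq_bigr => e' _ /=.
by rewrite -mulr_sumr.
Qed.

Lemma pser_top : pser 4 6 @ \oo --> (1 : R[i]).
Proof.
rewrite -(cvg_shiftn 1) /=.
have -> : (fun n => pser 4 6 (n + 1)%N) = (fun=> 1); last exact: cvg_cst.
apply/funext => n; rewrite addn1 /pser seriesEnat /= big_nat_recl // gcount_top // expr0 mulr1.
by rewrite big1 ?addr0 // => k _; rewrite gcount_top // mul0r.
Qed.

Lemma pser_eq0 d e : (d <= 4)%N -> (e <= 6)%N -> (e < wedge_rank d)%N -> pser d e = (fun=> 0).
Proof.
move=> d4 e6 lt; apply/funext => n; rewrite /pser seriesEnat /= big1 // => k _.
by rewrite gcount_eq0 // mul0r.
Qed.

(** Induction on [height]: every other series in the recursion has smaller height, is zero, or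
    enters with coefficient zero. The series itself returns with a loop coefficient whose modulus
    [loop_exponent] keeps below 1. *)
Lemma pser_cvg d e : (d <= 4)%N -> (e <= 6)%N -> cvgn (pser d e).
Proof.
have [m] := ubnP (height d e); elim: m d e => // m IHm d e; rewrite ltnS => hm d4 e6.
case: (ltnP e (wedge_rank d)) => [lt|le].
  by rewrite pser_eq0 //; exact: is_cvg_cst.
have [h0|h0] := posnP (height d e).
  have [-> ->] : d = 4%N /\ e = 6%N by move: h0; rewrite /height; lia.
  by apply/cvg_ex; exists 1; exact: pser_top.
pose D : 'I_5 := Ordinal (d4 : (d < 5)%N); pose E : 'I_7 := Ordinal (e6 : (e < 7)%N).
pose u (i : 'I_5 * 'I_7) n := (step_card p d e i.1 i.2)%:R * pser i.1 i.2 n.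
have ucvg i : i != (D, E) -> cvgn (u i).
  case: i => d' e' ne; rewrite /u /=.
  have d4' : (d' <= 4)%N by rewrite -ltnS.
  have e6' : (e' <= 6)%N by rewrite -ltnS.
  case: (boolP ((d' < d)%N || (wedge_rank d <= e')%N && (e' < e)%N)) => [lt|].
    rewrite step_card_eq0 //; under [X in cvg (X @ _)]funext do rewrite mul0r.
    exact: is_cvg_cst.
  rewrite negb_or negb_and -leqNgt -!ltnNge ltnS => /andP[dd' H].
  case: (ltnP e' (wedge_rank d')) => [lt|le'].
    rewrite pser_eq0 //; under [X in cvg (X @ _)]funext do rewrite mulr0.
    exact: is_cvg_cst.
  have ee' : (e <= e')%N.
    have := wedge_rank_mono dd' d4'; move: H; case/orP => //; lia.
  apply: is_cvgMr; apply: IHm => //; apply: leq_trans hm.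
  have : (d' != d :> nat) || (e' != e :> nat).
    rewrite -negb_and; apply: contra ne => /andP[/eqP e1 /eqP e2].
    by apply/eqP; congr (_, _); exact: val_inj.
  by rewrite /height; lia.
pose V n := \sum_(i | i != (D, E)) u i n.
have [v Vv] : exists v : R[i], V @ \oo --> v.
  exists (\sum_i (if i != (D, E) then limn (u i) else 0)).
  rewrite (_ : V = fun n => \sum_i (if i != (D, E) then u i n else 0)); last first.
    by apply/funext => n; rewrite /V big_mkcond.
  apply: cvg_bigsum => i; case: ifP => [ne|_]; last exact: cvg_cst.
  exact: ucvg.
set b := p%:R ^+ (4 * (6 - e)) * z ^+ height d e.
have Prec n : pser d e (n + height d e) = b * V n + b * (step_card p d e d e)%:R * pser d e n.
  rewrite pser_rec // pair_big /= (bigD1 (D, E)) //= mulrDr addrC -/b /V mulrA.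
  by [].
apply/cvg_ex; eexists; apply: (linear_rec_cvg h0 _ Prec Vv).
rewrite /b step_card_diag // natrX mulrAC -exprD abscM !abscX absc_nat.
have p0 : 0 < p%:R :> R by rewrite ltr0n prime_gt0.
have zh : absc z ^+ height d e < (p%:R ^- 3) ^+ height d e.
  by rewrite ltrXn2r -?lt0n ?absc_ge0 // ?invr_ge0 ?exprn_ge0 // ltW.
have : p%:R ^+ (4 * (6 - e) + (d * (4 - d) + (e - wedge_rank d) * (6 - e))) * absc z ^+ height d e
   < p%:R ^+ (3 * height d e) * (p%:R ^- 3) ^+ height d e :> R.
  apply: (@lt_le_trans _ _ (p%:R ^+ (4 * (6 - e) + (d * (4 - d) + (e - wedge_rank d) * (6 - e)))
      * (p%:R ^- 3) ^+ height d e)).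
    by rewrite ltr_pM2l // exprn_gt0.
  rewrite ler_wpM2r ?exprn_ge0 ?invr_ge0 ?exprn_ge0 ?(ltW p0) //.
  by rewrite ler_weXn2l ?ler1n ?prime_gt0 ?loop_exponent.
by rewrite exprM -exprMn divff ?expr1n // expf_neq0 // lt0r_neq0.
Qed.

Definition psum d e : R[i] := limn (pser d e).

Lemma psum_top : psum 4 6 = 1.
Proof. exact: (cvg_lim (@norm_hausdorff _ _) pser_top). Qed.

Lemma psum_eq0 d e : (d <= 4)%N -> (e <= 6)%N -> (e < wedge_rank d)%N -> psum d e = 0.
Proof. by move=> d4 e6 lt; rewrite /psum pser_eq0 // lim_cst. Qed.

Lemma psum_rec d e : (d <= 4)%N -> (e <= 6)%N ->
  psum d e = p%:R ^+ (4 * (6 - e)) * z ^+ height d e *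
    \sum_(d' < 5) \sum_(e' < 7) (step_card p d e d' e')%:R * psum d' e'.
Proof.
move=> d4 e6; apply: (cvg_lim (@norm_hausdorff _ _)).
rewrite -(cvg_shiftn (height d e)) /=.
rewrite (_ : (fun n => _) = fun n => p%:R ^+ (4 * (6 - e)) * z ^+ height d e *
    \sum_(d' < 5) \sum_(e' < 7) (step_card p d e d' e')%:R * pser d' e' n); last first.
  by apply/funext => n; rewrite pser_rec.
apply: cvgMr; apply: cvg_bigsum => d'; apply: cvg_bigsum => e'; apply: cvgMr.
by apply: pser_cvg; rewrite -ltnS.
Qed.

End Convergence.

(** * Igusa factors and the solution of the recursion *)

Lemma flag_poly_rcons m s d :
  flag_poly m (rcons s d) = gauss_binomial m d * flag_poly d s.
Proof.
elim: s => [|e s IHs] //=; rewrite IHs mulrCA; congr (_ * (_ * _)).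
by case: s {IHs}.
Qed.

Section Igusa.
Variables (K : numFieldType) (y : K) (u : nat -> K).

(** The ambient dimension [m] is decoupled from the range [n] of the flag dimensions, because
    splitting off the largest subspace of a flag leaves a flag inside that subspace. *)
Definition flag_sum m n : K := \sum_(I : {set 'I_n})
  (map_poly intr (flag_poly m [seq (nat_of_ord i).+1 | i <- enum I])).[y] *
  \prod_(i in I) u i.+1.

Lemma flag_sum0 m : flag_sum m 0 = 1.
Proof.
rewrite /flag_sum (big_pred1 finset.set0) => [|I]; last first.
  by have -> : I = finset.set0 by [apply/finset.setP => -[]]; rewrite /= eqxx.
have -> : [seq (nat_of_ord i).+1 | i <- enum (finset.set0 : {set 'I_0})] = [::].
  by case: (enum _) => // -[].
by rewrite /= rmorph1 hornerC mul1r big1 // => -[].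
Qed.

Definition set_rcons n (v : bool * {set 'I_n}) : {set 'I_n.+1} :=
  finset (fun i : 'I_n.+1 => if insub (i : nat) is Some j then (j : 'I_n) \in v.2 else v.1).

Lemma widen_set_rcons n (v : bool * {set 'I_n}) j :
  (widen_ord (leqnSn n) j \in set_rcons v) = (j \in v.2).
Proof. by rewrite finset.in_set /= valK. Qed.

Lemma max_set_rcons n (v : bool * {set 'I_n}) : (ord_max \in set_rcons v) = v.1.
Proof. by rewrite finset.in_set /= insubF // ltnn. Qed.

Lemma set_rcons_bij n : bijective (@set_rcons n).
Proof.
pose g (I : {set 'I_n.+1}) : bool * {set 'I_n} :=
  (ord_max \in I, finset (fun j : 'I_n => widen_ord (leqnSn n) j \in I)).
exists g => [[b J]|I]; rewrite /g.
  rewrite max_set_rcons; congr (_, _); apply/finset.setP => j.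
  by rewrite finset.in_set widen_set_rcons.
apply/finset.setP => i; rewrite finset.in_set; case: insubP => [j _ e|] /=.
  by rewrite finset.in_set; congr (_ \in I); exact: val_inj.
rewrite -leqNgt => ni; congr (_ \in I); apply: val_inj => /=.
by apply/eqP; rewrite eqn_leq ni -ltnS ltn_ord.
Qed.

Lemma enum_set_rcons n (v : bool * {set 'I_n}) :
  [seq (nat_of_ord i).+1 | i <- enum (set_rcons v)] =
  if v.1 then rcons [seq (nat_of_ord i).+1 | i <- enum v.2] n.+1
  else [seq (nat_of_ord i).+1 | i <- enum v.2].
Proof.
have E : [seq (nat_of_ord i).+1 | i <- enum v.2] =
    [seq (nat_of_ord i).+1 | i <- seq.filter (mem (set_rcons v))
      (seq.map (widen_ord (leqnSn n)) (enum 'I_n))].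
  rewrite filter_map -map_comp {1}/enum_mem -enumT /=; congr map.
  by apply: eq_filter => j; rewrite /= widen_set_rcons.
rewrite {1}/enum_mem -enumT enum_ordSr filter_rcons /= max_set_rcons.
by case: (v.1); rewrite ?map_rcons -E.
Qed.

Lemma flag_sumS m n :
  flag_sum m n.+1 = flag_sum m n + gauss y m n.+1 * u n.+1 * flag_sum n.+1 n.
Proof.
rewrite {1}/flag_sum (reindex (@set_rcons n)) /=; last exact/onW_bij/set_rcons_bij.
under eq_bigr => v _ do rewrite enum_set_rcons big_mkcond big_ord_recr /= max_set_rcons.
rewrite -(pair_big xpredT xpredT (fun b (J : {set 'I_n}) => (map_poly intr (flag_poly m
   (if b then rcons [seq (nat_of_ord i).+1 | i <- enum J] n.+1
    else [seq (nat_of_ord i).+1 | i <- enum J]))).[y] *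
    ((\prod_(i < n) if widen_ord (leqnSn n) i \in set_rcons (b, J) then u i.+1 else 1) *
     (if b then u n.+1 else 1)))) /=.
rewrite big_bool /= addrC; congr (_ + _).
  apply: eq_bigr => J _; rewrite mulr1; congr (_ * _); rewrite [RHS]big_mkcond.
  by apply: eq_bigr => i _; rewrite widen_set_rcons.
rewrite /flag_sum mulr_sumr; apply: eq_bigr => J _.
rewrite flag_poly_rcons rmorphM hornerM -/(gauss y m n.+1).
rewrite mulrA mulrAC -!mulrA; congr (_ * _); rewrite mulrCA; congr (_ * _); congr (_ * _).
by rewrite [RHS]big_mkcond; apply: eq_bigr => i _; rewrite widen_set_rcons.
Qed.

Lemma flag_sumE m n :
  flag_sum m n = 1 + \sum_(k < n) gauss y m k.+1 * u k.+1 * flag_sum k.+1 k.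
Proof.
elim: n => [|n IHn]; first by rewrite flag_sum0 big_ord0 addr0.
by rewrite flag_sumS IHn big_ord_recr addrA.
Qed.

End Igusa.

(** The terms are sorted by the largest element of the index set. A factor is thus expressed through
    shorter ones in the same variables, which is the shape of the adjoint system in [resp_rec]. *)
Lemma igusa_rec (R : realType) p n (U : nat -> R[i]) : igusa p n U =
  1 + \sum_(k < n) gauss (p%:R^-1) n.+1 k.+1 * (U k.+1 / (1 - U k.+1)) * igusa p k U.
Proof. exact: (flag_sumE p%:R^-1 (fun k => U k / (1 - U k)) n.+1 n). Qed.

(** Counting yields Gaussian binomials at p, whereas Igusa factors use them at the inverse of p.
    Inverting x in a factor x^k - x^i costs a sign and a power of x, and the signs cancel in the
    quotient. *)
Lemma gauss_inv (K : numFieldType) (x : K) m f : 1 < x -> (f <= m)%N ->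
  gauss x m f = x ^+ (f * (m - f)) * gauss x^-1 m f.
Proof.
move=> x1 fm; have x0 : x != 0 by rewrite gt_eqF // (lt_trans ltr01).
have E k : (f <= k)%N -> \prod_(i < f) (x^-1 ^+ k - x^-1 ^+ i) * x ^+ (k * f) * x ^+ 'C(f, 2) =
    (-1) ^+ f * \prod_(i < f) (x ^+ k - x ^+ i).
  move=> fk.
  have -> : x ^+ (k * f) = \prod_(i < f) x ^+ k by rewrite prodr_const card_ord exprM.
  have -> : x ^+ 'C(f, 2) = \prod_(i < f) x ^+ i.
    by rewrite -bin2_sum big_mkord prodrXr.
  rewrite -[X in (-1) ^+ X](card_ord f) -prodr_const -!big_split /=.
  apply: eq_bigr => i _; rewrite !exprVn; field.
  by rewrite !expf_neq0.
have nz : \prod_(i < f) (x ^+ f - x ^+ i) != 0.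
  apply/prodf_neq0 => i _; rewrite subr_eq0 gt_eqF //.
  by rewrite ltr_eXn2l.
apply: (mulIf nz); rewrite gauss_prod.
have := E m fm; have := E f (leqnn f); rewrite -(gauss_prod x^-1 m f).
set P := \prod_(i < f) (x^-1 ^+ f - _); set Q := \prod_(i < f) (x ^+ f - _).
set Q' := \prod_(i < f) (x ^+ m - _); set g := gauss x^-1 m f => e1 e2.
have s2 : (-1) ^+ f * (-1) ^+ f = 1 :> K by rewrite -exprMn mulrNN mulr1 expr1n.
have -> : Q' = (-1) ^+ f * ((-1) ^+ f * Q') by rewrite mulrA s2 mul1r.
have -> : Q = (-1) ^+ f * ((-1) ^+ f * Q) by rewrite mulrA s2 mul1r.
rewrite -e1 -e2; have -> : (m * f = f * (m - f) + f * f)%N.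
  by rewrite -mulnDr subnK // mulnC.
rewrite exprD; ring.
Qed.

(** The pairing of [V] with [A] is expanded by the first system and regrouped by the second; it then
    occurs on both sides and cancels. *)
Lemma adjoint_sum (K : comNzRingType) n (A B V : 'I_n -> K) (M : 'I_n -> 'I_n -> K) :
  (forall i, A i = B i + \sum_j M i j * A j) ->
  (forall j, V j = 1 + \sum_i V i * M i j) ->
  \sum_i A i = \sum_i V i * B i.
Proof.
move=> hA hV; have e : \sum_i V i * A i = \sum_i V i * B i + \sum_j (V j - 1) * A j.
  rewrite (eq_bigr (fun i => V i * B i + \sum_j V i * M i j * A j)) => [|i _]; last first.
    by rewrite {1}hA mulrDr mulr_sumr; congr (_ + _); apply: eq_bigr => j _; rewrite mulrA.
  rewrite big_split exchange_big /=; congr (_ + _); apply: eq_bigr => j _.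
  by rewrite -mulr_suml hV addrAC subrr add0r.
move: e; under [X in _ + X]eq_bigr do rewrite mulrBl mul1r.
rewrite sumrB; move: (\sum_i _ * A i) (\sum_i _ * B i) (\sum_i A i) => a b c e.
by transitivity (a - (a - c)); [ring|rewrite {1}e; ring].
Qed.

Lemma gauss_diag (K : numFieldType) (y : K) n : gauss y n n = 1.
Proof. by elim: n => [|n IHn]; rewrite ?gaussn0 // gaussS IHn gauss_small // mulr0 addr0. Qed.

Section FinalAlgebra.
Variables (R : realType) (p : nat) (t : R[i]) (F : nat -> nat -> R[i]).
Local Notation x := (p%:R : R[i]).
Hypotheses (p_gt1 : (1 < p)%N).
Hypothesis nz : forall a b, (0 < b)%N -> (a <= 3 * b)%N -> 1 - x ^+ a * t ^+ b != 0.
Hypotheses (F_top : F 4 6 = 1).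
Hypothesis F_zero : forall d e, (d <= 4)%N -> (e < wedge_rank d)%N -> F d e = 0.
Hypothesis F_rec : forall d e, (d <= 4)%N -> (e <= 6)%N -> (wedge_rank d <= e)%N ->
  F d e = x ^+ (4 * (6 - e)) * t ^+ height d e *
    \sum_(d' < 5) x ^+ (d * (4 - d')) * gauss x d' d *
      \sum_(e' < 7) x ^+ ((e - wedge_rank d) * (6 - e')) *
        gauss x (e' - wedge_rank d) (e - wedge_rank d) * F d' e'.

Let x1 : 1 < x. Proof. by rewrite ltr1n. Qed.
Let x0 : x != 0. Proof. by rewrite gt_eqF // (lt_trans ltr01 x1). Qed.

Definition Xmon i : R[i] := x ^+ (i * (10 - i)) * t ^+ (4 + i).

Let Xnz i : (i <= 6)%N -> 1 - Xmon i != 0.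
Proof.
move=> i6; apply: nz; first by rewrite addn_gt0.
by case: i i6 => [|[|[|[|[|[|[|]]]]]]].
Qed.

Definition Jsum k : R[i] := igusa p k (fun j => Xmon (6 - j)).

(** With A e the sum over d of F d e, the equations for d = 0 become
    A e = lower_sum e + \sum_e' kern e e' * A e', and [resp] solves the adjoint system. *)
Definition resp e : R[i] :=
  (if e is m.+1 then Jsum m / (1 - Xmon (5 - m)) else 1) / (1 - Xmon 6).

Definition kern e e' : R[i] :=
  x ^+ (4 * (6 - e)) * t ^+ (10 - e) * (x ^+ (e * (6 - e')) * gauss x e' e).

Lemma kern0 e' : kern 0 e' = Xmon 6.
Proof. by rewrite /kern gaussn0 mul0n expr0 !mulr1. Qed.

(** With e = k + 1, e' = m + 1 and i = 6 - e, the exponents 4 i from the homomorphisms, e (6 - e')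
    from avoiding the kernel and e (e' - e) from [gauss_inv] add up to i (10 - i), whatever e' is.
    This is the origin of the numerical data X_i. *)
Lemma kernS k m : (k <= m)%N -> (m <= 5)%N ->
  kern k.+1 m.+1 = Xmon (5 - k) * gauss x^-1 m.+1 k.+1.
Proof.
move=> km m5; rewrite /kern (gauss_inv x1) // /Xmon [x ^+ (k.+1 * _) * (_ * _)]mulrA -exprD.
rewrite mulrACA -exprD mulrA.
have -> : (4 + (5 - k) = 10 - k.+1)%N by lia.
congr (_ * _ * _); congr (x ^+ _).
by case: m m5 km => [|[|[|[|[|[|]]]]]] // _; case: k => [|[|[|[|[|[|]]]]]].
Qed.

Lemma kern_small e e' : (e' < e)%N -> kern e e' = 0.
Proof. by move=> lt; rewrite /kern gauss_small // !mulr0. Qed.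

(** The term e = 0 supplies the factor 1 / (1 - X_6), which is the zeta factor at 10 s - 24; the
    diagonal term supplies 1 / (1 - X_(5-m)); the remaining terms are those of [igusa_rec]. *)
Lemma resp_rec e' : (e' < 7)%N -> resp e' = 1 + \sum_(e < 7) resp e * kern e e'.
Proof.
move=> lt; have nz6 := Xnz (leqnn 6); rewrite big_ord_recl kern0.
case: e' lt => [|m] lt.
  rewrite big1 ?addr0 => [|i _]; last by rewrite kern_small ?mulr0.
  by rewrite /resp; field.
have m5 : (m <= 5)%N by [].
have nzm : 1 - Xmon (5 - m) != 0 by apply: Xnz; lia.
have E : \sum_(i < 6) resp (lift ord0 i) * kern (lift ord0 i) m.+1 =
   (Jsum m - 1) / (1 - Xmon 6) + resp m.+1 * Xmon (5 - m).
  rewrite -(big_mkord xpredT (fun k => resp k.+1 * kern k.+1 m.+1)).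
  rewrite (big_cat_nat (n := m.+1)) //= [X in _ + X]big_nat [X in _ + X]big1 ?addr0; last first.
    by move=> k /andP[mk _]; rewrite kern_small ?mulr0.
  rewrite big_nat_recr //= kernS // /gauss_binomial; congr (_ + _); last first.
    by rewrite gauss_diag mulr1.
  rewrite /Jsum igusa_rec addrAC subrr add0r big_mkord mulr_suml; apply: eq_bigr => k _.
  rewrite kernS //; last exact: ltnW.
  rewrite /resp subSS /Jsum; have := Xnz (leq_trans (leq_subr k 5) (leqnSn 5)).
  by move: (igusa _ _ _) (gauss _ _ _) (Xmon _) (Xmon _) nz6 => a b c d nd nc; field; apply/andP.
rewrite E /resp; field; exact/andP.
Qed.

Definition lower_sum e : R[i] := \sum_(d < 4) F d.+1 e.

Lemma total_sum : \sum_(d < 5) \sum_(e < 7) F d e = \sum_(e < 7) resp e * lower_sum e.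
Proof.
rewrite exchange_big /=.
apply: (adjoint_sum (M := fun e e' : 'I_7 => kern e e')) => [e|e]; last exact: resp_rec.
have e6 : (e <= 6)%N by rewrite -ltnS.
rewrite big_ord_recl addrC; congr (_ + _).
have hh : height 0 e = (10 - e)%N by rewrite /height; lia.
rewrite F_rec // hh mulr_sumr; under [RHS]eq_bigr do rewrite mulr_sumr.
rewrite [RHS]exchange_big; apply: eq_bigr => d' _.
rewrite mul0n expr0 gaussn0 !mul1r mulr_sumr; apply: eq_bigr => e' _.
by rewrite !subn0 /kern !mulrA.
Qed.

(** The sums are cut down to the ranks that can occur, which leaves few enough terms for an explicit
    expansion. *)
Lemma F_recE d e : (d <= 4)%N -> (e <= 6)%N -> (wedge_rank d <= e)%N ->
  F d e = x ^+ (4 * (6 - e)) * t ^+ height d e *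
    \sum_(d <= d' < 5) x ^+ (d * (4 - d')) * gauss x d' d *
      \sum_(wedge_rank d' <= e' < 7) x ^+ ((e - wedge_rank d) * (6 - e')) *
        gauss x (e' - wedge_rank d) (e - wedge_rank d) * F d' e'.
Proof.
move=> d4 e6 le; rewrite F_rec //; congr (_ * _).
rewrite -(big_mkord xpredT (fun d' => x ^+ (d * (4 - d')) * gauss x d' d *
      \sum_(e' < 7) x ^+ ((e - wedge_rank d) * (6 - e')) *
        gauss x (e' - wedge_rank d) (e - wedge_rank d) * F d' e')).
rewrite (big_cat_nat (n := d)) //=; last exact: leqW.
rewrite big_nat big1 ?add0r => [|d' /andP[_ lt]]; last by rewrite gauss_small // mulr0 mul0r.
rewrite !big_nat; apply: eq_bigr => d' /andP[_ d5]; congr (_ * _).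
have w7 : (wedge_rank d' <= 7)%N by case: d' d5 => [|[|[|[|[|]]]]].
rewrite -(big_mkord xpredT (fun e' => x ^+ ((e - wedge_rank d) * (6 - e')) *
        gauss x (e' - wedge_rank d) (e - wedge_rank d) * F d' e')).
rewrite (big_cat_nat (n := wedge_rank d')) //= big_nat big1 ?add0r // => e' /andP[_ lt].
by rewrite F_zero ?mulr0.
Qed.

Ltac nat_eval := repeat match goal with
  | |- context [wedge_rank ?a] =>
    let c := eval vm_compute in (wedge_rank a) in progress change (wedge_rank a) with c
  | |- context [height ?a ?b] =>
    let c := eval vm_compute in (height a b) in progress change (height a b) with c
  | |- context [subn ?a ?b] =>
    let c := eval vm_compute in (subn a b) in progress change (subn a b) with c
  | |- context [muln ?a ?b] =>
    let c := eval vm_compute in (muln a b) in progress change (muln a b) with c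
  end.

Ltac expand_sums :=
  repeat (first [rewrite big_ltn; [|by []] | rewrite big_geq; [|by []]]; nat_eval);
  rewrite !(gaussS, gaussn0, gauss0S) ?F_top.

Lemma solve_loop (f k c : R[i]) : 1 - k != 0 -> f = k * f + c -> f = c / (1 - k).
Proof. by move=> nk e; apply: (canRL (mulfK nk)); rewrite mulrBr mulr1 {1}e; ring. Qed.

Local Notation g21 := (1 + x).
Local Notation g31 := (1 + x + x ^+ 2).
Local Notation g41 := (1 + x + x ^+ 2 + x ^+ 3).
Local Notation g42 := ((1 + x ^+ 2) * (1 + x + x ^+ 2)).

(** Seven unknowns with 0 < d < 4 survive the bound by [wedge_rank]. They are solved one after the
    other, each from those already known, and every denominator comes from the loop of its own
    equation. *)
Lemma F36E : F 3 6 = t * g41 / (1 - x ^+ 3 * t).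
Proof.
apply: solve_loop; first exact: (nz (a := 3) (b := 1)).
by rewrite {1}F_recE //; expand_sums; ring.
Qed.

Lemma F26E : F 2 6 = t ^+ 2 * (x ^+ 2 * g31 * F 3 6 + g42) / (1 - x ^+ 4 * t ^+ 2).
Proof.
apply: solve_loop; first exact: nz.
by rewrite {1}F_recE //; expand_sums; ring.
Qed.

Lemma F25E : F 2 5 = x ^+ 4 * t ^+ 3 * (x ^+ 4 * F 2 6 + x ^+ 2 * g31 * F 3 6 + g42) /
  (1 - x ^+ 8 * t ^+ 3).
Proof.
apply: solve_loop; first exact: nz.
by rewrite {1}F_recE //; expand_sums; ring.
Qed.

Lemma F16E : F 1 6 = t ^+ 3 * (x ^+ 2 * g21 * F 2 6 + x * g31 * F 3 6 + g41) /
  (1 - x ^+ 3 * t ^+ 3).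
Proof.
apply: solve_loop; first exact: nz.
by rewrite {1}F_recE //; expand_sums; ring.
Qed.

Lemma F15E : F 1 5 = x ^+ 4 * t ^+ 4 * (x ^+ 3 * (g31 * F 1 6) +
   x ^+ 2 * g21 * (x ^+ 2 * F 2 5 + g31 * F 2 6) + x * g31 * (g31 * F 3 6) + g41 * g31) /
  (1 - x ^+ 9 * t ^+ 4).
Proof.
apply: solve_loop; first exact: nz.
by rewrite {1}F_recE //; expand_sums; ring.
Qed.

Lemma F14E : F 1 4 = x ^+ 8 * t ^+ 5 * (x ^+ 3 * (x * g21 * F 1 5 + g31 * F 1 6) +
   x ^+ 2 * g21 * (x * g21 * F 2 5 + g31 * F 2 6) + x * g31 * (g31 * F 3 6) + g41 * g31) /
  (1 - x ^+ 13 * t ^+ 5).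
Proof.
apply: solve_loop; first exact: nz.
by rewrite {1}F_recE //; expand_sums; ring.
Qed.

Lemma F13E : F 1 3 = x ^+ 12 * t ^+ 6 * (x ^+ 3 * (F 1 4 + F 1 5 + F 1 6) +
   x ^+ 2 * g21 * (F 2 5 + F 2 6) + x * g31 * F 3 6 + g41) / (1 - x ^+ 15 * t ^+ 6).
Proof.
apply: solve_loop; first exact: nz.
by rewrite {1}F_recE //; expand_sums; ring.
Qed.

Definition zetaZ4 : R[i] := 1 / ((1 - t) * (1 - x * t) * (1 - x ^+ 2 * t) * (1 - x ^+ 3 * t)).

Let nz1 : 1 - t != 0.
Proof. by have := nz (a := 0) (b := 1) isT isT; rewrite mul1r. Qed.
Let nz2 : 1 - x * t != 0. Proof. exact: (nz (a := 1) (b := 1)). Qed.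
Let nz3 : 1 - x ^+ 2 * t != 0. Proof. exact: (nz (a := 2) (b := 1)). Qed.
Let nz4 : 1 - x ^+ 3 * t != 0. Proof. exact: (nz (a := 3) (b := 1)). Qed.
Let nz5 : 1 - x ^+ 4 * t ^+ 2 != 0. Proof. exact: nz. Qed.
Let nz6 : 1 - x ^+ 3 * t ^+ 3 != 0. Proof. exact: nz. Qed.
Let nz7 : 1 - x ^+ 8 * t ^+ 3 != 0. Proof. exact: nz. Qed.
Let nz8 : 1 - x ^+ 9 * t ^+ 4 != 0. Proof. exact: nz. Qed.
Let nz9 : 1 - x ^+ 13 * t ^+ 5 != 0. Proof. exact: nz. Qed.
Let nz10 : 1 - x ^+ 15 * t ^+ 6 != 0. Proof. exact: nz. Qed.

Ltac side := rewrite ?exprMn; repeat (apply/andP; split => //).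

(** The factor 1 - X_0 cancels the denominator of [resp 6], so this term yields the summand of
    W_0. *)
Lemma lower_sum6 : lower_sum 6 = (1 - Xmon 0) * zetaZ4.
Proof.
rewrite /lower_sum !big_ord_recr big_ord0 /= F_top F16E F26E F36E /Xmon /zetaZ4 mul0n addn0.
by field; side.
Qed.

(** The numerator is p^(-4) Y_1 - p^(-5) X_1, and the denominator 1 - X_1 of the exceptional factor
    E_1 is supplied by [resp 5]. For e = 4 and e = 3 the same happens with E_2 and E_3, and the
    trailing factors there are the Igusa factors in Y_1 and in (Y_2, Y_1). *)
Lemma lower_sum5 : lower_sum 5 = zetaZ4 * ((1 + x ^+ 2) * (1 + x + x ^+ 2)) *
  ((x ^+ 4 * t ^+ 3 - x ^+ 4 * t ^+ 5) / (1 - x ^+ 8 * t ^+ 3)).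
Proof.
rewrite /lower_sum !big_ord_recr big_ord0 /= (F_zero (d := 3)) // (F_zero (d := 4)) //.
rewrite F15E F16E F25E F26E F36E /zetaZ4; field; side.
Qed.

Lemma lower_sum4 : lower_sum 4 = zetaZ4 * ((1 + x) * (1 + x ^+ 2) * (1 + x + x ^+ 2)) *
  ((x ^+ 8 * t ^+ 5 - x ^+ 8 * t ^+ 6) / (1 - x ^+ 13 * t ^+ 5)) *
  (1 + (1 + x^-1) * (x ^+ 8 * t ^+ 3 / (1 - x ^+ 8 * t ^+ 3))).
Proof.
rewrite /lower_sum !big_ord_recr big_ord0 /= (F_zero (d := 2)) //.
rewrite (F_zero (d := 3)) // (F_zero (d := 4)) //.
rewrite F14E F15E F16E F25E F26E F36E /zetaZ4; field; side.
Qed.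

Lemma lower_sum3 : lower_sum 3 = zetaZ4 * ((1 + x ^+ 2) * (1 + x)) *
  ((x ^+ 12 * t ^+ 6 - x ^+ 12 * t ^+ 7) / (1 - x ^+ 15 * t ^+ 6)) *
  (1 + (1 + x^-1 + x ^- 2) * (x ^+ 13 * t ^+ 5 / (1 - x ^+ 13 * t ^+ 5)) +
   (1 + x^-1 + x ^- 2) * (x ^+ 8 * t ^+ 3 / (1 - x ^+ 8 * t ^+ 3)) *
     (1 + (1 + x^-1) * (x ^+ 13 * t ^+ 5 / (1 - x ^+ 13 * t ^+ 5)))).
Proof.
rewrite /lower_sum !big_ord_recr big_ord0 /= (F_zero (d := 2)) //.
rewrite (F_zero (d := 3)) // (F_zero (d := 4)) //.
rewrite F13E F14E F15E F16E F25E F26E F36E /zetaZ4; field; side.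
Qed.

Lemma lower_sum_eq0 e : (e < 3)%N -> lower_sum e = 0.
Proof.
move=> e3; rewrite /lower_sum big1 // => d _; apply: F_zero => //.
by case: d => [[|[|[|[|]]]]] //= _; apply: leq_trans e3 _.
Qed.

End FinalAlgebra.

(** * The local zeta function *)

Section NatPow.
Variables (R : realType) (p : nat).
Hypothesis p_gt0 : (0 < p)%N.
Implicit Types z w s : R[i].

Lemma cexpD z w : cexp (z + w) = cexp z * cexp w.
Proof.
case: z w => [a b] [c d]; rewrite /cexp /= expRD cosD sinD.
by apply/eqP; rewrite eq_complex /=; apply/andP; split; apply/eqP; ring.
Qed.

Lemma absc_cexp z : absc (cexp z) = expR (complex.Re z).
Proof.
case: z => [a b]; rewrite /absc normc_def /= !exprMn -mulrDr cos2Dsin2 mulr1.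
by rewrite sqrtr_sqr ger0_norm // expR_ge0.
Qed.

Lemma natpowD z w : natpow p (z + w) = natpow p z * natpow p w.
Proof. by rewrite /natpow mulrDr cexpD. Qed.

Lemma natpow0 : natpow p (0 : R[i]) = 1.
Proof. by rewrite /natpow mulr0 /cexp /= expR0 cos0 sin0 mulr1 mulr0. Qed.

Lemma natpowMn n z : natpow p (n%:R * z) = natpow p z ^+ n.
Proof.
elim: n => [|n IHn]; first by rewrite mul0r natpow0.
by rewrite -natr1 mulrDl mul1r natpowD IHn exprSr.
Qed.

Lemma natpow1 : natpow p (1 : R[i]) = p%:R.
Proof.
rewrite /natpow mulr1 /cexp /= lnK; last by rewrite posrE ltr0n.
by rewrite cos0 sin0 mulr1 mulr0 -(rmorph_nat (real_complex R)).
Qed.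

Lemma natpow_nat n : natpow p (n%:R : R[i]) = p%:R ^+ n.
Proof. by rewrite -[n%:R]mulr1 natpowMn natpow1. Qed.

Lemma natpow_affine a b s : natpow p (a%:R - b%:R * s) = p%:R ^+ a * natpow p (- s) ^+ b.
Proof. by rewrite -mulrN natpowD natpow_nat natpowMn. Qed.

Lemma absc_natpow s : absc (natpow p s) = expR (ln p%:R * complex.Re s).
Proof.
rewrite /natpow absc_cexp; congr expR.
by case: s => a b; rewrite /= mul0r subr0.
Qed.

Lemma absc_natpowN_lt s : (1 < p)%N -> 3 < complex.Re s -> absc (natpow p (- s)) < p%:R ^- 3.
Proof.
move=> p1 s3; rewrite absc_natpow.
have lnp : 0 < ln (p%:R : R) by rewrite ln_gt0 // ltr1n.
have -> : p%:R ^- 3 = expR (- (ln p%:R * 3)) :> R.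
  by rewrite expRN expRM_natr lnK // posrE ltr0n.
rewrite ltr_expR; case: s s3 => a b /= s3.
by rewrite mulrN ltrN2 ltr_pM2l.
Qed.

End NatPow.

Section Instance.
Variables (R : realType) (p : nat) (p_pr : prime p) (z : R[i]).
Hypothesis z_small : absc z < p%:R ^- 3.
Local Notation x := (p%:R : R[i]).

Lemma one_sub_neq0 a b : (0 < b)%N -> (a <= 3 * b)%N -> 1 - x ^+ a * z ^+ b != 0.
Proof.
move=> b0 ab; apply/eqP => /subr0_eq e.
have : absc (x ^+ a * z ^+ b) < 1.
  have p0 : 0 < p%:R :> R by rewrite ltr0n prime_gt0.
  rewrite abscM !abscX absc_nat.
  have zb : absc z ^+ b < (p%:R ^- 3) ^+ b.
    by rewrite ltrXn2r -?lt0n ?absc_ge0 // ?invr_ge0 ?exprn_ge0 // ltW.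
  have lt : p%:R ^+ a * absc z ^+ b < p%:R ^+ a * (p%:R ^- 3) ^+ b by rewrite ltr_pM2l // exprn_gt0.
  apply: (lt_le_trans lt).
  rewrite exprVn -exprM -ler_pdivlMr ?invr_gt0 ?exprn_gt0 // invrK mul1r.
  by rewrite ler_weXn2l ?ler1n ?prime_gt0.
by rewrite -e (absc_nat R 1) ltxx.
Qed.

Lemma psum_zero d e : (d <= 4)%N -> (e < wedge_rank d)%N -> psum p z d e = 0.
Proof.
move=> d4 lt; apply: psum_eq0 => //; apply: leq_trans (ltnW lt) _.
by case: d d4 {lt} => [|[|[|[|[|]]]]].
Qed.

Lemma psum_gauss_rec d e : (d <= 4)%N -> (e <= 6)%N -> (wedge_rank d <= e)%N ->
  psum p z d e = x ^+ (4 * (6 - e)) * z ^+ height d e *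
    \sum_(d' < 5) x ^+ (d * (4 - d')) * gauss x d' d *
      \sum_(e' < 7) x ^+ ((e - wedge_rank d) * (6 - e')) *
        gauss x (e' - wedge_rank d) (e - wedge_rank d) * psum p z d' e'.
Proof.
move=> d4 e6 le; rewrite psum_rec //; congr (_ * _).
apply: eq_bigr => d' _; rewrite mulr_sumr; apply: eq_bigr => e' _.
have d'4 : (d' <= 4)%N by rewrite -ltnS.
have e'6 : (e' <= 6)%N by rewrite -ltnS.
rewrite /step_card /between_card leq0n !subn0 -/(wedge_rank d) le !natrM !natrX !natr_gaussn.
rewrite subKn // mulrA; case: (ltnP e' (wedge_rank d)) => [lt|le'].
  case: (ltnP d' d) => [ltd|led]; first by rewrite gauss_small // !mulr0 !mul0r.
  by rewrite psum_zero ?mulr0 // (leq_trans lt) // wedge_rank_mono.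
have -> : (6 - wedge_rank d - (6 - e') = e' - wedge_rank d)%N by lia.
by rewrite !mulrA.
Qed.

End Instance.

Lemma igusa1 (R : realType) p (U : nat -> R[i]) :
  igusa p 1 U = 1 + (1 + p%:R^-1) * (U 1%N / (1 - U 1%N)).
Proof.
rewrite igusa_rec big_ord_recr big_ord0 /= igusa_rec big_ord0.
by rewrite !(gaussS, gaussn0, gauss0S); ring.
Qed.

Lemma igusa2 (R : realType) p (U : nat -> R[i]) :
  igusa p 2 U = 1 + (1 + p%:R^-1 + p%:R ^- 2) * (U 1%N / (1 - U 1%N)) +
    (1 + p%:R^-1 + p%:R ^- 2) * (U 2%N / (1 - U 2%N)) *
      (1 + (1 + p%:R^-1) * (U 1%N / (1 - U 1%N))).
Proof.
rewrite igusa_rec !big_ord_recr big_ord0 /= igusa1 igusa_rec big_ord0.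
by rewrite !(gaussS, gaussn0, gauss0S) -exprVn; ring.
Qed.

Section Final.
Variables (R : realType) (p : nat) (p_pr : prime p) (p_odd : odd p) (s : R[i]).
Hypothesis s_gt3 : 3 < complex.Re s.
Local Notation x := (p%:R : R[i]).
Local Notation t := (natpow p (- s) : R[i]).

Let p_gt0 : (0 < p)%N. Proof. exact: prime_gt0. Qed.

Let t_small : absc t < p%:R ^- 3.
Proof. by apply: absc_natpowN_lt => //; exact: prime_gt1. Qed.

Lemma num_normal_F24_gcount n :
  num_normal_subgroups F24 (p ^ n) = (\sum_(d < 5) \sum_(e < 7) gcount p d e n)%N.
Proof.
rewrite (num_normal_F24 (card_normal_heis p_pr p_odd n)) exchange_big.
by apply: eq_bigr => d _ /=; rewrite exchange_big.
Qed.

Lemma series_zeta_terms :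
  series (local_normal_zeta_terms F24 p s) =
  (fun N => \sum_(d < 5) \sum_(e < 7) pser p t d e N).
Proof.
apply/funext => N; rewrite /pser /series /=.
under [RHS]eq_bigr do rewrite exchange_big /=.
rewrite [RHS]exchange_big /=; apply: eq_bigr => n _.
rewrite /local_normal_zeta_terms num_normal_F24_gcount mulNr -mulrN natpowMn.
rewrite natr_sum mulr_suml; apply: eq_bigr => d _.
by rewrite natr_sum mulr_suml.
Qed.

Lemma cvg_zeta_series : series (local_normal_zeta_terms F24 p s) @ \oo -->
  \sum_(d < 5) \sum_(e < 7) psum p t d e.
Proof.
rewrite series_zeta_terms; apply: cvg_bigsum => d; apply: cvg_bigsum => e.
by apply: pser_cvg => //; rewrite -ltnS.
Qed.

Lemma X_E i : (i <= 10)%N -> X_ p s i = Xmon p t i.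
Proof. by move=> i10; rewrite /X_ natpow_affine. Qed.

Lemma Y_1E : Y_ p s 1 = x ^+ 8 * t ^+ 3. Proof. by rewrite /Y_ natpow_affine. Qed.
Lemma Y_2E : Y_ p s 2 = x ^+ 13 * t ^+ 5. Proof. by rewrite /Y_ natpow_affine. Qed.
Lemma Y_3E : Y_ p s 3 = x ^+ 15 * t ^+ 6. Proof. by rewrite /Y_ natpow_affine. Qed.

Lemma igusa_XE k : igusa p k (fun j => X_ p s (6 - j)) = Jsum p t k.
Proof.
by congr igusa; apply/funext => j; rewrite X_E // (leq_trans (leq_subr _ _)).
Qed.

Lemma zeta_pE a b : zeta_p p (b%:R * s - a%:R) = (1 - x ^+ a * t ^+ b)^-1.
Proof. by rewrite /zeta_p opprB natpow_affine. Qed.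

Lemma zeta_Z4E : zeta_Z4 p s = zetaZ4 p t.
Proof.
have E a : zeta_p p (s - a%:R) = (1 - x ^+ a * t)^-1.
  by rewrite -[s]mul1r (zeta_pE a 1) expr1 mul1r.
rewrite /zeta_Z4 -[X in zeta_p p X]subr0 (E 0%N) (E 1%N) !E /zetaZ4.
by rewrite expr0 expr1 !mul1r !invfM.
Qed.

Lemma W_0E : W_ 0 p s = Jsum p t 5.
Proof. by rewrite /W_ igusa_XE /exceptional /= igusa_rec big_ord0 !addr0 !mulr1. Qed.

Lemma W_1E : W_ 1 p s = Jsum p t 4 *
  ((x ^- 4 * (x ^+ 8 * t ^+ 3) - x ^- 5 * Xmon p t 1) / ((1 - Xmon p t 1) * (1 - x ^+ 8 * t ^+ 3))).
Proof.
have -> : W_ 1 p s = igusa p 4 (fun j => X_ p s (6 - j)) *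
  ((x ^- 4 * Y_ p s 1 - x ^- 5 * X_ p s 1) / ((1 - X_ p s 1) * (1 - Y_ p s 1))) *
  igusa p 0 (fun j => Y_ p s (1 - j)) by [].
by rewrite igusa_XE X_E // Y_1E igusa_rec big_ord0 addr0 mulr1.
Qed.

Lemma W_2E : W_ 2 p s = Jsum p t 3 *
  ((x ^- 5 * (x ^+ 13 * t ^+ 5) - x ^- 8 * Xmon p t 2) /
    ((1 - Xmon p t 2) * (1 - x ^+ 13 * t ^+ 5))) *
  (1 + (1 + x^-1) * (x ^+ 8 * t ^+ 3 / (1 - x ^+ 8 * t ^+ 3))).
Proof.
have -> : W_ 2 p s = igusa p 3 (fun j => X_ p s (6 - j)) *
  ((x ^- 5 * Y_ p s 2 - x ^- 8 * X_ p s 2) / ((1 - X_ p s 2) * (1 - Y_ p s 2))) *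
  igusa p 1 (fun j => Y_ p s (2 - j)) by [].
by rewrite igusa_XE igusa1 X_E // -[(2 - 1)%N]/1%N Y_1E Y_2E.
Qed.

Lemma W_3E : W_ 3 p s = Jsum p t 2 *
  ((x ^- 3 * (x ^+ 15 * t ^+ 6) - x ^- 9 * Xmon p t 3) /
    ((1 - Xmon p t 3) * (1 - x ^+ 15 * t ^+ 6))) *
  (1 + (1 + x^-1 + x ^- 2) * (x ^+ 13 * t ^+ 5 / (1 - x ^+ 13 * t ^+ 5)) +
    (1 + x^-1 + x ^- 2) * (x ^+ 8 * t ^+ 3 / (1 - x ^+ 8 * t ^+ 3)) *
      (1 + (1 + x^-1) * (x ^+ 13 * t ^+ 5 / (1 - x ^+ 13 * t ^+ 5)))).
Proof.
have -> : W_ 3 p s = igusa p 2 (fun j => X_ p s (6 - j)) *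
  ((x ^- 3 * Y_ p s 3 - x ^- 9 * X_ p s 3) / ((1 - X_ p s 3) * (1 - Y_ p s 3))) *
  igusa p 2 (fun j => Y_ p s (3 - j)) by [].
by rewrite igusa_XE igusa2 X_E // -[(3 - 1)%N]/2%N -[(3 - 2)%N]/1%N Y_1E Y_2E Y_3E.
Qed.

Lemma psum_total : \sum_(d < 5) \sum_(e < 7) psum p t d e =
  zeta_Z4 p s * zeta_p p (10%:R * s - 24%:R) *
    (W_ 0 p s + (n_1 p)%:R * W_ 1 p s + (n_2 p)%:R * W_ 2 p s
     + (n_3 p)%:R * W_ 3 p s).
Proof.
have p_gt1 := prime_gt1 p_pr; have nz := one_sub_neq0 p_pr t_small.
have Ftop : psum p t 4 6 = 1 := psum_top p_pr t.
have Fz := @psum_zero R p p_pr t.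
have Frec := psum_gauss_rec p_pr t_small.
rewrite (total_sum p_gt1 nz Frec) !big_ord_recr big_ord0 /=.
rewrite !(lower_sum_eq0 Fz (isT : 0 < 3)%N, lower_sum_eq0 Fz (isT : 1 < 3)%N,
  lower_sum_eq0 Fz (isT : 2 < 3)%N).
rewrite !mulr0 !add0r.
rewrite (lower_sum3 p_gt1 nz Ftop Fz Frec) (lower_sum4 p_gt1 nz Ftop Fz Frec).
rewrite (lower_sum5 nz Ftop Fz Frec) (lower_sum6 nz Ftop Fz Frec).
rewrite zeta_Z4E zeta_pE W_0E W_1E W_2E W_3E.
rewrite /resp -[(5 - 5)%N]/0%N -[(5 - 4)%N]/1%N -[(5 - 3)%N]/2%N -[(5 - 2)%N]/3%N.
have x0 : x != 0 by rewrite pnatr_eq0 -lt0n.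
have -> : (n_1 p)%:R = (1 + x ^+ 2) * (1 + x + x ^+ 2) by rewrite /n_1 !(natrM, natrD, natrX); ring.
have -> : (n_2 p)%:R = (1 + x) * (1 + x ^+ 2) * (1 + x + x ^+ 2).
  by rewrite /n_2 !(natrM, natrD, natrX); ring.
have -> : (n_3 p)%:R = (1 + x ^+ 2) * (1 + x) by rewrite /n_3 !(natrM, natrD, natrX); ring.
have e1 : x ^- 4 * (x ^+ 8 * t ^+ 3) - x ^- 5 * Xmon p t 1 = x ^+ 4 * t ^+ 3 - x ^+ 4 * t ^+ 5.
  by rewrite /Xmon; field.
have e2 : x ^- 5 * (x ^+ 13 * t ^+ 5) - x ^- 8 * Xmon p t 2 = x ^+ 8 * t ^+ 5 - x ^+ 8 * t ^+ 6.
  by rewrite /Xmon; field.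
have e3 : x ^- 3 * (x ^+ 15 * t ^+ 6) - x ^- 9 * Xmon p t 3 = x ^+ 12 * t ^+ 6 - x ^+ 12 * t ^+ 7.
  by rewrite /Xmon; field.
rewrite e1 e2 e3.
have -> : Xmon p t 6 = x ^+ 24 * t ^+ 10 by [].
have nX0 : 1 - Xmon p t 0 != 0 by exact: nz.
have nX1 : 1 - Xmon p t 1 != 0 by exact: nz.
have nX2 : 1 - Xmon p t 2 != 0 by exact: nz.
have nX3 : 1 - Xmon p t 3 != 0 by exact: nz.
have nY1 : 1 - x ^+ 8 * t ^+ 3 != 0 by exact: nz.
have nY2 : 1 - x ^+ 13 * t ^+ 5 != 0 by exact: nz.
have nY3 : 1 - x ^+ 15 * t ^+ 6 != 0 by exact: nz.
have nX6 : 1 - x ^+ 24 * t ^+ 10 != 0 by exact: nz.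
(* The Igusa factors, [zetaZ4] and the monomials X_0 to X_3 now match on both sides, so they become
   variables; [field] is left with an identity in which their expansions no longer appear. *)
move: (Jsum p t 2) (Jsum p t 3) (Jsum p t 4) (Jsum p t 5) (zetaZ4 p t) => j2 j3 j4 j5 Z.
move: nX0 nX1 nX2 nX3 => {e1 e2 e3}.
move: (Xmon p t 0) (Xmon p t 1) (Xmon p t 2) (Xmon p t 3) => X0 X1 X2 X3 nX0 nX1 nX2 nX3.

by field; rewrite ?exprMn; repeat (apply/andP; split => //).
Qed.

End Final.

Theorem theorem1p5 (R : realType) :
  exists E : seq nat, forall p : nat, prime p -> p \notin E ->
  forall s : R[i], 3 < complex.Re s ->
  cvgn (series (local_normal_zeta_terms F24 p s)) /\
  local_normal_zeta F24 p s =
    zeta_Z4 p s * zeta_p p (10%:R * s - 24%:R) *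
    (W_ 0 p s + (n_1 p)%:R * W_ 1 p s + (n_2 p)%:R * W_ 2 p s
     + (n_3 p)%:R * W_ 3 p s).
Proof.
(* The prime 2 is excluded because the classification of normal subgroups by homomorphisms halves a
   quadratic form modulo [L]. *)
exists [:: 2%N] => p p_pr; rewrite inE => p_neq2 s s_gt3.
have p_odd : odd p by case: (even_prime p_pr) p_neq2 => // ->.
have zcvg := cvg_zeta_series p_pr p_odd s_gt3.
by split; [exact: cvgP zcvg|rewrite -psum_total //; exact: cvg_lim zcvg].
Qed.
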